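(* Assume the parametric setting below, with $\sigma_\lambda<\infty$ and $(V,\rho_\lambda)$ compact. Suppose there is $a\in(2,\infty]$ with $G(p)<\infty$ for all $p\in[2,a)$, and let $\tau(p):=K_R^d(p)G(p)$ for $p\in[2,a)$, $z(y):=\ln\tau(1/y)$ for $y\in(1/a,1/2]$, $w(x):=\inf_{y\in(1/a,1/2]}(xy+z(y))$, and $$J:=\int_0^1\exp\big(w(H(V,\rho_\lambda,\epsilon))\big)\,d\epsilon .$$ If $J<\infty$, then $f$ satisfies the NCLT in $C(V,\rho_\lambda)$ (the fields $Q_L[f]$, $Q_\infty$ have continuous versions and $\mathbf EF(Q_L[f])\to\mathbf EF(Q_\infty)$ for every bounded continuous $F\colon C(V)\to\mathbb R$ as $\min_ln(l)\to\infty$ along parallelepipeds $L=[1,n(1)]\times\dots\times[1,n(d)]\cap\mathbb Z_+^d$), and $$\sup_{L}\Big\|\sup_{v\in V}Q_L[f](v)\Big\|G\tau<\infty .$$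
   Context: Let $(X_s,\mathcal B_s,\mu_s)$, $s=1,\dots,d$, be probability spaces and $\{\xi_i(s):i\ge1,1\le s\le d\}$ mutually independent random variables, $\xi_i(s)$ with law $\mu_s$. $|\zeta|_p=(\mathbf E|\zeta|^p)^{1/p}$; for a positive function $\psi$ on $[2,a)$, $\|\zeta\|G\psi:=\sup_{p\in[2,a)}|\zeta|_p/\psi(p)$. $N(\vec k)=\max_sk(s)$. Parametric setting: $V$ is a set and $f(v,\vec x)=\sum_{\vec k:N(\vec k)\le M}\lambda(v,\vec k)\prod_{s=1}^dg^{(s)}_{k(s)}(x(s))$, $M\le\infty$, where for each $s$, $g^{(s)}_1,g^{(s)}_2,\dots$ are centered and orthonormal in $L_2(\mu_s)$. $\sigma_\lambda:=\sup_v\sum_{\vec k}|\lambda(v,\vec k)|$; $\rho_\lambda(v_1,v_2):=\sum_{\vec k}|\lambda(v_1,\vec k)-\lambda(v_2,\vec k)|$; $G(p):=\prod_{s=1}^d\sup_{j\ge1}|g^{(s)}_j(\xi_1(s))|_p$. $Q_L[f](v):=|L|^{-1/2}\sum_{\vec k\in L}f(v,\xi_{k(1)}(1),\dots,\xi_{k(d)}(d))$; $Q_\infty(v):=\sum_{N(\vec k)\le M}\lambda(v,\vec k)\prod_s\beta^{(s)}(k(s))$ with $\{\beta^{(s)}(j)\}$ mutually independent standard normal. $N(V,r,\epsilon)$ is the minimal cardinality of an $\epsilon$-net of $(V,r)$ and $H(V,r,\epsilon)=\ln N(V,r,\epsilon)$. $K_R(p)$ is the smallest constant $K$ such that for all $n$,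 real $c_i$ and i.i.d. centered $\zeta_i$ with finite $p$-th moment, $|\sum c_i\zeta_i|_p\le K(\sum c_i^2)^{1/2}|\zeta_1|_p$. *)

(* Defs.v *)
From HB Require Import structures.
From mathcomp Require Import all_boot all_order all_algebra.
From mathcomp Require Import all_classical all_reals all_analysis.
From mathcomp Require Import hoelder normal_distribution.

Set Implicit Arguments.
Unset Strict Implicit.
Unset Printing Implicit Defensive.

Import Order.TTheory GRing.Theory Num.Def Num.Theory.
Import numFieldNormedType.Exports.

Local Open Scope classical_set_scope.
Local Open Scope ring_scope.

Section Defs.
Context {R : realType}.

Definition pnorm {dT} {T : measurableType dT} (P : probability T R)
  (p : R) (zeta : T -> R) : \bar R :=
  Lnorm P p%:E (fun t => (zeta t)%:E).

Definition prange (a : \bar R) : set R := [set p | 2 <= p /\ (p%:E < a)%E].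

Definition Gnorm {dT} {T : measurableType dT} (P : probability T R)
  (a : \bar R) (psi : R -> R) (zeta : T -> R) : \bar R :=
  ereal_sup [set (pnorm P p zeta * (psi p)^-1%:E)%E | p in prange a].

Definition iid_seq {dT} {T : measurableType dT} (P : probability T R)
  (n : nat) (zeta : nat -> T -> R) : Prop :=
  (forall i, (i < n)%N -> measurable_fun setT (zeta i)) /\
  (forall i (A : set R), (i < n)%N -> measurable A ->
      P (zeta i @^-1` A) = P (zeta 0%N @^-1` A)) /\
  (forall A : nat -> set R, (forall i, measurable (A i)) ->
      P (\bigcap_(i in [set i | (i < n)%N]) (zeta i @^-1` A i)) =
      (\prod_(0 <= i < n) P (zeta i @^-1` A i))%E).

Definition rosenthal_bound (p K : R) : Prop :=
  forall (n : nat) (c : nat -> R) (dT : measure_display)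
    (T : measurableType dT) (P : probability T R) (zeta : nat -> T -> R),
    (0 < n)%N ->
    iid_seq P n zeta ->
    (\int[P]_t (zeta 0%N t)%:E = 0)%E ->
    (pnorm P p (zeta 0%N) < +oo)%E ->
    (pnorm P p (fun t => (\sum_(0 <= i < n) c i * zeta i t)%R)
      <= (K * Num.sqrt (\sum_(0 <= i < n) c i ^+ 2))%R%:E
         * pnorm P p (zeta 0%N))%E.

Definition K_R (p : R) : R := inf [set K | 0 <= K /\ rosenthal_bound p K].

Definition kvec (d : nat) := {ffun 'I_d -> nat}.

(* M <= oo : None stands for M = oo *)
Definition in_range (M : option nat) (j : nat) : bool :=
  (1 <= j)%N && (if M is Some m then (j <= m)%N else true).

Definition Kset (d : nat) (M : option nat) : set (kvec d) :=
  [set k | forall s, in_range M (k s)].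
Arguments Kset : clear implicits.

(* sum of a real family over a countable index set, defined as
   (sum of positive parts) - (sum of negative parts); it is the usual sum
   whenever the family is absolutely summable. *)
Definition rsum {I : choiceType} (S : set I) (u : I -> R) : R :=
  fine (\esum_(i in S) (Num.max (u i) 0)%:E) -
  fine (\esum_(i in S) (Num.max (- u i) 0)%:E).

Definition sigma_lam (d : nat) (M : option nat) {V : Type}
  (lam : V -> kvec d -> R) : \bar R :=
  ereal_sup [set (\esum_(k in Kset d M) (`|lam v k|)%:E) | v in [set: V]].

Definition rho_lam (d : nat) (M : option nat) {V : Type}
  (lam : V -> kvec d -> R) (v1 v2 : V) : R :=
  fine (\esum_(k in Kset d M) (`|lam v1 k - lam v2 k|)%:E).

Definition rho_open {V : Type} (rho : V -> V -> R) (U : set V) : Prop :=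
  forall v, U v -> exists2 e : R, 0 < e & forall u, rho v u < e -> U u.

Definition rho_compact {V : Type} (rho : V -> V -> R) : Prop :=
  forall (I : Type) (U : I -> set V), (forall i, rho_open rho (U i)) ->
    (forall v, exists i, U i v) ->
    exists (n : nat) (f : 'I_n -> I), forall v, exists j, U (f j) v.

Definition is_net {V : Type} (rho : V -> V -> R) (eps : R) (n : nat)
  (f : 'I_n -> V) := forall v : V, exists j, rho v (f j) <= eps.

Definition covnum {V : Type} (rho : V -> V -> R) (eps : R) : R :=
  inf [set n%:R | n in [set n : nat | exists f : 'I_n -> V,
        is_net rho eps f]].

Definition entropy {V : Type} (rho : V -> V -> R) (eps : R) : R :=
  ln (covnum rho eps).

Definition is_version {V : Type} {dT} {T : measurableType dT}
  (P : probability T R) (Q Y : V -> T -> R) : Prop :=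
  forall v, exists N : set T, [/\ measurable N, P N = 0%E &
     forall t, Y v t <> Q v t -> N t].

Definition rho_continuous {V : Type} (rho : V -> V -> R) (h : V -> R) : Prop :=
  forall v (e : R), 0 < e -> exists2 del : R, 0 < del &
    forall u, rho v u < del -> `|h u - h v| < e.

Definition cont_paths {V : Type} {T : Type} (rho : V -> V -> R)
  (Y : V -> T -> R) : Prop := forall t, rho_continuous rho (fun v => Y v t).

Definition bounded_continuous_functional {V : Type} (rho : V -> V -> R)
  (F : (V -> R) -> R) : Prop :=
  (exists B : R, forall h, rho_continuous rho h -> `|F h| <= B) /\
  (forall h (e : R), rho_continuous rho h -> 0 < e ->
     exists2 del : R, 0 < del & forall h', rho_continuous rho h' ->
       (forall v, `|h' v - h v| < del) -> `|F h' - F h| < e).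


(* {xi_i(s) : i >= 1, s} mutually independent: product rule for every
   finite subfamily (the subfamily is {i in [1,n]} x {all s}; omitted
   indices are handled by taking A = whole space). *)
Definition indep_xi (d : nat) (dX : 'I_d -> measure_display)
  (X : forall s, measurableType (dX s)) {dO} {Omega : measurableType dO}
  (P : probability Omega R) (xi : nat -> forall s, Omega -> X s) : Prop :=
  forall (n : nat) (A : nat -> forall s, set (X s)),
    (forall i s, measurable (A i s)) ->
    P (\bigcap_(i in [set i | (1 <= i <= n)%N])
         \bigcap_(s in [set: 'I_d]) (xi i s @^-1` A i s)) =
    (\prod_(1 <= i < n.+1) \prod_(s < d) P (xi i s @^-1` A i s))%E.

Definition std_gauss_family (d : nat) {dO} {Omega : measurableType dO}
  (P : probability Omega R) (beta : 'I_d -> nat -> Omega -> R) : Prop :=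
  [/\ (forall s j, (1 <= j)%N -> measurable_fun setT (beta s j)),
      (forall s j (A : set R), (1 <= j)%N -> measurable A ->
         P (beta s j @^-1` A) = normal_prob 0 1 A) &
      (forall (n : nat) (A : 'I_d -> nat -> set R),
        (forall s j, measurable (A s j)) ->
        P (\bigcap_(j in [set j | (1 <= j <= n)%N])
             \bigcap_(s in [set: 'I_d]) (beta s j @^-1` A s j)) =
        (\prod_(1 <= j < n.+1) \prod_(s < d) P (beta s j @^-1` A s j))%E)].

Definition fval (d : nat) (dX : 'I_d -> measure_display)
  (X : forall s, measurableType (dX s)) (M : option nat)
  (g : forall s, nat -> X s -> R) {V : Type} (lam : V -> kvec d -> R)
  (v : V) (x : forall s, X s) : R :=
  rsum (Kset d M) (fun k => lam v k * \prod_(s < d) g s (k s) (x s)).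

Definition QL (d : nat) (dX : 'I_d -> measure_display)
  (X : forall s, measurableType (dX s)) {dO} {Omega : measurableType dO}
  (xi : nat -> forall s, Omega -> X s) (M : option nat)
  (g : forall s, nat -> X s -> R) {V : Type} (lam : V -> kvec d -> R)
  (n : 'I_d -> nat) (v : V) (w : Omega) : R :=
  (Num.sqrt (\prod_(s < d) (n s)%:R))^-1 *
  \sum_(k : {ffun 'I_d -> 'I_(\max_(s < d) n s).+1} |
          [forall s, (1 <= k s <= n s)%N])
     fval M g lam v (fun s => xi (k s) s w).

Definition Qinf (d : nat) {Omega : Type} (M : option nat)
  (beta : 'I_d -> nat -> Omega -> R) {V : Type} (lam : V -> kvec d -> R)
  (v : V) (w : Omega) : R :=
  rsum (Kset d M) (fun k => lam v k * \prod_(s < d) beta s (k s) w).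

Definition Gfun (d : nat) (dX : 'I_d -> measure_display)
  (X : forall s, measurableType (dX s)) {dO} {Omega : measurableType dO}
  (P : probability Omega R) (xi : nat -> forall s, Omega -> X s)
  (M : option nat) (g : forall s, nat -> X s -> R) (p : R) : \bar R :=
  (\prod_(s < d) ereal_sup [set pnorm P p (g s j \o xi 1%N s)
                             | j in [set j | in_range M j]])%E.

Definition tau (d : nat) (Gf : R -> \bar R) (p : R) : R :=
  K_R p ^+ d * fine (Gf p).

Definition yrange (a : \bar R) : set R :=
  [set y | 0 < y <= 1/2 /\ ((1/y)%:E < a)%E].

Definition zfun (tu : R -> R) (y : R) : R := ln (tu (1/y)).
Definition wfun (a : \bar R) (tu : R -> R) (x : R) : R :=
  inf [set x * y + zfun tu y | y in yrange a].

Definition Jint {V : Type} (rho : V -> V -> R) (a : \bar R) (tu : R -> R)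
  : \bar R :=
  (\int[@lebesgue_measure R]_(e in `]0%R, 1%R]) (expR (wfun a tu (entropy rho e)))%:E)%E.

End Defs.

Arguments sigma_lam {R} d M {V} lam.
Arguments rho_lam {R} d M {V} lam v1 v2.

(* Main.v *)
(* The normalised sum factorises over the coordinates: Q_L[f](v) is the series
   of lam(v,k) W_k, where W_k is the product over s of the normalised sums
   n(s)^(-1/2) sum_i g^(s)_k(s)(xi_i(s)).  Independence of the coordinates and
   Rosenthal's inequality give |W_k|_p <= tau(p), uniformly in L, so that the
   increments of Q_L[f] satisfy |Q_L[f](u) - Q_L[f](v)|_p <= tau(p) rho(u,v).
   Chaining along 2^(-i)-nets, with the exponent p optimised at each level,
   bounds E sup_v by the entropy integral J, simultaneously for Q_L[f] and for
   the tails of its series, and uniformly in L.  Hence a common truncation level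
   reduces both the existence of continuous versions and the convergence of
   E F(Q_L[f]) to finitely many terms.  There the normalised sums converge to
   independent normal variables: the trigonometric moments converge by a Taylor
   estimate, and a class of functions closed under multiplication by sines
   contains, by Bernstein approximation in the variable (1 + sin x)/2, all
   bounded Lipschitz functions.  The same convergence transfers the moment bound
   to the products of Gaussian variables.  General bounded continuous F follow
   by infimal convolution. *)

Require Import Defs.
From HB Require Import structures.
From mathcomp Require Import all_boot all_order all_algebra.
From mathcomp Require Import all_classical all_reals all_analysis.
From mathcomp Require Import hoelder normal_distribution.
From mathcomp Require Import measurable_realfun.
From mathcomp Require Import ring lra.

Import Order.TTheory GRing.Theory Num.Def Num.Theory.
Import numFieldNormedType.Exports.

Local Open Scope classical_set_scope.
Local Open Scope ring_scope.

Set Implicit Arguments.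
Unset Strict Implicit.
Unset Printing Implicit Defensive.

(** * Moment bounds *)

(** Three obstacles shape the proof. [K_R] is an infimum of reals, equal to 0 by convention over an
    empty set, so Rosenthal's inequality is first proved with some finite constant; its size is
    irrelevant, because afterwards only the optimal one enters. The set V may be uncountable, so a
    supremum over V need not be measurable: such suprema are bounded pathwise by increasing
    sequences of measurable variables built on nets, and the integral of a nonnegative function is
    monotone in any case. Tightness of laws on C(V) is replaced by approximation: for a Lipschitz
    functional, passing from the field to a partial sum of its series costs at most the Lipschitz
    constant times the mean of an envelope, and these means are bounded alike on all probability
    spaces. For the finite-dimensional limit a moment of some order p in ]2, 3] is enough, since the
    Lyapunov term n^(1 - p/2) vanishes; the assumption a > 2 provides it. *)

Section Integral.
Context {R : realType} d (T : measurableType d) (mu : {measure set T -> \bar R}).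
Local Open Scope ereal_scope.

(** The integral of a nonnegative function is a supremum over the simple functions below it, so
    monotonicity holds for arbitrary functions, in particular for a supremum over an uncountable
    V. *)
Lemma ge0_le_integral_any (f g : T -> \bar R) :
  (forall x, 0 <= f x) -> (forall x, f x <= g x) ->
  \int[mu]_x f x <= \int[mu]_x g x.
Proof.
move=> f0 fg.
have g0 x : 0 <= g x by exact: le_trans (fg x).
rewrite !ge0_integralTE//; apply: ereal_sup_le => _ [h hf <-].
by exists h => //= x; exact: le_trans (fg x).
Qed.

End Integral.

Lemma cvg_powR_seq {R : realType} (p l : R) (u : nat -> R) : 0 < p ->
  (forall n, 0 <= u n) -> u n @[n --> \oo] --> l ->
  u n `^ p @[n --> \oo] --> l `^ p.
Proof.
move=> p0 u0 ul.
have l0 : 0 <= l.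
  rewrite -(cvg_lim _ ul)//; apply: limr_ge; first by apply/cvg_ex; exists l.
  exact: nearW.
(* The power is differentiable only at a positive limit; at the limit 0, [u n < e^(1/p)] gives the
   claim directly. *)
move: l0 ul; rewrite le_eqVlt => /predU1P[<- ul|l0 ul].
  rewrite powR0 ?gt_eqF//; apply/cvgrPdist_lt => e e0.
  have e'0 : 0 < e `^ p^-1 by rewrite powR_gt0.
  move/cvgrPdist_lt : ul => /(_ _ e'0); apply: filterS => n.
  rewrite !sub0r !normrN !ger0_norm ?powR_ge0// => une.
  have -> : e = (e `^ p^-1) `^ p by rewrite -powRrM mulVf ?gt_eqF// powRr1 ?ltW.
  by rewrite gt0_ltr_powR ?nnegrE ?powR_ge0.
apply: (cvg_comp u (@powR R ^~ p) ul).
suff : differentiable (@powR R ^~ p : R^o -> R^o) l.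
  by move/differentiable_continuous.
apply/derivable1_diffP/derivable_powR; by rewrite in_itv/= l0.
Qed.

Section Lp.
Context {R : realType} d (T : measurableType d) (P : probability T R).
Implicit Types (X Y : T -> R) (p q C : R).

(* [Lb p X C]: X is measurable and |X|_p <= C. *)
Definition Lb p X C :=
  measurable_fun setT X /\ (\int[P]_w (`|X w| `^ p)%:E <= (C `^ p)%:E)%E.

Lemma measurable_normp p X : measurable_fun setT X ->
  measurable_fun setT (fun w => (`|X w| `^ p)%:E).
Proof.
move=> mX; apply/measurable_EFinP.
apply: (@measurableT_comp _ _ _ _ _ _ (@powR R ^~ p)).
  exact: measurable_realfun.measurable_powR.
exact: measurableT_comp.
Qed.

Lemma normp_ge0 p X w : (0 <= (`|X w| `^ p)%:E)%E.
Proof. by rewrite lee_fin powR_ge0. Qed.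

Lemma pnorm_powR p X : 0 < p ->
  (pnorm P p X `^ p = \int[P]_w (`|X w| `^ p)%:E)%E.
Proof.
by move=> p0; rewrite /pnorm poweR_Lnorm ?gt_eqF//.
Qed.

Lemma pnorm_le p X C : 0 < p -> 0 <= C ->
  (\int[P]_w (`|X w| `^ p)%:E <= (C `^ p)%:E)%E <-> (pnorm P p X <= C%:E)%E.
Proof.
move=> p0 C0; rewrite -pnorm_powR// -poweR_EFin; split => h.
- have : ((pnorm P p X `^ p) `^ p^-1 <= (C%:E `^ p) `^ p^-1)%E.
    apply: gt0_ler_poweR => //; first by rewrite invr_ge0 ltW.
      by rewrite in_itv/= leey poweR_ge0.
    by rewrite in_itv/= leey lee_fin powR_ge0.
  by rewrite -!poweRrM divff ?gt_eqF// !poweRe1// ?Lnorm_ge0// lee_fin.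
- apply: gt0_ler_poweR => //; first exact: ltW.
    by rewrite in_itv/= leey Lnorm_ge0.
  by rewrite in_itv/= leey andbT lee_fin.
Qed.

Lemma LbP p X C : 0 < p -> 0 <= C -> measurable_fun setT X ->
  Lb p X C <-> (pnorm P p X <= C%:E)%E.
Proof. by move=> p0 C0 mX; rewrite -pnorm_le//; split => [[]|]. Qed.

Lemma Lb_pnorm p X C : 0 < p -> 0 <= C -> Lb p X C -> (pnorm P p X <= C%:E)%E.
Proof. by move=> p0 C0 [mX]; exact: (pnorm_le X p0 C0).1. Qed.

Lemma Lb0 p C : 0 < p -> Lb p (cst 0) C.
Proof.
move=> p0; split => //; under eq_integral do rewrite normr0 powR0 ?gt_eqF//.
by rewrite integral0 lee_fin powR_ge0.
Qed.

Lemma integral_prob_cst (c : R) : (\int[P]_w c%:E = c%:E)%E.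
Proof.
have := integral_cst P measurableT c%:E; rewrite /cst/= => ->.
by rewrite probability_setT mule1.
Qed.

Lemma Lb_le p X Y C : 0 <= p -> measurable_fun setT X ->
  (forall w, `|X w| <= `|Y w|) -> Lb p Y C -> Lb p X C.
Proof.
move=> p0 mX XY [mY YC]; split; [exact: mX|refine (le_trans _ YC)].
apply: ge0_le_integral_any => w; first exact: normp_ge0.
by rewrite lee_fin ge0_ler_powR// nnegrE.
Qed.

Lemma LbW p X C C' : 0 <= p -> 0 <= C -> C <= C' -> Lb p X C -> Lb p X C'.
Proof.
move=> p0 C0 CC' [mX XC]; split; [exact: mX|refine (le_trans XC _)].
by rewrite lee_fin ge0_ler_powR// nnegrE// (le_trans C0).
Qed.

Lemma LbD p X Y C C' : 1 <= p -> 0 <= C -> 0 <= C' ->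
  Lb p X C -> Lb p Y C' -> Lb p (fun w => X w + Y w) (C + C').
Proof.
move=> p1 C0 C'0 XC YC.
have p0 : 0 < p by exact: lt_le_trans p1.
have [mX mY] := (XC.1, YC.1).
apply/LbP => //; [exact: addr_ge0|exact: measurable_funD|].
by rewrite (le_trans (minkowski_EFin P mX mY p1))// EFinD leeD// Lb_pnorm.
Qed.

Lemma LbZ p X C a : 0 <= C -> Lb p X C -> Lb p (fun w => a * X w) (`|a| * C).
Proof.
move=> C0 [mX XC]; split; first exact: measurable_funM.
under eq_integral do rewrite normrM powRM// EFinM.
rewrite ge0_integralZl_EFin ?powR_ge0//; last exact: measurable_normp.
by rewrite powRM// EFinM lee_wpmul2l// lee_fin powR_ge0.
Qed.

Lemma Lb_sum p (I : Type) (r : seq I) (X : I -> T -> R) (C : I -> R) : 1 <= p ->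
  (forall i, 0 <= C i) -> (forall i, Lb p (X i) (C i)) ->
  Lb p (fun w => \sum_(i <- r) X i w) (\sum_(i <- r) C i).
Proof.
move=> p1 C0 XC.
have p0 : 0 < p by exact: lt_le_trans p1.
elim: r => [|i r ih].
  by rewrite big_nil; under eq_fun do rewrite big_nil; exact: Lb0.
rewrite big_cons; under eq_fun do rewrite big_cons.
by apply: LbD => //; exact: sumr_ge0.
Qed.

(** Young's inequality for the product of [y^p] and 1, with conjugate exponents [q / p] and
    [(1 - p / q)^-1]. *)
Lemma powR_le_affine p q (y : R) : 0 < p -> p <= q -> 0 <= y ->
  y `^ p <= (p / q) * y `^ q + (1 - p / q).
Proof.
move=> p0; rewrite le_eqVlt => /predU1P[<-|pq] y0.
  by rewrite divff ?gt_eqF// subrr mul1r addr0.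
have q0 : 0 < q by exact: lt_trans pq.
have qp : 0 < q / p by rewrite divr_gt0.
have h1 : 0 < 1 - p / q by rewrite subr_gt0 ltr_pdivrMr// mul1r.
have := @conjugate_powR R (y `^ p) 1 (q / p) (1 - p / q)^-1 (powR_ge0 _ _) ler01 qp.
rewrite invr_gt0 h1 invrK invf_div subrKC mulr1 powR1 mul1r => /(_ isT erefl).
by rewrite -powRrM mulrC [p * _]mulrC divfK ?gt_eqF.
Qed.

(** Lyapunov's inequality: the affine bound applied to [|X| / C] integrates to the coefficients
    [p / q] and [1 - p / q], which add up to 1. The division is why [C] is positive. *)
Lemma Lb_mono p q X C : 0 < p -> p <= q -> 0 < C -> Lb q X C -> Lb p X C.
Proof.
move=> p0 pq C0 [mX XC]; split; first exact: mX.
have q0 : 0 < q by exact: lt_le_trans pq.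
have Ci : 0 <= C^-1 by rewrite invr_ge0 ltW.
have pt w : `|X w| `^ p <= C `^ p * (p / q) * (C `^ q)^-1 * `|X w| `^ q
                           + C `^ p * (1 - p / q).
  have := powR_le_affine p0 pq (mulr_ge0 (normr_ge0 (X w)) Ci).
  rewrite !powRM// => /(ler_wpM2l (powR_ge0 C p)).
  rewrite mulrCA -(powRM _ (ltW C0) Ci) divff ?gt_eqF// powR1 mulr1.
  move=> /le_trans; apply; rewrite mulrDr lerD2r.
  have -> : C^-1 `^ q = (C `^ q)^-1.
    by rewrite -powR_inv1 ?ltW// -powRrM mulN1r powRN.
  by rewrite le_eqVlt; apply/orP; left; apply/eqP; ring.
have c1 : 0 <= C `^ p * (p / q) * (C `^ q)^-1.
  by rewrite !mulr_ge0 ?powR_ge0 ?invr_ge0 ?powR_ge0// ltW.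
have c2 : 0 <= C `^ p * (1 - p / q).
  by rewrite mulr_ge0 ?powR_ge0// subr_ge0 ler_pdivrMr// mul1r.
apply: (@le_trans _ _ (\int[P]_w ((C `^ p * (p / q) * (C `^ q)^-1)%:E * (`|X w| `^ q)%:E
   + (C `^ p * (1 - p / q))%:E))%E).
  apply: ge0_le_integral_any => w; first exact: normp_ge0.
  by rewrite -EFinM -EFinD lee_fin.
rewrite ge0_integralD//; last 2 first.
- by move=> w _; rewrite mule_ge0 ?lee_fin ?powR_ge0.
- by apply: measurable_funeM; exact: measurable_normp.
rewrite ge0_integralZl_EFin//; last exact: measurable_normp.
rewrite integral_prob_cst.
apply: (@le_trans _ _ ((C `^ p * (p / q) * (C `^ q)^-1)%:E * (C `^ q)%:E + (C `^ p * (1 - p / q))%:E)%E).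
  by rewrite leeD2r// lee_wpmul2l// lee_fin.
by rewrite -EFinM -EFinD lee_fin divfK ?gt_eqF ?powR_gt0// -mulrDr subrKC mulr1.
Qed.

(** The p-th power of a maximum is at most the sum of the p-th powers, whence the factor
    [n^(1/p)]. *)
Lemma Lb_max p n (X : 'I_n -> T -> R) C : 0 < p -> 0 <= C ->
  (forall i, Lb p (X i) C) ->
  Lb p (fun w => \big[Num.max/0]_(i < n) `|X i w|) (n%:R `^ p^-1 * C).
Proof.
move=> p0 C0 XC; split.
  have -> : (fun w => \big[Num.max/0]_(i < n) `|X i w|) =
     \big[(fun f g : T -> R => f \max g)/cst 0]_(i < n) (fun w => `|X i w|).
    by apply/funext => w; elim/big_ind2 : _ => // x f y g -> ->.
  elim/big_ind : _ => // [f g mf mg|i _]; first exact: measurable_maxr.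
  by apply: measurableT_comp => //; exact: (XC i).1.
apply: (@le_trans _ _ (\int[P]_w \sum_(i < n) (`|X i w| `^ p)%:E)%E).
  apply: ge0_le_integral_any => w; first by rewrite lee_fin powR_ge0.
  rewrite sumEFin lee_fin ger0_norm; last first.
    by elim/big_ind : _ => // x y x0 y0; rewrite le_max x0.
  elim/big_ind : _ => [|x y hx hy|i _].
  - by rewrite powR0 ?gt_eqF// sumr_ge0// => i _; exact: powR_ge0.
  - by rewrite /Num.max; case: ifP.
  - by rewrite (bigD1 i)//= lerDl sumr_ge0// => j _; exact: powR_ge0.
rewrite ge0_integral_sum//; last first.
- by move=> i; apply: measurable_normp; exact: (XC i).1.
rewrite powRM ?powR_ge0// -powRrM mulVf ?gt_eqF// powRr1//.
apply: (@le_trans _ _ (\sum_(i < n) (C `^ p)%:E)%E).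
  by apply: lee_sum => i _; exact: (XC i).2.
by rewrite sumEFin lee_fin sumr_const card_ord mulr_natl.
Qed.

(** Fatou's lemma for the p-th powers, which converge by continuity of the power. *)
Lemma Lb_lim p X (X_ : nat -> T -> R) C : 0 < p -> 0 <= C ->
  (forall n, Lb p (X_ n) C) -> (forall w, X_ n w @[n --> \oo] --> X w) -> Lb p X C.
Proof.
move=> p0 C0 XC Xlim; split.
  apply: (measurable_fun_cvg (h := X_)) => //; first by move=> n; exact: (XC n).1.
have mX n : measurable_fun setT (fun w => (`|X_ n w| `^ p)%:E).
  by apply: measurable_normp; exact: (XC n).1.
have := @fatou _ _ _ P setT measurableT (fun n w => (`|X_ n w| `^ p)%:E) mX.
move=> /(_ (fun n w _ => normp_ge0 p (X_ n) w)) h.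
refine (le_trans _ (le_trans h _)).
  apply: ge0_le_integral_any => w; first exact: normp_ge0.
  suff E : (`|X_ n w| `^ p)%:E @[n --> \oo] --> (`|X w| `^ p)%:E.
    by rewrite (cvg_limn_einf_sup E).1.
  apply/cvg_EFin; first exact: nearW.
  apply: (@cvg_powR_seq _ p (`|X w|) (fun n => `|X_ n w|)) => //.
  by apply: cvg_norm; exact: Xlim.
rewrite limn_einf_lim; apply: lime_le; first exact: is_cvg_einfs.
apply: nearW => n; refine (le_trans (ereal_inf_lbound _) (XC n).2).
by exists n => /=.
Qed.

(** [f] is arbitrary, in the application a supremum over V. Pointwise [|f|] is at most the
    increasing limit of [S], to which monotone convergence applies; the slack [e] leaves room for
    the approximation by net points. *)
Lemma pnorm_dom p (f : T -> R) (S : nat -> T -> R) C : 0 < p -> 0 <= C ->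
  (forall I, Lb p (S I) C) -> (forall w I, 0 <= S I w) ->
  (forall w I J, (I <= J)%N -> S I w <= S J w) ->
  (forall w e, 0 < e -> exists I, `|f w| <= S I w + e) ->
  (pnorm P p f <= C%:E)%E.
Proof.
move=> p0 C0 SC S0 Smono fS; apply/pnorm_le => //.
have nd w : {homo (fun I => (`|S I w| `^ p)%:E) : n m / (n <= m)%N >-> (n <= m)%E}.
  move=> I J IJ; rewrite lee_fin ge0_ler_powR ?nnegrE ?(ltW p0)//.
  by rewrite !ger0_norm//; exact: Smono.
have mS I : measurable_fun setT (fun w => (`|S I w| `^ p)%:E).
  by apply: measurable_normp; exact: (SC I).1.
apply: (@le_trans _ _ (\int[P]_w limn (fun I => (`|S I w| `^ p)%:E))%E).
  apply: ge0_le_integral_any => w; first exact: normp_ge0.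
  have /cvg_lim -> // := ereal_nondecreasing_cvgn (nd w).
  have Sle I : ((`|S I w| `^ p)%:E <=
      ereal_sup (range (fun I => (`|S I w| `^ p)%:E)))%E.
    by apply: ereal_sup_ubound; exists I.
  case: ereal_sup Sle => [r Sr|_|/(_ 0%N)]; last 2 first.
  - by rewrite leey.
  - by rewrite leeNy_eq.
  have r0 : 0 <= r by move: (Sr 0%N); rewrite lee_fin; apply: le_trans; exact: powR_ge0.
  have -> : r = (r `^ p^-1) `^ p by rewrite -powRrM mulVf ?gt_eqF// powRr1.
  rewrite lee_fin ge0_ler_powR ?nnegrE ?powR_ge0 ?(ltW p0)//.
  apply/ler_addgt0Pr => e e0; have [I /le_trans] := fS w e e0; apply.
  rewrite lerD2r -[S I w]ger0_norm//.
  have -> : `|S I w| = (`|S I w| `^ p) `^ p^-1 by rewrite -powRrM divff ?gt_eqF// powRr1.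
  by rewrite ge0_ler_powR ?nnegrE ?powR_ge0 ?invr_ge0 ?(ltW p0)// -lee_fin.
rewrite monotone_convergence//.
apply: lime_le.
  apply: ereal_nondecreasing_is_cvgn => I J IJ.
  by apply: ge0_le_integral_any => w; [exact: normp_ge0|exact: nd].
by apply: nearW => I; exact: (SC I).2.
Qed.

End Lp.

(** * Independence *)

Section Indep2.
Context {R : realType} d (T : measurableType d) (P : probability T R).
Implicit Types (U V : T -> R).

Definition indep2 U V := forall A B : set R, measurable A -> measurable B ->
  P (U @^-1` A `&` V @^-1` B) = (P (U @^-1` A) * P (V @^-1` B))%E.

Lemma indep2_comp U V (f g : R -> R) : measurable_fun setT f ->
  measurable_fun setT g -> indep2 U V -> indep2 (f \o U) (g \o V).
Proof.
move=> mf mg UV A B mA mB.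
have mfA : measurable (f @^-1` A) by rewrite -[X in measurable X]setTI; exact: mf.
have mgB : measurable (g @^-1` B) by rewrite -[X in measurable X]setTI; exact: mg.
exact: (UV _ _ mfA mgB).
Qed.

Lemma integrable_distribution (X : {RV P >-> R}) :
  P.-integrable setT (EFin \o X) -> (distribution P X).-integrable setT EFin.
Proof.
move=> /integrableP[_ iX]; apply/integrableP; split => //.
by rewrite ge0_integral_distribution//; exact: measurableT_comp.
Qed.

Section Product.
Variables (U V : T -> R).
Hypotheses (mU : measurable_fun setT U) (mV : measurable_fun setT V).
Hypothesis UV : indep2 U V.

Let mUV : measurable_fun setT (fun w => (U w, V w)).
Proof. exact: measurable_fun_pair. Qed.

Let X1 : {RV P >-> R} := HB.pack_for {mfun T >-> R} U (isMeasurableFun.Build _ _ _ _ U mU).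
Let X2 : {RV P >-> R} := HB.pack_for {mfun T >-> R} V (isMeasurableFun.Build _ _ _ _ V mV).
Let X12 : {RV P >-> (R * R)%type} := HB.pack_for {mfun T >-> (R * R)%type}
  (fun w => (U w, V w)) (isMeasurableFun.Build _ _ _ _ (fun w => (U w, V w)) mUV).

Let joint A : measurable A ->
  (distribution P X1 \x distribution P X2)%E A = distribution P X12 A.
Proof.
apply: product_measure_unique => B C mB mC.
by rewrite /distribution/= /pushforward/= -UV.
Qed.

Lemma indep2_ge0_integralM :
  (forall w, 0 <= U w) -> (forall w, 0 <= V w) ->
  (\int[P]_w (U w * V w)%:E = (\int[P]_w (U w)%:E) * \int[P]_w (V w)%:E)%E.
Proof.
move=> U0 V0.
(* Positive parts make the integrand nonnegative on the whole plane, as Tonelli's theorem requires;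
   along [(U, V)] it is the product itself. *)
pose f (z : R * R) := ((Num.max z.1 0) * (Num.max z.2 0))%:E.
have mm : measurable_fun setT (fun x : R => Num.max x 0).
  by apply: measurable_maxr.
have mf : measurable_fun setT f.
  apply/measurable_EFinP; apply: measurable_funM.
    exact: (measurableT_comp mm (@measurable_fst _ _ _ _)).
  exact: (measurableT_comp mm (@measurable_snd _ _ _ _)).
have f0 z : (0 <= f z)%E by rewrite lee_fin mulr_ge0// le_max lexx orbT.
have -> : (\int[P]_w (U w * V w)%:E = \int[distribution P X12]_z f z)%E.
  rewrite ge0_integral_distribution//; apply: eq_integral => w _ /=.
  by rewrite /f/= !max_l.
rewrite (eq_measure_integral (distribution P X1 \x distribution P X2)%E); last first.
  by move=> A mA _; exact/esym/joint.
rewrite fubini_tonelli1// /fubini_F.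
under eq_integral => x _.
  rewrite /f/=; under eq_integral do rewrite EFinM.
  rewrite ge0_integralZl_EFin//; last 3 first.
    by move=> y _; rewrite lee_fin le_max lexx orbT.
    exact/measurable_EFinP.
    by rewrite le_max lexx orbT.
  rewrite ge0_integral_distribution; last 2 first.
    exact/measurable_EFinP.
    by move=> y; rewrite lee_fin le_max lexx orbT.
  over.
rewrite ge0_integralZr//; last 3 first.
- exact/measurable_EFinP.
- by move=> y _; rewrite lee_fin le_max lexx orbT.
- by apply: integral_ge0 => w _; rewrite lee_fin le_max lexx orbT.
rewrite ge0_integral_distribution; last 2 first.
  exact/measurable_EFinP.
  by move=> y; rewrite lee_fin le_max lexx orbT.
by congr (_ * _)%E; apply: eq_integral => w _ /=; rewrite max_l.
Qed.

End Product.

Lemma indep2_integrableM U V : indep2 U V ->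
  P.-integrable setT (EFin \o U) -> P.-integrable setT (EFin \o V) ->
  P.-integrable setT (EFin \o (fun w => U w * V w)).
Proof.
move=> UV /integrableP[mU iU] /integrableP[mV iV].
move/measurable_EFinP : mU => mU; move/measurable_EFinP : mV => mV.
apply/integrableP; split; first exact/measurable_EFinP/measurable_funM.
under eq_integral do rewrite /= normrM.
rewrite indep2_ge0_integralM//.
- by rewrite lte_mul_pinfty ?ge0_fin_numE ?integral_ge0.
- exact: measurableT_comp.
- exact: measurableT_comp.
- exact: (@indep2_comp _ _ normr normr).
Qed.

Section SignedProduct.
Variables (U V : T -> R).
Hypotheses (iU : P.-integrable setT (EFin \o U)) (iV : P.-integrable setT (EFin \o V)).
Hypothesis UV : indep2 U V.

Let mU : measurable_fun setT U.
Proof. by case/integrableP : iU => /measurable_EFinP. Qed.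
Let mV : measurable_fun setT V.
Proof. by case/integrableP : iV => /measurable_EFinP. Qed.
Let mUV : measurable_fun setT (fun w => (U w, V w)).
Proof. exact: measurable_fun_pair. Qed.

Let X1 : {RV P >-> R} := HB.pack_for {mfun T >-> R} U (isMeasurableFun.Build _ _ _ _ U mU).
Let X2 : {RV P >-> R} := HB.pack_for {mfun T >-> R} V (isMeasurableFun.Build _ _ _ _ V mV).
Let X12 : {RV P >-> (R * R)%type} := HB.pack_for {mfun T >-> (R * R)%type}
  (fun w => (U w, V w)) (isMeasurableFun.Build _ _ _ _ (fun w => (U w, V w)) mUV).

Let joint A : measurable A ->
  (distribution P X1 \x distribution P X2)%E A = distribution P X12 A.
Proof.
apply: product_measure_unique => B C mB mC.
by rewrite /distribution/= /pushforward/= -UV.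
Qed.

Lemma indep2_integralM :
  (\int[P]_w (U w * V w)%:E = (\int[P]_w (U w)%:E) * \int[P]_w (V w)%:E)%E.
Proof.
have iUV := indep2_integrableM UV iU iV.
pose f (z : R * R) := (z.1 * z.2)%:E.
have mf : measurable_fun setT f.
  by apply/measurable_EFinP; apply: measurable_funM.
have -> : (\int[P]_w (U w * V w)%:E = \int[distribution P X12]_z f z)%E.
  by rewrite integral_distribution.
rewrite (eq_measure_integral (distribution P X1 \x distribution P X2)%E); last first.
  by move=> A mA _; exact/esym/joint.
rewrite -integral12_prod_meas1; last first.
  apply/integrableP; split; first exact: mf.
  rewrite (eq_measure_integral (distribution P X12)); last first.
    by move=> A mA _; exact/joint.
  rewrite ge0_integral_distribution//; last exact: measurableT_comp.
  by case/integrableP : iUV.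
rewrite /fubini_F.
under eq_integral => x _.
  rewrite /f/=; under eq_integral do rewrite EFinM.
  rewrite integralZl//; last first.
    exact: integrable_distribution.
  rewrite (@integral_distribution _ _ _ _ _ _ X2 EFin)//.
  over.
have fEV : (\int[P]_w (V w)%:E \is a fin_num)%E by exact: integrable_fin_num.
rewrite -(fineK fEV) integralZr//; last exact: integrable_distribution.
by rewrite (@integral_distribution _ _ _ _ _ _ X1 EFin).
Qed.

End SignedProduct.

End Indep2.

Section PiLambda.
Context {R : realType} d (T : measurableType d) (P : probability T R).
Implicit Types (G H : set (set T)).

Lemma indep_dynkin (D : set T) : measurable D ->
  dynkin [set C | measurable C /\ P (C `&` D) = (P C * P D)%E].
Proof.
move=> mD; split.
- by split => //; rewrite setTI probability_setT mul1e.
- move=> A [mA AD]; split; first exact: measurableC.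
  have -> : ~` A `&` D = D `\` (A `&` D).
    by apply/seteqP; split => x /=; tauto.
  have fA := fin_num_measure P _ mA; have fD := fin_num_measure P _ mD.
  rewrite measureD//; last 2 first.
  + exact: measurableI.
  + by rewrite ltey_eq fin_num_measure.
  rewrite setIA [D `&` A]setIC -setIA setIid.
  rewrite [X in (_ - X)%E](AD : _ = _) probability_setC// muleBl ?mul1e//.
- move=> F tF FD; split.
    by apply: bigcupT_measurable => n; exact: (FD n).1.
  rewrite setI_bigcupl measure_semi_bigcup//; last 3 first.
  + by move=> n; apply: measurableI => //; exact: (FD n).1.
  + exact: trivIset_setIr.
  + by apply: bigcupT_measurable => n; apply: measurableI => //; exact: (FD n).1.
  rewrite measure_semi_bigcup//; last 2 first.
  + by move=> n; exact: (FD n).1.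
  + by apply: bigcupT_measurable => n; exact: (FD n).1.
  rewrite -(fineK (fin_num_measure P _ mD)) muleC -nneseriesZl//.
  apply: eq_eseriesr => n _.
  by rewrite (fineK (fin_num_measure P _ mD)) muleC; exact: (FD n).2.
Qed.

(** The pi-lambda theorem is applied twice: to the first event against a generator of the second
    family, then to the second event against an arbitrary first one. *)
Lemma indep_g_sigma G H : setI_closed G -> setI_closed H ->
  G `<=` measurable -> H `<=` measurable ->
  (forall A B, G A -> H B -> P (A `&` B) = (P A * P B)%E) ->
  forall A B, <<s G >> A -> <<s H >> B -> P (A `&` B) = (P A * P B)%E.
Proof.
move=> GI HI Gm Hm GH.
have key (K : set (set T)) B : setI_closed K -> K `<=` measurable -> measurable B ->
    (forall A, K A -> P (A `&` B) = (P A * P B)%E) ->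
    forall A, <<s K >> A -> measurable A /\ P (A `&` B) = (P A * P B)%E.
  move=> KI Km mB KB A; rewrite -setI_closed_g_dynkin_g_sigma_algebra// => KA.
  by apply: (KA [set C | measurable C /\ P (C `&` B) = (P C * P B)%E]); split;
    [exact: indep_dynkin|move=> C KC; split; [exact: Km|exact: KB]].
have GB A B : <<s G >> A -> H B -> measurable A /\ P (A `&` B) = (P A * P B)%E.
  by move=> GA HB; apply: (key G) => //; [exact: Hm|move=> C GC; exact: GH].
move=> A B GA HB.
have mA : measurable A.
  apply: (key G setT GI Gm measurableT _ A GA).1 => C GC.
  by rewrite setIT probability_setT mule1.
rewrite setIC muleC.
apply: (key H A HI Hm mA _ B HB).2.
by move=> C HC; rewrite setIC muleC; exact: (GB _ _ GA HC).2.
Qed.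

End PiLambda.

(** * Independence of functions of disjoint blocks of coordinates *)

Section Blocks.
Context {R : realType} d (T : measurableType d) (P : probability T R).
Variables (J : finType) (Z : J -> T -> R).
Hypothesis mZ : forall j, measurable_fun setT (Z j).

Definition mindep := forall A : J -> set R, (forall j, measurable (A j)) ->
  P (\bigcap_(j in [set: J]) (Z j @^-1` A j)) = (\prod_j P (Z j @^-1` A j))%E.

(** Product events over a block form a pi-system, unlike the union of the preimages under the single
    coordinates; hence this generator of the sigma-algebra of the block. *)
Definition cylinders (B : pred J) : set (set T) :=
  [set C | exists2 A : J -> set R, (forall j, measurable (A j)) &
           C = \bigcap_(j in [set j | B j]) (Z j @^-1` A j)].

Definition adapted (B : pred J) (U : T -> R) :=
  @measurable_fun _ _ (g_sigma_algebraType (cylinders B)) R setT U.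

Lemma setI_closed_cylinders B : setI_closed (cylinders B).
Proof.
move=> _ _ [A mA ->] [A' mA' ->]; exists (fun j => A j `&` A' j).
  by move=> j; exact: measurableI.
by rewrite -bigcapI; apply: eq_bigcapr => j _; rewrite preimage_setI.
Qed.

Lemma measurable_preZ j A : measurable A -> measurable (Z j @^-1` A).
Proof. by move=> mA; rewrite -[X in measurable X]setTI; exact: mZ. Qed.

Lemma measurable_cylinders B : cylinders B `<=` measurable.
Proof.
move=> _ [A mA ->]; apply: fin_bigcap_measurable; first exact: finite_finset.
by move=> j _; exact: measurable_preZ.
Qed.

Lemma adapted_coord (B : pred J) j : B j -> adapted B (Z j).
Proof.
move=> Bj _ A mA; rewrite setTI; apply: sub_sigma_algebra.
exists (fun i => if i == j then A else setT).
  by move=> i; case: ifP.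
apply/seteqP; split => w /=.
  by move=> ZA i Bi; case: eqP => // ->.
by move=> /(_ j Bj); rewrite eqxx.
Qed.

Lemma mindep_blocks (B B' : pred J) (U V : T -> R) : mindep ->
  (forall j, B j -> ~~ B' j) ->
  adapted B U -> adapted B' V -> indep2 P U V.
Proof.
move=> iZ BB' aU aV A A' mA mA'.
apply: (@indep_g_sigma _ _ _ P (cylinders B) (cylinders B')).
- exact: setI_closed_cylinders.
- exact: setI_closed_cylinders.
- exact: measurable_cylinders.
- exact: measurable_cylinders.
- move=> _ _ [C mC ->] [C' mC' ->].
  have PE (D : pred J) (F : J -> set R) : (forall j, measurable (F j)) ->
      P (\bigcap_(j in [set j | D j]) (Z j @^-1` F j)) =
      (\prod_j (if D j then P (Z j @^-1` F j) else 1))%E.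
    move=> mF; pose F' j := if D j then F j else setT.
    have mF' j : measurable (F' j) by rewrite /F'; case: ifP.
    have -> : \bigcap_(j in [set j | D j]) (Z j @^-1` F j) =
        \bigcap_(j in [set: J]) (Z j @^-1` F' j).
      apply/seteqP; split => w /= h j; rewrite /F'.
        by case: ifP => // Dj _; exact: h.
      by move=> Dj; have := h j I; rewrite /F' Dj.
    rewrite (iZ _ mF'); apply: eq_bigr => j _; rewrite /F'; case: ifP => // _.
    by rewrite preimage_setT probability_setT.
  (* The two product events merge into one over the union of the disjoint blocks, with the sides [C]
     on [B] and the sides [C'] elsewhere. *)
  pose D := [pred j | B j || B' j]; pose F j := if B j then C j else C' j.
  have mF j : measurable (F j) by rewrite /F; case: ifP.
  have -> : \bigcap_(j in [set j | B j]) (Z j @^-1` C j) `&`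
      \bigcap_(j in [set j | B' j]) (Z j @^-1` C' j) =
      \bigcap_(j in [set j | D j]) (Z j @^-1` F j).
    apply/seteqP; split => w /=.
      by move=> [h h'] j /orP[Bj|B'j]; rewrite /F; case: ifP => // Bj';
        [exact: h|move: Bj; rewrite Bj'|exact: h|exact: h'].
    move=> h; split => j Bj; have := h j; rewrite /D/= Bj ?orbT => /(_ isT).
      by rewrite /F Bj.
    by rewrite /F; case: ifP => // /BB'; rewrite Bj.
  rewrite !PE// -big_split/=; apply: eq_bigr => j _; rewrite /F.
  have [Bj|Bj]/= := boolP (B j); last by rewrite mul1e.
  by rewrite (negbTE (BB' _ Bj)) mule1.
- by have := aU measurableT A mA; rewrite setTI.
- by have := aV measurableT A' mA'; rewrite setTI.
Qed.

Lemma adapted_measurable B (U : T -> R) : adapted B U -> measurable_fun setT U.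
Proof.
move=> aU _ A mA; have := aU measurableT A mA; rewrite !setTI.
move=> UA; apply: (UA measurable); split; first exact: sigma_algebra_measurable.
exact: measurable_cylinders.
Qed.

Lemma adaptedS (B B' : pred J) (U : T -> R) : (forall j, B j -> B' j) ->
  adapted B U -> adapted B' U.
Proof.
move=> BB' aU _ A mA; have := aU measurableT A mA; rewrite !setTI.
apply: sub_sigma_algebra2 => _ [C mC ->].
exists (fun j => if B j then C j else setT); first by move=> j; case: ifP.
apply/seteqP; split => w /= h j Bj; first by case: ifP => // /h.
by have := h j (BB' _ Bj); rewrite Bj.
Qed.

(** The product over the remaining indices is adapted to the union of their blocks, which is
    disjoint from the first block; induction splits off one factor at a time. *)
Lemma mindep_ge0_integral_prod (S : eqType) (r : seq S) (B : S -> pred J)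
    (U : S -> T -> R) : mindep -> uniq r ->
  (forall s s' j, B s j -> B s' j -> s = s') ->
  (forall s, adapted (B s) (U s)) -> (forall s w, 0 <= U s w) ->
  (\int[P]_w (\prod_(s <- r) U s w)%:E = \prod_(s <- r) \int[P]_w (U s w)%:E)%E.
Proof.
move=> iZ ur dB aU U0; elim: r ur => [_|s r ih /= /andP[sr ur]].
  by under eq_integral do rewrite big_nil; rewrite big_nil integral_prob_cst.
under eq_integral do rewrite big_cons.
have aprod : adapted [pred j | has (B^~ j) r] (fun w => \prod_(s <- r) U s w).
  elim: r {ih sr ur} => [|t r ihr].
    have -> : (fun w => \prod_(s0 <- [::]) U s0 w) = cst 1.
      by apply/funext => w; rewrite big_nil.
    exact: measurable_cst.
  have -> : (fun w => \prod_(s0 <- t :: r) U s0 w) =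
      (fun w => U t w * \prod_(s0 <- r) U s0 w).
    by apply/funext => w; rewrite big_cons.
  apply: measurable_funM.
    by apply: adaptedS (aU t) => j /= ->.
  by apply: adaptedS ihr => j /= ->; rewrite orbT.
rewrite big_cons indep2_ge0_integralM ?ih//.
- exact: adapted_measurable (aU s).
- exact: adapted_measurable aprod.
- apply: (mindep_blocks iZ _ (aU s) aprod) => j Bj; apply/hasPn => t tr.
  by apply/negP => Btj; move: sr; rewrite (dB _ _ _ Bj Btj) tr.
- by move=> w; exact: prodr_ge0.
Qed.

End Blocks.

(** * Equality in law across probability spaces *)

Section EqualLaw.
Context {R : realType} d d' d'' (T : measurableType d) (T' : measurableType d')
  (E : measurableType d'') (P : probability T R) (P' : probability T' R).
Variables (X : T -> E) (Y : T' -> E).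
Hypotheses (mX : measurable_fun setT X) (mY : measurable_fun setT Y).
Hypothesis XY : forall A, measurable A -> P (X @^-1` A) = P' (Y @^-1` A).

Let X1 : {RV P >-> E} :=
  HB.pack_for {mfun T >-> E} X (isMeasurableFun.Build _ _ _ _ X mX).
Let Y1 : {RV P' >-> E} :=
  HB.pack_for {mfun T' >-> E} Y (isMeasurableFun.Build _ _ _ _ Y mY).

Lemma eq_law_ge0_integral (f : E -> \bar R) : measurable_fun setT f ->
  (forall x, (0 <= f x)%E) -> (\int[P]_w f (X w) = \int[P']_w f (Y w))%E.
Proof.
move=> mf f0.
transitivity (\int[distribution P X1]_x f x)%E.
  by rewrite ge0_integral_distribution.
transitivity (\int[distribution P' Y1]_x f x)%E; last first.
  by rewrite ge0_integral_distribution.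
by apply: eq_measure_integral => A mA _; exact: XY.
Qed.

Lemma eq_law_integrable (f : E -> \bar R) : measurable_fun setT f ->
  P.-integrable setT (f \o X) -> P'.-integrable setT (f \o Y).
Proof.
move=> mf /integrableP[_ iX]; apply/integrableP; split.
  exact: measurableT_comp.
rewrite -(@eq_law_ge0_integral (fun x => `|f x|%E))//.
exact: measurableT_comp.
Qed.

Lemma eq_law_integral (f : E -> \bar R) : measurable_fun setT f ->
  P.-integrable setT (f \o X) -> (\int[P]_w f (X w) = \int[P']_w f (Y w))%E.
Proof.
move=> mf iX; have iY := eq_law_integrable mf iX.
transitivity (\int[distribution P X1]_x f x)%E.
  by rewrite integral_distribution.
transitivity (\int[distribution P' Y1]_x f x)%E; last first.
  by rewrite integral_distribution.
by apply: eq_measure_integral => A mA _; exact: XY.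
Qed.

End EqualLaw.

(** * Rosenthal's inequality *)

Section Taylor.
Context {R : realType}.
Implicit Types (x a b p : R).

(** Inverting [1 - x <= exp (- x)] gives [exp x <= 1 / (1 - x)], and [(1 - x) (1 + x + 2 x^2) - 1 =
    x^2 (1 - 2 x)] is nonnegative. *)
Lemma expR_le_quadratic x : `|x| <= 2^-1 -> expR x <= 1 + x + 2 * x ^+ 2.
Proof.
move=> x2; have [xl xu] : -2^-1 <= x /\ x <= 2^-1.
  by move: x2; rewrite ler_norml => /andP.
have x1 : 0 < 1 - x by lra.
have := expR_ge1Dx (- x); rewrite expRN => h.
have : expR x <= (1 - x)^-1.
  by rewrite -[leLHS]invrK lef_pV2 ?posrE ?invr_gt0 ?expR_gt0.
move=> /le_trans; apply; rewrite -[leLHS]mul1r ler_pdivrMr//.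
have : 0 <= x ^+ 2 * (1 - 2 * x) by rewrite mulr_ge0 ?sqr_ge0//; lra.
by lra.
Qed.

Lemma powR_subr2 p a : 2 <= p -> `|a| `^ p = `|a| `^ (p - 2) * a ^+ 2.
Proof.
move=> p2; rewrite -[a ^+ 2]real_normK ?num_real// -powR_mulrn//.
have [->|a0] := eqVneq a 0.
  by rewrite normr0 powR0 ?powR_mulrn// ?expr0n ?mulr0//; rewrite gt_eqF//; lra.
by rewrite -powRD ?subrK// normr_eq0 a0 implybT.
Qed.

(** The first summand pays for the quadratic remainder when [b] is small compared with [a]; the
    other two pay for [|a + b|^p] and for the linear term when it is not. *)
Definition taylor_cst p : R := 2 * p ^+ 2 + (1 + 2 * p) `^ p + p * (2 * p) `^ (p - 1).

Lemma taylor_cst_ge0 p : 0 <= p -> 0 <= taylor_cst p.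
Proof.
by move=> p0; rewrite /taylor_cst !addr_ge0 ?mulr_ge0 ?powR_ge0 ?sqr_ge0.
Qed.

(** The threshold [2 p |b| <= |a|] makes [u = b / a] satisfy [|p u| <= 1/2], so that
    [(1 + u)^p <= exp (p u)] has a quadratic bound. Beyond the threshold the left side and the
    linear term are at most multiples of [|b|^p]. *)
Lemma powR_taylor p a b : 2 <= p ->
  `|a + b| `^ p <= `|a| `^ p + p * (a * `|a| `^ (p - 2)) * b +
    taylor_cst p * (`|a| `^ (p - 2) * b ^+ 2 + `|b| `^ p).
Proof.
move=> p2; have p0 : 0 < p by lra.
have [ab|ab] := leP (2 * p * `|b|) `|a|.
  have [a0|a0] := eqVneq a 0.
    move: ab; rewrite a0 normr0 => ab.
    have /eqP : `|b| = 0 by have := normr_ge0 b; nra.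
    rewrite normr_eq0 => /eqP ->.
    by rewrite addr0 normr0 expr0n/= powR0 ?gt_eqF// !(mulr0, addr0).
  pose u := b / a.
  have u2 : `|p * u| <= 2^-1.
    rewrite /u !normrM normfV mulrA ler_pdivrMr ?normr_gt0// (ger0_norm (ltW p0)).
    by lra.
  have u1 : 0 < 1 + u.
    by move: u2; rewrite ler_norml => /andP[h _]; nra.
  have -> : a + b = a * (1 + u) by rewrite /u mulrDr mulr1 mulrCA divff// mulr1.
  rewrite normrM (gtr0_norm u1) powRM ?(ltW u1)//.
  have h1 : (1 + u) `^ p <= 1 + p * u + 2 * (p * u) ^+ 2.
    apply: le_trans (expR_le_quadratic u2).
    rewrite /powR gt_eqF// ler_expR ler_pM2l//.
    by apply: le_trans (le_ln1Dx _) _ => //; lra.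
  apply: le_trans (ler_wpM2l (powR_ge0 _ _) h1) _.
  have -> : `|a| `^ p * (1 + p * u + 2 * (p * u) ^+ 2) =
     `|a| `^ p + p * (a * `|a| `^ (p - 2)) * b +
     2 * p ^+ 2 * (`|a| `^ (p - 2) * b ^+ 2).
    by rewrite (powR_subr2 _ p2) /u; field.
  rewrite lerD2l; apply: ler_pM.
  - by rewrite mulr_ge0 ?sqr_ge0.
  - by rewrite mulr_ge0 ?powR_ge0 ?sqr_ge0.
  - by rewrite /taylor_cst -addrA lerDl addr_ge0 ?mulr_ge0 ?powR_ge0// ltW.
  - by rewrite lerDl powR_ge0.
have h1 : `|a + b| `^ p <= (1 + 2 * p) `^ p * `|b| `^ p.
  rewrite -powRM//; last lra.
  rewrite ge0_ler_powR ?nnegrE ?(ltW p0) ?mulr_ge0//; first lra.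
  by apply: le_trans (ler_normD _ _) _; lra.
have h2 : - (p * (2 * p) `^ (p - 1) * `|b| `^ p) <= p * (a * `|a| `^ (p - 2)) * b.
  rewrite lerNl -mulNr.
  apply: le_trans (ler_norm _) _.
  rewrite normrM normrN !normrM (ger0_norm (ltW p0)) (ger0_norm (powR_ge0 _ _)).
  rewrite -[X in `|a| * _ `^ X](_ : p - 1 - 1 = _); last lra.
  rewrite mulr_powRB1//; last lra.
  rewrite -[X in _ <= X]mulrA -!mulrA ler_pM2l//.
  have h3 : `|a| `^ (p - 1) <= (2 * p) `^ (p - 1) * `|b| `^ (p - 1).
    rewrite -powRM//; last lra.
    rewrite ge0_ler_powR ?nnegrE ?mulr_ge0 ?(ltW p0)//; first lra.
    exact: ltW.
  apply: le_trans (ler_wpM2r (normr_ge0 b) h3) _.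
  by rewrite -mulrA [_ * `|b|]mulrC mulr_powRB1.
have h4 := powR_ge0 `|a| p; have h5 := powR_ge0 `|a| (p - 2).
have h6 := powR_ge0 `|b| p; have h7 := sqr_ge0 b.
have h8 : 0 <= taylor_cst p * (`|a| `^ (p - 2) * b ^+ 2).
  by rewrite mulr_ge0 ?taylor_cst_ge0 ?(ltW p0)// mulr_ge0.
have h9 : 0 <= 2 * p ^+ 2 * `|b| `^ p.
  by apply: mulr_ge0 h6; apply: mulr_ge0 => //; exact: sqr_ge0.
have E : taylor_cst p * `|b| `^ p = 2 * p ^+ 2 * `|b| `^ p +
    (1 + 2 * p) `^ p * `|b| `^ p + p * (2 * p) `^ (p - 1) * `|b| `^ p.
  by rewrite /taylor_cst !mulrDl.
rewrite mulrDr E; lra.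
Qed.

(** For [x <= l] the last term dominates, otherwise [x^(r-p) <= l^(r-p)]. Unlike Lyapunov's
    inequality this covers [r = 0], which occurs as [p - 2] at [p = 2]; the price is the factor 2 in
    [Lb_moment]. *)
Lemma powR_interp (x l r p : R) : 0 <= x -> 0 < l -> 0 <= r -> r <= p ->
  x `^ r <= l `^ (r - p) * x `^ p + l `^ r.
Proof.
move=> x0 l0 r0 rp.
have [xl|lx] := leP x l.
  apply: (@le_trans _ _ (l `^ r)); last by rewrite lerDr mulr_ge0 ?powR_ge0.
  by rewrite ge0_ler_powR ?nnegrE// ltW.
apply: (@le_trans _ _ (l `^ (r - p) * x `^ p)); last by rewrite lerDl powR_ge0.
have x1 : 0 < x by exact: lt_trans lx.
have -> : x `^ r = x `^ (r - p) * x `^ p.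
  by rewrite -powRD ?subrK// (gt_eqF x1) implybT.
rewrite ler_wpM2r ?powR_ge0// -opprB !powRN lef_pV2 ?posrE ?powR_gt0//.
by rewrite ge0_ler_powR ?nnegrE ?subr_ge0 ?(ltW x1) ?(ltW l0)// ltW.
Qed.

(** One factor [s + t] is split off, and the remaining power dominates both [s^(q-1)] and [t^(q-1)].
    With [s] the accumulated sum of squares, this gain absorbs the Taylor error of one more
    summand. *)
Lemma powR_addr_ge (s t q : R) : 1 <= q -> 0 <= s -> 0 <= t ->
  s `^ q + 2^-1 * (t * s `^ (q - 1) + t `^ q) <= (s + t) `^ q.
Proof.
move=> q1 s0 t0; have q0 : 0 < q by lra.
have st0 : 0 <= s + t by exact: addr_ge0.
have q10 : 0 <= q - 1 by lra.
rewrite -(mulr_powRB1 st0 q0) -(mulr_powRB1 s0 q0) -(mulr_powRB1 t0 q0).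
have h1 : s `^ (q - 1) <= (s + t) `^ (q - 1).
  by rewrite ge0_ler_powR ?nnegrE// lerDl.
have h2 : t `^ (q - 1) <= (s + t) `^ (q - 1).
  by rewrite ge0_ler_powR ?nnegrE// lerDr.
by nra.
Qed.

End Taylor.

Section Moments.
Context {R : realType} d (T : measurableType d) (P : probability T R).
Implicit Types (X Y Z : T -> R) (p l r al c : R).

Lemma Lb_moment p X l r : 0 < l -> 0 <= r -> r <= p -> Lb P p X l ->
  (\int[P]_w (`|X w| `^ r)%:E <= (2 * l `^ r)%:E)%E.
Proof.
move=> l0 r0 rp [mX Xl].
apply: (@le_trans _ _ (\int[P]_w ((l `^ (r - p))%:E * (`|X w| `^ p)%:E + (l `^ r)%:E))%E).
  apply: ge0_le_integral_any => w; first exact: normp_ge0.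
  by rewrite -EFinM -EFinD lee_fin powR_interp.
rewrite ge0_integralD//; last 3 first.
- by move=> w _; rewrite mule_ge0 ?lee_fin ?powR_ge0.
- by apply: measurable_funeM; exact: measurable_normp.
- by move=> w _; rewrite lee_fin powR_ge0.
rewrite integral_prob_cst ge0_integralZl_EFin ?powR_ge0//; last exact: measurable_normp.
apply: (@le_trans _ _ ((l `^ (r - p))%:E * (l `^ p)%:E + (l `^ r)%:E)%E).
  by rewrite leeD2r// lee_wpmul2l// lee_fin powR_ge0.
rewrite -EFinM -EFinD lee_fin -powRD ?subrK ?(gt_eqF l0) ?implybT//.
by rewrite mulrDl mul1r.
Qed.

Lemma Lb_integrable p X l r : 0 < l -> 0 <= r -> r <= p -> Lb P p X l ->
  P.-integrable setT (EFin \o (fun w => `|X w| `^ r)).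
Proof.
move=> l0 r0 rp Xl; apply/integrableP; split.
  by apply: measurable_normp; exact: Xl.1.
under eq_integral do rewrite /= ger0_norm ?powR_ge0//.
by rewrite (le_lt_trans (Lb_moment l0 r0 rp Xl))// ltry.
Qed.

Lemma Lb_integrable1 p X l : 0 < l -> 1 <= p -> Lb P p X l ->
  P.-integrable setT (EFin \o X).
Proof.
move=> l0 p1 Xl; apply: le_integrable (Lb_integrable l0 ler01 p1 Xl) => //.
  exact/measurable_EFinP/Xl.1.
by move=> w _ /=; rewrite lee_fin powRr1// normr_id.
Qed.

(* Taylor expansion to second order: the linear term vanishes since Z is centered
   and independent of X. *)
Lemma rosenthal_step p X Z c l al : 2 <= p -> 0 < l -> 0 < al ->
  indep2 P X Z -> Lb P p X l -> Lb P p Z al -> (\int[P]_w (Z w)%:E = 0)%E ->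
  (\int[P]_w (`|X w + c * Z w| `^ p)%:E <=
   (l `^ p + taylor_cst p *
     (4 * l `^ (p - 2) * al ^+ 2 * c ^+ 2 + `|c| `^ p * al `^ p))%:E)%E.
Proof.
move=> p2 l0 al0 XZ Xl Zal EZ.
have p0 : 0 <= p by lra.
have p20 : 0 <= p - 2 by lra.
have pp : p - 2 <= p by lra.
have C0 : 0 <= taylor_cst p by exact: taylor_cst_ge0.
have [mX mZ] := (Xl.1, Zal.1).
have mpw r : measurable_fun setT (fun x : R => `|x| `^ r).
  by apply: (@measurableT_comp _ _ _ _ _ _ (@powR R ^~ r)) => //;
    exact: measurable_realfun.measurable_powR.
pose f1 w := `|X w| `^ p.
pose h2 w := X w * `|X w| `^ (p - 2).
pose f2 w := h2 w * Z w.
pose f3 w := `|X w| `^ (p - 2) * `|Z w| `^ 2.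
pose f4 w := `|Z w| `^ p.
have i1 : P.-integrable setT (EFin \o f1) by exact: (Lb_integrable l0 p0 (lexx _) Xl).
have i4 : P.-integrable setT (EFin \o f4) by exact: (Lb_integrable al0 p0 (lexx _) Zal).
have ih2 : P.-integrable setT (EFin \o h2).
  apply: (le_integrable measurableT _ _ (Lb_integrable l0 (_ : 0 <= p - 1) (_ : p - 1 <= p) Xl)).
  - by apply/measurable_EFinP/measurable_funM => //; exact: (measurableT_comp (mpw _)).
  - move=> w _ /=; rewrite lee_fin normrM (ger0_norm (powR_ge0 _ (p - 2))).
    rewrite (ger0_norm (powR_ge0 _ (p - 1))).
    rewrite -[p - 2](_ : p - 1 - 1 = _); last lra.
    by rewrite mulr_powRB1//; lra.
  - lra.
  - lra.
have i2 : P.-integrable setT (EFin \o f2).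
  apply: indep2_integrableM => //; last by apply: (Lb_integrable1 al0 _ Zal); lra.
  apply: (@indep2_comp _ _ _ _ _ _ (fun x => x * `|x| `^ (p - 2)) id) => //.
  by apply: measurable_funM => //.
have XZ3 : indep2 P (fun w => `|X w| `^ (p - 2)) (fun w => `|Z w| `^ 2).
  exact: (@indep2_comp _ _ _ _ _ _ (fun x => `|x| `^ (p - 2)) (fun x => `|x| `^ 2)).
have i3 : P.-integrable setT (EFin \o f3).
  apply: indep2_integrableM => //; first exact: (Lb_integrable l0 p20 pp Xl).
  exact: (Lb_integrable al0 (ler0n _ 2) p2 Zal).
have I2 : (\int[P]_w (f2 w)%:E = 0)%E.
  rewrite indep2_integralM ?EZ ?mule0//.
    by apply: (Lb_integrable1 al0 _ Zal); lra.
  apply: (@indep2_comp _ _ _ _ _ _ (fun x => x * `|x| `^ (p - 2)) id) => //.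
  by apply: measurable_funM => //.
have I3 : (\int[P]_w (f3 w)%:E <= ((2 * l `^ (p - 2)) * (2 * al `^ 2))%:E)%E.
  rewrite indep2_ge0_integralM//; last 2 first.
  - exact: (measurableT_comp (mpw _)).
  - exact: (measurableT_comp (mpw _)).
  rewrite EFinM; apply: lee_pmul.
  - by apply: integral_ge0 => w _; exact: normp_ge0.
  - by apply: integral_ge0 => w _; exact: normp_ge0.
  - exact: (Lb_moment l0 p20 pp Xl).
  - exact: (Lb_moment al0 (ler0n _ 2) p2 Zal).
pose C := taylor_cst p.
apply: (@le_trans _ _ (\int[P]_w ((f1 w)%:E + ((p * c)%:E * (f2 w)%:E +
   ((C * c ^+ 2)%:E * (f3 w)%:E + (C * `|c| `^ p)%:E * (f4 w)%:E))))%E).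
  apply: ge0_le_integral_any => w; first exact: normp_ge0.
  rewrite -!EFinM -!EFinD lee_fin; apply: le_trans (powR_taylor _ _ p2) _.
  rewrite /f1 /f2 /f3 /f4 /h2 normrM powRM// !powR_mulrn// real_normK ?num_real//.
  by rewrite le_eqVlt; apply/orP; left; apply/eqP; rewrite /C; ring.
have i3' := integrableZl measurableT (C * c ^+ 2) i3.
have i4' := integrableZl measurableT (C * `|c| `^ p) i4.
have i2' := integrableZl measurableT (p * c) i2.
rewrite integralD//; last first.
  by apply: integrableD => //; apply: integrableD.
rewrite integralD//; last by apply: integrableD.
rewrite integralD// !integralZl// I2 mule0 add0e EFinD.
apply: leeD; first exact: Xl.2.
rewrite mulrDr EFinD; apply: leeD.
  apply: le_trans (lee_wpmul2l _ I3) _.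
    by rewrite lee_fin mulr_ge0// sqr_ge0.
  rewrite -EFinM lee_fin powR_mulrn ?(ltW al0)//.
  by rewrite le_eqVlt; apply/orP; left; apply/eqP; rewrite /C; ring.
rewrite mulrA [leRHS]EFinM; apply: lee_wpmul2l; last exact: Zal.2.
by rewrite lee_fin mulr_ge0 ?powR_ge0.
Qed.

(** The factor 8 is the 4 of [rosenthal_step] times the 2 that compensates the [2^-1] in
    [powR_addr_ge]; the summand 1 makes powers of the constant increase with the exponent. *)
Definition ros_cst p : R := 1 + 8 * taylor_cst p.

(* The shift [de] keeps the intermediate bounds positive; it tends to 0 in the
   application. *)
Lemma rosenthal_mindep p n (c : nat -> R) (Z : nat -> T -> R) (de al : R) :
  2 <= p -> 0 < de -> 0 < al ->
  (forall i, (i < n)%N -> Lb P p (Z i) al) ->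
  (forall i, (i < n)%N -> (\int[P]_w (Z i w)%:E = 0)%E) ->
  mindep P (fun i : 'I_n => Z i) ->
  Lb P p (fun w => \sum_(0 <= i < n) c i * Z i w)
    (ros_cst p * al * Num.sqrt (de + \sum_(0 <= i < n) c i ^+ 2)).
Proof.
move=> p2 de0 al0 Zal EZ iZ.
have p0 : 0 < p by lra.
have C0 : 0 <= taylor_cst p by apply: taylor_cst_ge0; exact: ltW.
have K1 : 1 <= ros_cst p by rewrite /ros_cst lerDl mulr_ge0.
have K0 : 0 < ros_cst p by apply: lt_le_trans K1.
suff : forall m, (m <= n)%N -> Lb P p (fun w => \sum_(0 <= i < m) c i * Z i w)
    (ros_cst p * al * Num.sqrt (de + \sum_(0 <= i < m) c i ^+ 2)) by apply.
have mZ (i : 'I_n) : measurable_fun setT (Z i) by exact: (Zal _ (ltn_ord i)).1.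
have sumE m : (m <= n)%N -> (fun w => \sum_(0 <= i < m) c i * Z i w) =
    (fun w => \sum_(i < n) (if (i < m)%N then c i * Z i w else 0)).
  move=> mn; apply/funext => w.
  by rewrite big_mkord (big_ord_widen n (fun i => c i * Z i w) mn) big_mkcond.
elim=> [_|m ih mn].
  under eq_fun do rewrite big_geq//.
  exact: Lb0.
set s := \sum_(0 <= i < m) c i ^+ 2 in ih.
have s0 : 0 <= s by apply: sumr_ge0 => i _; exact: sqr_ge0.
have ds0 : 0 < de + s by exact: ltr_wpDr.
set A := ros_cst p * al; have A0 : 0 < A by rewrite mulr_gt0.
have l0 : 0 < A * Num.sqrt (de + s) by rewrite mulr_gt0// sqrtr_gt0.
have Xl := ih (ltnW mn).
have XZ : indep2 P (fun w => \sum_(0 <= i < m) c i * Z i w) (Z m).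
  apply: (mindep_blocks mZ iZ (B := fun j => (j < m)%N) (B' := fun j => j == m :> nat)).
  - by move=> j jm; rewrite ltn_eqF.
  - rewrite (sumE m (ltnW mn)).
    apply: measurable_sum => i; case: (ltnP i m) => im; last exact: measurable_cst.
    apply: measurable_funM; first exact: measurable_cst.
    exact: (@adapted_coord _ _ _ _ (fun j : 'I_n => Z j) (fun j => (j < m)%N) i).
  - exact: (@adapted_coord _ _ _ _ (fun j : 'I_n => Z j) (fun j => j == m :> nat) (Ordinal mn) (eqxx _)).
split.
  rewrite (sumE _ mn); apply: measurable_sum => i; case: (ltnP i m.+1) => _ //.
  exact: measurable_funM.
under eq_integral do rewrite big_nat_recr//=.
apply: le_trans (rosenthal_step (c m) p2 l0 al0 XZ Xl (Zal _ mn) (EZ _ mn)) _.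
rewrite big_nat_recr//= -/s addrA lee_fin.
set t := c m ^+ 2; have t0 : 0 <= t by exact: sqr_ge0.
have sqE (x : R) : 0 <= x -> Num.sqrt x `^ p = x `^ (p / 2).
  by move=> x0; rewrite -powR12_sqrt// -powRrM mulrC.
have sq2 (x : R) : 0 <= x -> Num.sqrt x `^ (p - 2) = x `^ (p / 2 - 1).
  by move=> x0; rewrite -powR12_sqrt// -powRrM; congr (_ `^ _); field.
rewrite !(powRM _ (ltW A0) (sqrtr_ge0 _)) sq2 ?(ltW ds0)// !sqE ?(ltW ds0)//; last first.
  by rewrite addr_ge0// ltW.
have cE : `|c m| `^ p = t `^ (p / 2) by rewrite -sqE// sqrtr_sqr.
rewrite cE.
have q1 : 1 <= p / 2 by lra.
have H := powR_addr_ge q1 (ltW ds0) t0.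
(* The square of the constant is split off from [A^p]; since [8 * taylor_cst p <= ros_cst p ^+ 2],
   it absorbs the Taylor constant. *)
have Ap : A `^ p = ros_cst p ^+ 2 * (A `^ (p - 2) * al ^+ 2).
  have := @powR_subr2 _ p A p2; rewrite gtr0_norm// => ->; rewrite /A; ring.
have alp : al `^ p <= A `^ p / ros_cst p ^+ 2.
  rewrite ler_pdivlMr ?exprn_gt0// /A powRM ?(ltW K0) ?(ltW al0)// mulrC.
  rewrite ler_wpM2r ?powR_ge0// -powR_mulrn ?(ltW K0)//.
  by rewrite ler_powR.
have K2 : 8 * taylor_cst p <= ros_cst p ^+ 2.
  by rewrite /ros_cst; nra.
set w1 := (de + s) `^ (p / 2) in H *; set w2 := (de + s) `^ (p / 2 - 1) in H *.
set w3 := t `^ (p / 2) in H *.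
have w20 : 0 <= w2 by exact: powR_ge0.
have w30 : 0 <= w3 by exact: powR_ge0.
apply: (@le_trans _ _ (A `^ p * (w1 + 2^-1 * (t * w2 + w3)))); last first.
  by rewrite ler_wpM2l ?powR_ge0.
rewrite [leRHS]mulrDr lerD2l.
set B := A `^ (p - 2) * al ^+ 2 in Ap.
have B0 : 0 <= B by rewrite mulr_ge0 ?powR_ge0 ?sqr_ge0.
have alB : al `^ p <= B.
  by apply: le_trans alp _; rewrite Ap mulrAC divff ?mul1r// gt_eqF ?exprn_gt0.
have -> : 4 * (A `^ (p - 2) * w2) * al ^+ 2 * t = 4 * B * (t * w2) by rewrite /B; ring.
rewrite Ap.
have tw : 0 <= t * w2 by exact: mulr_ge0.
have h1 : w3 * al `^ p <= w3 * B by rewrite ler_wpM2l.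
apply: (@le_trans _ _ (taylor_cst p * (4 * B * (t * w2) + w3 * B))).
  by rewrite ler_wpM2l// lerD2l.
have h2 : 0 <= B * (t * w2) by exact: mulr_ge0.
have h3 : 0 <= B * w3 by exact: mulr_ge0.
have h4 : 8 * taylor_cst p * (B * (t * w2)) <= ros_cst p ^+ 2 * (B * (t * w2)).
  by rewrite ler_wpM2r.
have h5 : 8 * taylor_cst p * (B * w3) <= ros_cst p ^+ 2 * (B * w3).
  by rewrite ler_wpM2r.
have h6 : 0 <= taylor_cst p * (B * w3) by exact: mulr_ge0.
by nra.
Qed.

End Moments.

(** * The optimal Rosenthal constant *)

Section KR.
Context {R : realType}.
Implicit Types (p K : R).

Lemma iid_mindep d (T : measurableType d) (P : probability T R) n
  (zeta : nat -> T -> R) : iid_seq P n zeta -> mindep P (fun i : 'I_n => zeta i).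
Proof.
move=> [_ [_ iZ]] A mA.
pose A' i := if insub i is Some j then A j else setT.
have A'E (j : 'I_n) : A' j = A j by rewrite /A' valK.
have mA' i : measurable (A' i) by rewrite /A'; case: insubP.
have -> : \bigcap_(j in [set: 'I_n]) (zeta j @^-1` A j) =
    \bigcap_(i in [set i | (i < n)%N]) (zeta i @^-1` A' i).
  apply/seteqP; split => w /= h.
    by move=> i /= i_n; rewrite -[i]/(val (Ordinal i_n)) A'E; exact: h.
  by move=> j _; rewrite -A'E; apply: h => /=.
rewrite iZ// big_mkord; apply: eq_bigr => j _; by rewrite A'E.
Qed.

(** Nonemptiness of the set that defines [K_R]. The bound is first obtained with the norm [a] and
    the square root enlarged by [e], which keeps them positive; then [e] tends to 0. *)
Lemma rosenthal_exists p : 2 <= p -> exists2 K, 0 <= K & rosenthal_bound p K.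
Proof.
move=> p2; have p0 : 0 < p by lra.
have C0 : 0 <= taylor_cst p by apply: taylor_cst_ge0; exact: ltW.
have K0 : 0 <= ros_cst p by rewrite addr_ge0// mulr_ge0.
exists (ros_cst p) => // n c d T P zeta n0 iid EZ Zfin.
have [mZ [law _]] := iid.
have mZ0 := mZ _ n0.
set a := fine (pnorm P p (zeta 0%N)).
have aE : (pnorm P p (zeta 0%N) = a%:E)%E.
  by rewrite fineK// ge0_fin_numE// Lnorm_ge0.
have a0 : 0 <= a by rewrite fine_ge0// Lnorm_ge0.
set s := \sum_(0 <= i < n) c i ^+ 2.
have s0 : 0 <= s by apply: sumr_ge0 => i _; exact: sqr_ge0.
have key (e : R) : 0 < e ->
    (pnorm P p (fun t => (\sum_(0 <= i < n) c i * zeta i t)%R) <=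
     (ros_cst p * (a + e) * (Num.sqrt s + e))%:E)%E.
  move=> e0; have ae0 : 0 < a + e by exact: ltr_wpDl.
  have L : Lb P p (zeta 0%N) (a + e).
    by apply/LbP => //; [exact: ltW|rewrite aE lee_fin lerDl ltW].
  have := @rosenthal_mindep _ _ _ P p n c zeta (e ^+ 2) (a + e) p2.
  move=> /(_ _ ae0 _ _ (iid_mindep iid))[].
  - by rewrite exprn_gt0.
  - move=> i i_n; split; first exact: mZ.
    rewrite (@eq_law_ge0_integral _ _ _ _ _ _ _ P P (zeta i) (zeta 0%N) _ _ _
      (fun x => (`|x| `^ p)%:E))//.
    + exact: L.2.
    + exact: mZ.
    + by move=> A mA; exact: law.
    + exact: (@measurable_normp _ _ _ p id).
  - move=> i i_n.
    rewrite -(@eq_law_integral _ _ _ _ _ _ _ P P (zeta 0%N) (zeta i) _ _ _ EFin)//.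
    + exact: mZ.
    + by move=> A mA; exact/esym/law.
    + by apply: (@Lb_integrable1 _ _ _ _ p _ (a + e)) => //; lra.
  move=> mS SL.
  have := @Lb_pnorm _ _ _ P p _ _ p0 _ (conj mS SL).
  move=> h; apply: le_trans (h _) _.
    by rewrite !mulr_ge0 ?sqrtr_ge0// ltW.
  rewrite lee_fin ler_wpM2l//; first by rewrite mulr_ge0// ltW.
  have se0 : 0 <= Num.sqrt s + e by rewrite addr_ge0 ?sqrtr_ge0// ltW.
  rewrite -[leRHS](ger0_norm se0) -sqrtr_sqr ler_sqrt ?sqr_ge0// sqrrD sqr_sqrtr//.
  rewrite -/s addrC lerD2r lerDl.
  by rewrite mulrn_wge0// mulr_ge0 ?sqrtr_ge0// ltW.
rewrite -/s aE -EFinM.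
set x := pnorm _ _ _ in key *.
have xfin : x = (fine x)%:E.
  rewrite fineK// ge0_fin_numE ?Lnorm_ge0//.
  by rewrite (le_lt_trans (key 1 ltr01))// ltry.
rewrite xfin lee_fin.
pose D := ros_cst p * (a + Num.sqrt s + 1).
have D0 : 0 <= D by rewrite mulr_ge0// !addr_ge0// sqrtr_ge0.
apply/ler_addgt0Pr => e e0.
(* As [h <= 1], the error is at most [h * D], and the choice makes this at most [e]. *)
pose h := Num.min 1 (e / (D + 1)).
have h0 : 0 < h by rewrite lt_min ltr01 divr_gt0//; lra.
have h1 : h <= 1 by rewrite ge_min lexx.
have hD : h * D <= e.
  have : h <= e / (D + 1) by rewrite ge_min lexx orbT.
  rewrite ler_pdivlMr; last lra.
  by nra.
have := key h h0; rewrite xfin lee_fin => /le_trans; apply.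
have -> : ros_cst p * (a + h) * (Num.sqrt s + h) =
   ros_cst p * Num.sqrt s * a + h * (ros_cst p * (a + Num.sqrt s + h)) by ring.
rewrite lerD2l; apply: le_trans hD; rewrite ler_wpM2l ?(ltW h0)//.
by rewrite ler_wpM2l// lerD2l.
Qed.

(** The inequality is closed in the constant. If [s * a] vanishes, every constant gives the same
    bound 0; otherwise the norm divided by [s * a] is a lower bound of the admissible constants,
    hence at most their infimum. *)
Lemma rosenthal_K_R p : 2 <= p -> rosenthal_bound p (K_R p).
Proof.
move=> p2 n c d T P zeta n0 iid EZ Zfin.
have [K K0 rK] := rosenthal_exists p2.
set s := Num.sqrt _; set x := pnorm _ _ _.
have s0 : 0 <= s by exact: sqrtr_ge0.
set a := fine (pnorm P p (zeta 0%N)).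
have aE : (pnorm P p (zeta 0%N) = a%:E)%E.
  by rewrite fineK// ge0_fin_numE// Lnorm_ge0.
have a0 : 0 <= a by rewrite fine_ge0// Lnorm_ge0.
have key K' : rosenthal_bound p K' -> (x <= (K' * s * a)%:E)%E.
  by move=> h; have := h n c d T P zeta n0 iid EZ Zfin; rewrite aE -EFinM.
have xfin : x = (fine x)%:E.
  rewrite fineK// ge0_fin_numE ?Lnorm_ge0//.
  by rewrite (le_lt_trans (key K rK))// ltry.
rewrite aE -EFinM xfin lee_fin -mulrA.
have [sa|sa] := eqVneq (s * a) 0.
  by have := key K rK; rewrite xfin lee_fin -!mulrA sa !mulr0.
have sa0 : 0 < s * a by rewrite lt0r sa mulr_ge0.
rewrite -ler_pdivrMr//; apply: lb_le_inf; first by exists K.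
by move=> K' [_ rK']; rewrite ler_pdivrMr// mulrA -lee_fin -xfin; exact: key.
Qed.

(** The case of one summand with weight 1. This bound will make tau at least 1, and hence the
    function z nonnegative. *)
Lemma K_R_ge1 d (T : measurableType d) (P : probability T R) (Z : T -> R) p :
  2 <= p -> measurable_fun setT Z -> (\int[P]_t (Z t)%:E = 0)%E ->
  (0 < pnorm P p Z)%E -> (pnorm P p Z < +oo)%E -> 1 <= K_R p.
Proof.
move=> p2 mZ EZ Z0 Zfin.
have [K K0 rK] := rosenthal_exists p2.
apply: lb_le_inf; first by exists K.
move=> K' [K'0 rK'].
have iid : iid_seq P 1 (fun=> Z).
  split => //; split => // A mA; rewrite big_nat1.
  congr (P _); apply/seteqP; split => w; first by move=> h; exact: (h 0%N).
  by move=> h i /=; rewrite ltnS leqn0 => /eqP ->.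
have := rK' 1%N (fun=> 1) d T P (fun=> Z) isT iid EZ Zfin.
rewrite big_nat1 expr1n sqrtr1 mulr1.
under eq_fun do rewrite big_nat1 mul1r.
set a := fine (pnorm P p Z).
have aE : (pnorm P p Z = a%:E)%E by rewrite fineK// ge0_fin_numE// ltW.
by move: Z0; rewrite aE -EFinM lee_fin lte_fin => a0; rewrite -ler_pdivrMr// divff// gt_eqF.
Qed.

End KR.

(** * Entropy and chaining *)

Section Entropy.
Context {R : realType} (V : Type) (rho : V -> V -> R).
Hypotheses (rho_refl : forall v, rho v v = 0) (rho_ge0 : forall u v, 0 <= rho u v)
  (rho_sym : forall u v, rho u v = rho v u)
  (rho_tri : forall u v t, rho u t <= rho u v + rho v t).
Hypothesis Hcomp : rho_compact rho.

(** A set of naturals attains its infimum, so the covering number is the size of an actual net. *)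
Lemma inf_natr (S : set nat) : S !=set0 ->
  exists2 n, S n & inf [set (k%:R : R) | k in S] = n%:R.
Proof.
move=> [k Sk].
have ex : exists n, `[< S n >] by exists k; apply/asboolP.
have [n /asboolP Sn nmin] := ex_minnP ex.
exists n => //; apply/eqP; rewrite eq_le; apply/andP; split.
  apply: inf_lbound; last by exists n.
  by exists 0 => _ [m _ <-]; exact: ler0n.
apply: lb_le_inf; first by exists k%:R, k.
by move=> _ [m Sm <-]; rewrite ler_nat; apply: nmin; apply/asboolP.
Qed.

Lemma net_exists (e : R) : 0 < e -> exists n, exists2 f : 'I_n -> V,
  is_net rho e f & covnum rho e = n%:R.
Proof.
move=> e0; have [|n [f ff] nE] := @inf_natr [set n | exists f : 'I_n -> V, is_net rho e f].
  have [|v|n [f fP]] := @Hcomp V (fun u => [set v | rho v u < e]).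
  - move=> u v /= vu; exists (e - rho v u); first by rewrite subr_gt0.
    move=> t vt; apply: le_lt_trans (rho_tri t v u) _.
    by rewrite rho_sym; lra.
  - by exists v => /=; rewrite rho_refl.
  - by exists n, f => v; have [j /= vj] := fP v; exists j; exact: ltW.
by exists n, f.
Qed.

Lemma covnum_le (e e' : R) : 0 < e -> e <= e' -> covnum rho e' <= covnum rho e.
Proof.
move=> e0 ee'; have [n [f ff ->]] := net_exists e0.
apply: inf_lbound; first by exists 0 => _ [m _ <-]; exact: ler0n.
exists n => //; exists f => v; have [j vj] := ff v; exists j.
exact: le_trans ee'.
Qed.

Lemma covnum_ge1 (v : V) (e : R) : 0 < e -> 1 <= covnum rho e.
Proof.
move=> e0; have [[|n] [f ff ->]] := net_exists e0; first by have [[]] := ff v.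
by rewrite ler1n.
Qed.

Lemma entropy_ge0 (v : V) (e : R) : 0 < e -> 0 <= entropy rho e.
Proof. by move=> e0; rewrite ln_ge0// (covnum_ge1 v). Qed.

Lemma entropy_le (v : V) (e e' : R) : 0 < e -> e <= e' -> entropy rho e' <= entropy rho e.
Proof.
move=> e0 ee'; have c1 := covnum_ge1 v e0; have c1' := covnum_ge1 v (lt_le_trans e0 ee').
by rewrite ler_ln ?posrE ?covnum_le//; lra.
Qed.

Variables (a : \bar R) (tu : R -> R).
Hypotheses (Ha : (2%:E < a)%E) (tu1 : forall p, prange a p -> 1 <= tu p).

Lemma yrange_half : yrange a (1 / 2).
Proof. by split; [lra|rewrite div1r mul1r invrK]. Qed.

Lemma yrange_prange y : yrange a y -> prange a y^-1.
Proof.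
move=> [/andP[y0 y2]]; rewrite div1r => ya; split => //.
by rewrite -[2]invrK lef_pV2 ?posrE ?invr_gt0//; lra.
Qed.

Lemma zfun_ge0 y : yrange a y -> 0 <= zfun tu y.
Proof.
by move=> /yrange_prange yp; rewrite /zfun div1r ln_ge0// tu1.
Qed.

Lemma wfun_le (x y : R) : 0 <= x -> yrange a y -> wfun a tu x <= x * y + zfun tu y.
Proof.
move=> x0 ya; apply: inf_lbound; last by exists y.
exists 0 => _ [t ta <-]; rewrite addr_ge0 ?zfun_ge0//.
by case: ta => /andP[t0 _] _; rewrite mulr_ge0// ltW.
Qed.

Lemma wfun_ge (x c : R) : (forall y, yrange a y -> c <= x * y + zfun tu y) ->
  c <= wfun a tu x.
Proof.
move=> h; apply: lb_le_inf; last by move=> _ [y ya <-]; exact: h.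
by exists (x * (1 / 2) + zfun tu (1 / 2)), (1 / 2) => //; exact: yrange_half.
Qed.

Definition entfun (e : R) := expR (wfun a tu (entropy rho e)).

Lemma entfun_ge0 e : 0 <= entfun e. Proof. exact: expR_ge0. Qed.

Lemma entfun_le (v : V) (e e' : R) : 0 < e -> e <= e' -> entfun e' <= entfun e.
Proof.
move=> e0 ee'; rewrite ler_expR; apply: wfun_ge => y ya.
have e'0 : 0 < e' by exact: lt_le_trans ee'.
apply: le_trans (wfun_le (entropy_ge0 v e'0) ya) _.
rewrite lerD2r ler_wpM2r ?(entropy_le v)//.
by case: ya => /andP[/ltW].
Qed.

(** Logarithms turn [N^(1/q) * tu q] into [x y + z(y)] at [x = ln N] and [y = 1/q], so a bound valid
    for every [q] passes to the infimum [w]. *)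
Lemma entfun_bound (v : V) (e c : R) : 0 < e ->
  (forall q, prange a q -> c <= covnum rho e `^ q^-1 * tu q) -> c <= entfun e.
Proof.
move=> e0 h; have [c0|c0] := leP c 0; first exact: le_trans c0 (entfun_ge0 e).
rewrite -[c]lnK ?posrE// ler_expR; apply: wfun_ge => y ya.
have yp := yrange_prange ya.
have := h _ yp; rewrite invrK -ler_ln ?posrE//; last first.
  by have := h _ yp; rewrite invrK; exact: lt_le_trans.
move=> /le_trans; apply.
have N0 : 0 < covnum rho e by apply: lt_le_trans (covnum_ge1 v e0).
rewrite lnM ?posrE ?powR_gt0//; last first.
  by apply: lt_le_trans (tu1 yp).
by rewrite ln_powR /zfun div1r mulrC.
Qed.

Hypothesis HJ : (Jint rho a tu < +oo)%E.

Definition dyad (i : nat) : R := 2^-1 ^+ i.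

Lemma dyad_gt0 i : 0 < dyad i. Proof. by rewrite exprn_gt0// invr_gt0. Qed.

Lemma dyadS i : dyad i.+1 = dyad i / 2. Proof. by rewrite /dyad exprSr. Qed.

(** [dyad i.+1] is the length of []dyad i.+1, dyad i]], on which the nonincreasing integrand is at
    least [entfun (dyad i)]: the series is a lower sum of the entropy integral. *)
Definition entterm (i : nat) : R := dyad i.+1 * entfun (dyad i).

Lemma entterm_ge0 i : 0 <= entterm i.
Proof. by rewrite mulr_ge0 ?entfun_ge0// ltW ?dyad_gt0. Qed.

Lemma entterm_bounded (v : V) I :
  \sum_(i < I) entterm i <= fine (Jint rho a tu).
Proof.
have J0 : (0 <= Jint rho a tu)%E.
  by apply: integral_ge0 => e _; rewrite lee_fin expR_ge0.
rewrite -lee_fin fineK ?ge0_fin_numE// /Jint integral_mkcond.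
(* A step function below the integrand on []0, 1]], constant on the disjoint intervals []dyad i.+1,
   dyad i]]. *)
pose g I (e : R) := \sum_(i < I) entfun (dyad i) * \1_(`]dyad i.+1, dyad i]%classic) e.
have gI0 I' e : e <= dyad I' -> g I' e = 0.
  move=> eI; rewrite /g big1// => i _.
  rewrite indicE memNset ?mulr0//= in_itv/= => /andP[ie _].
  have : dyad I' <= dyad i.+1.
    by rewrite /dyad ler_iXn2l ?ltn_ord//; lra.
  lra.
have gle I' e : 0 < e -> g I' e <= entfun e.
  move=> e0; elim: I' => [|I' ih]; first by rewrite /g big_ord0 entfun_ge0.
  rewrite /g big_ord_recr/= -/(g I' e) indicE.
  have [|_] := boolP (e \in _); last by rewrite mulr0 addr0.
  rewrite inE/= in_itv/= => /andP[_ eI].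
  by rewrite gI0// add0r mulr1 (entfun_le v).
apply: (@le_trans _ _ (\int[lebesgue_measure]_e (g I e)%:E)%E); last first.
  apply: ge0_le_integral_any => e.
    rewrite lee_fin sumr_ge0// => i _; rewrite mulr_ge0 ?entfun_ge0//.
  rewrite patchE; case: ifPn => [|eD].
    by rewrite inE/= in_itv/= => /andP[e0 _]; rewrite lee_fin gle.
  rewrite lee_fin /g big1// => i _.
  rewrite indicE memNset ?mulr0//= in_itv/= => /andP[ie ei].
  move: eD; rewrite notin_setE/= in_itv/=; apply; apply/andP; split.
    exact: lt_trans (dyad_gt0 _) ie.
  by apply: le_trans ei _; rewrite /dyad exprn_ile1//; lra.
under eq_integral do rewrite /g -sumEFin.
rewrite ge0_integral_sum//; last 2 first.
- move=> i; apply/measurable_EFinP/measurable_funM => //.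
- by move=> i e _; rewrite lee_fin mulr_ge0 ?entfun_ge0.
rewrite -sumEFin; apply: lee_sum => i _.
under eq_integral do rewrite EFinM.
rewrite ge0_integralZl_EFin ?entfun_ge0//; last exact/measurable_EFinP.
rewrite integral_indic//= setIT lebesgue_measure_itv/= lte_fin.
rewrite dyadS ifT; last by rewrite ltr_pdivrMr// ltr_pMr ?dyad_gt0// ltr1n.
rewrite -EFinD -EFinM lee_fin /entterm dyadS mulrC.
by rewrite ler_wpM2l ?entfun_ge0//; lra.
Qed.

Lemma entterm_tail (v : V) (r : R) : 0 < r ->
  exists i0, forall I, \sum_(i0 <= i < I) entterm i <= r.
Proof.
move=> r0.
pose S := [set \sum_(0 <= i < I) entterm i | I in [set: nat]].
have hS : has_sup S.
  split; first by exists 0, 0%N => //; rewrite big_geq.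
  by exists (fine (Jint rho a tu)) => _ [I _ <-]; rewrite big_mkord; exact: entterm_bounded v I.
have [_ [i0 _ <-] hi] := sup_adherent r0 hS.
exists i0 => I; have [Ii|iI] := leqP I i0; first by rewrite big_geq// ltW.
have : \sum_(0 <= i < I) entterm i <= sup S by apply: sup_upper_bound => //; exists I.
rewrite (big_cat_nat (n := i0))//=; last exact: ltnW.
lra.
Qed.

End Entropy.

(** * Chaining along dyadic nets *)

Section Chaining.
Context {R : realType} d (T : measurableType d) (P : probability T R).
Variables (V : Type) (rho : V -> V -> R).
Hypotheses (rho_refl : forall v, rho v v = 0) (rho_ge0 : forall u v, 0 <= rho u v)
  (rho_sym : forall u v, rho u v = rho v u)
  (rho_tri : forall u v t, rho u t <= rho u v + rho v t).
Hypothesis Hcomp : rho_compact rho.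
Variables (a : \bar R) (tu : R -> R).
Hypotheses (Ha : (2%:E < a)%E) (tu1 : forall p, prange a p -> 1 <= tu p).
Variable v0 : V.

(* For an exponent q >= p the q-th moments give the factor n^(1/q) tau(q); for
   q < p one has n^(1/p) <= n^(1/q).  The infimum over q is exp (w (ln n)). *)
Lemma max_increment (n : nat) (X : 'I_n -> T -> R) (e eps p : R) :
  0 < e -> 0 < eps -> covnum rho e = n%:R -> prange a p ->
  (forall q j, prange a q -> Lb P q (X j) (tu q * eps)) ->
  Lb P p (fun w => \big[Num.max/0]_(j < n) `|X j w|)
    (tu p * (eps * entfun rho a tu e)).
Proof.
move=> e0 eps0 nE pa XL.
have p0 : 0 < p by have [] := pa; lra.
have tp1 := tu1 pa; have tp0 : 0 < tu p by exact: lt_le_trans tp1.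
have n1 : 1 <= n%:R :> R by rewrite -nE; apply: (covnum_ge1 _ _ _ _ v0).
have n0 : 0 < n%:R :> R by exact: lt_le_trans n1.
have mM : measurable_fun setT (fun w => \big[Num.max/0]_(j < n) `|X j w|).
  by apply: (@Lb_max _ _ _ P p n X (tu p * eps) p0 _ (fun j => XL p j pa)).1;
    rewrite mulr_ge0 ?ltW.
have ent0 := entfun_ge0 rho a tu e.
apply/LbP => //; first by rewrite !mulr_ge0// ltW.
have key q : prange a q ->
    (pnorm P p (fun w => (\big[Num.max/0]_(j < n) `|X j w|)%R) <=
     (tu p * eps * (n%:R `^ q^-1 * tu q))%:E)%E.
  move=> qa; have q0 : 0 < q by have [] := qa; lra.
  have tq1 := tu1 qa; have tq0 : 0 < tu q by exact: lt_le_trans tq1.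
  have nq0 : 0 < n%:R `^ q^-1 :> R by exact: powR_gt0.
  apply: Lb_pnorm => //; first by rewrite !mulr_ge0// ltW.
  have [pq|qp] := leP p q.
    apply: (@Lb_mono _ _ _ _ p q) => //; first by rewrite !mulr_gt0.
    apply: LbW (Lb_max q0 _ (fun j => XL q j qa)); first exact: ltW.
    - by rewrite !mulr_ge0// ltW.
    - have : 0 <= n%:R `^ q^-1 * tu q * eps by rewrite !mulr_ge0// ltW.
      by nra.
    - by rewrite mulr_ge0// ltW.
  have npq : n%:R `^ p^-1 <= n%:R `^ q^-1 :> R.
    by rewrite ler_powR// lef_pV2 ?posrE// ltW.
  apply: LbW (Lb_max p0 _ (fun j => XL p j pa)); first exact: ltW.
  - by rewrite !mulr_ge0 ?powR_ge0// ltW.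
  - have tpe : 0 <= tu p * eps by rewrite mulr_ge0// ltW.
    rewrite mulrC ler_wpM2l//; apply: le_trans npq _.
    by rewrite ler_peMr// ltW.
  - by rewrite mulr_ge0// ltW.
set x := pnorm _ _ _ in key *.
have xfin : x = (fine x)%:E.
  rewrite fineK// ge0_fin_numE ?Lnorm_ge0//.
  have ha : prange a p by [].
  by rewrite (le_lt_trans (key p ha))// ltry.
rewrite xfin lee_fin mulrA -ler_pdivrMl ?mulr_gt0//.
apply: (entfun_bound _ _ _ _ _ _ v0) => // q qa.
by rewrite nE ler_pdivrMl ?mulr_gt0// -lee_fin -xfin key.
Qed.

Variable Y : V -> T -> R.
Hypothesis Ycont : cont_paths rho Y.
Hypothesis Yinc : forall p u v, prange a p ->
  Lb P p (fun w => Y u w - Y v w) (tu p * rho u v).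

Lemma nets : exists N : nat -> nat, exists F : forall i, 'I_(N i) -> V,
  forall i, is_net rho (dyad i) (F i) /\ covnum rho (dyad i) = (N i)%:R.
Proof.
have h i : exists n, exists f : 'I_n -> V,
    is_net rho (dyad i) f /\ covnum rho (dyad i) = n%:R.
  have [n [f ff fn]] := net_exists rho_refl rho_sym rho_tri Hcomp (dyad_gt0 i).
  by exists n, f.
exists (fun i => sval (cid (h i))), (fun i => sval (cid (svalP (cid (h i))))).
by move=> i; exact: svalP (cid (svalP (cid (h i)))).
Qed.

(** [S I] is the sum of [|Y|] over the net of level [i0] plus the maximal increments of the levels
    from [i0] to [I]; continuity of paths lets the nets reach every [v]. The coarsest level is
    summed rather than chained, since its bounds [b] can be made small separately. One sequence [S]
    serves all exponents [p]. *)
Lemma chaining (N : nat -> nat) (F : forall i, 'I_(N i) -> V) (i0 : nat)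
    (b : 'I_(N i0) -> R) (r : R) :
  (forall i, is_net rho (dyad i) (F i) /\ covnum rho (dyad i) = (N i)%:R) ->
  (forall j, 0 <= b j) ->
  (forall p j, prange a p -> Lb P p (Y (F i0 j)) (tu p * b j)) ->
  (forall I, \sum_(i0.+1 <= i < I) entterm rho a tu i <= r) ->
  exists S : nat -> T -> R,
  [/\ forall p I, prange a p -> Lb P p (S I) (tu p * (\sum_j b j + 4 * r)),
      forall w I, 0 <= S I w,
      forall w I J, (I <= J)%N -> S I w <= S J w &
      forall v w e, 0 < e -> exists I, `|Y v w| <= S I w + e].
Proof.
move=> NF b0 Fb tail.
pose pi_ i v := sval (cid ((NF i).1 v)).
have pi_P i v : rho v (F i (pi_ i v)) <= dyad i by exact: svalP (cid ((NF i).1 v)).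
pose M i w : R := \big[Num.max/0]_(j < N i.+1)
  `|Y (F i.+1 j) w - Y (F i (pi_ i (F i.+1 j))) w|.
pose S0 w : R := \sum_(j < N i0) `|Y (F i0 j) w|.
pose S I w : R := S0 w + \sum_(i0 <= i < I) M i w.
have M0 i w : 0 <= M i w.
  by rewrite /M; elim/big_ind : _ => // x y x0 y0; rewrite le_max x0.
have S00 w : 0 <= S0 w by apply: sumr_ge0.
have tp p : prange a p -> 0 < tu p by move=> pa; exact: lt_le_trans (tu1 pa).
have te p i : prange a p -> 0 <= tu p * (4 * entterm rho a tu i.+1).
  move=> pa; apply: mulr_ge0; first exact/ltW/tp.
  by apply: mulr_ge0 => //; exact: entterm_ge0.
have ML i p : prange a p -> Lb P p (M i) (tu p * (4 * entterm rho a tu i.+1)).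
  move=> pa.
  (* An increment between levels [i.+1] and [i] spans a distance of at most [dyad i], four times the
     weight [dyad i.+2] in [entterm]. *)
  have -> : 4 * entterm rho a tu i.+1 = dyad i * entfun rho a tu (dyad i.+1).
    by rewrite /entterm !dyadS; field.
  apply: max_increment => //; first exact: dyad_gt0.
  - exact: dyad_gt0.
  - exact: (NF i.+1).2.
  - move=> q j qa; apply: LbW (Yinc _ _ qa).
    + by have [] := qa; lra.
    + by rewrite mulr_ge0// ltW// tp.
    + by rewrite ler_wpM2l ?pi_P// ltW// tp.
exists S; split.
- move=> p I pa; have p1 : 1 <= p by have [] := pa; lra.
  have p0 : 0 <= p by lra.
  have L0 : Lb P p S0 (\sum_j tu p * b j).
    apply: Lb_sum => // j; first by rewrite mulr_ge0// ltW// tp.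
    apply: Lb_le (Fb p j pa) => //; last by move=> w; rewrite normr_id.
    by apply: measurableT_comp => //; exact: (Fb p j pa).1.
  have L1 : Lb P p (fun w => \sum_(i0 <= i < I) M i w)
      (\sum_(i0 <= i < I) tu p * (4 * entterm rho a tu i.+1)).
    apply: Lb_sum => // i; last exact: ML.
    exact: te.
  apply: LbW (LbD p1 _ _ L0 L1) => //.
  + apply: addr_ge0; last by apply: sumr_ge0 => i _; exact: te.
    by apply: sumr_ge0 => j _; rewrite mulr_ge0// ltW// tp.
  + rewrite -!mulr_sumr -mulrDr ler_wpM2l ?(ltW (tp _ pa))// lerD2l.
    rewrite ler_wpM2l//; apply: le_trans (tail I.+1).
    by rewrite big_add1.
  + by rewrite sumr_ge0// => j _; rewrite mulr_ge0// ltW// tp.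
  + by apply: sumr_ge0 => i _; exact: te.
- by move=> w I; rewrite addr_ge0// sumr_ge0.
- move=> w I J IJ; rewrite lerD2l.
  have [Ii|iI] := leqP I i0; first by rewrite [leLHS]big_geq// sumr_ge0.
  by rewrite (big_cat_nat (n := I) (p := J))//= ?lerDl ?sumr_ge0// ltnW.
- move=> v w e e0.
  have [del del0 Ydel] := Ycont w v e0.
  have [I0 I0del] : exists I0, dyad I0 < del.
    have h2 : `|2^-1 : R| < 1 by rewrite ger0_norm//; lra.
    have /cvgrPdist_lt/(_ del del0)[n _ hn] := cvg_expr h2.
    exists n; have := hn n (leqnn n).
    by rewrite /= sub0r normrN ger0_norm// ltW// dyad_gt0.
  pose I := (i0 + I0)%N.
  (* Induction along the chain: the value at a net point of level [i0 + k] is bounded by the sum up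
     to that level. *)
  have YI k j : `|Y (F (i0 + k)%N j) w| <= S (i0 + k)%N w.
    elim: k j => [|k ih].
      rewrite addn0 => j; rewrite /S big_geq// addr0 /S0.
      by rewrite (bigD1 j)//= lerDl sumr_ge0.
    rewrite addnS => j; rewrite /S big_nat_recr ?leq_addr//= addrA.
    set u := pi_ (i0 + k)%N (F (i0 + k).+1 j).
    have -> : Y (F (i0 + k).+1 j) w = Y (F (i0 + k)%N u) w +
       (Y (F (i0 + k).+1 j) w - Y (F (i0 + k)%N u) w) by rewrite addrC subrK.
    apply: le_trans (ler_normD _ _) _; apply: lerD; first exact: ih.
    exact: (le_bigmax _ (fun j => `|Y (F (i0 + k).+1 j) w -
      Y (F (i0 + k)%N (pi_ (i0 + k)%N (F (i0 + k).+1 j))) w|)).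
  exists I; have vI : rho v (F I (pi_ I v)) < del.
    apply: le_lt_trans (pi_P I v) _; apply: le_lt_trans I0del.
    by rewrite /dyad ler_iXn2l ?leq_addl//; lra.
  have -> : Y v w = Y (F I (pi_ I v)) w - (Y (F I (pi_ I v)) w - Y v w).
    by rewrite opprB addrC subrK.
  apply: le_trans (ler_normB _ _) _; apply: lerD; first exact: YI.
  exact/ltW/Ydel.
Qed.

End Chaining.

(** * Trigonometric moments of the normal law *)

Section Gauss.
Context {R : realType}.
Notation mu := (@lebesgue_measure R).
Notation ph := (@normal_pdf R 0 1).
Notation NP := (@normal_prob R 0 1).

Lemma integral_normal_prob (f : R -> \bar R) : measurable_fun setT f ->
  (\int[NP]_x `|f x| < +oo)%E ->
  (\int[NP]_x f x = \int[mu]_x (f x * (ph x)%:E))%E.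
Proof.
move=> mf finf.
rewrite -(Radon_Nikodym_change_of_variables (normal_prob_dominates 0 1))//=; last first.
  by apply/integrableP; split.
apply: ae_eq_integral => //.
- apply: emeasurable_funM => //; apply: (measurable_int mu).
  by apply: Radon_Nikodym_integrable; exact: normal_prob_dominates.
- apply: emeasurable_funM => //=; apply/measurableT_comp => //=.
  exact: measurable_normal_pdf.
- apply: ae_eqe_mul2l => /=.
  rewrite Radon_NikodymE//=; first exact: normal_prob_dominates.
  move=> abmu.
  case: cid => /= h [h1 h2 h3].
  apply: integral_ae_eq => //=.
  + by apply/measurableT_comp => //; exact: measurable_normal_pdf.
  + by move=> E E01 mE; rewrite -h3.
Qed.

Lemma phE x : ph x = normal_peak 1 * expR (- x ^+ 2 / 2).
Proof.
by rewrite normal_pdfE ?oner_eq0// /normal_fun subr0 expr1n.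
Qed.

(** Since [|x| <= exp (x^2 / 4)], the integrand is at most a multiple of [exp (- x^2 / 8)], the
    shape of the normal density with standard deviation 2. *)
Lemma normal_moment_integrable : mu.-integrable [set: R] (EFin \o (fun x => `|x| * ph x)).
Proof.
have h2 : (2 : R) != 0 by rewrite pnatr_eq0.
have p2 := normal_peak_gt0 h2.
pose c : R := normal_peak 1 / normal_peak (2 : R).
have mf : measurable_fun [set: R] (fun x => `|x| * ph x).
  by apply: measurable_funM; [exact: measurable_realfun.normr_measurable|exact: measurable_normal_pdf].
apply: (le_integrable measurableT _ _
  (integrableZl measurableT c (integrable_normal_pdf (0 : R) (2 : R)))).
  by move/measurable_EFinP : mf => mf; exact: mf.
move=> x _ /=; rewrite lee_fin.
have c0 : 0 <= c by rewrite divr_ge0 ?normal_peak_ge0.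
have n1 : 0 <= `|x| * ph x by rewrite mulr_ge0 ?normal_pdf_ge0.
have n2 : 0 <= c * normal_pdf 0 2 x by rewrite mulr_ge0 ?normal_pdf_ge0.
rewrite (ger0_norm n1) (ger0_norm n2) {n1 n2}; move: (x : R) => {}x.
rewrite phE normal_pdfE// /normal_fun subr0 /c !mulrA divfK ?gt_eqF//.
rewrite [`|x| * _]mulrC -mulrA ler_wpM2l ?normal_peak_ge0//.
have h : `|x| <= expR (x ^+ 2 / 4).
  apply: le_trans (expR_ge1Dx _).
  rewrite -[x ^+ 2]real_normK ?num_real//.
  have := sqr_ge0 (`|x| / 2 - 1); lra.
apply: le_trans (ler_wpM2r (expR_ge0 _) h) _.
rewrite -expRD ler_expR; have := sqr_ge0 x; lra.
Qed.

(** The fundamental theorem of calculus on [[-n, n]], whose boundary terms vanish in the limit,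
    combined with dominated convergence. *)
Lemma integralT_derive0 (F f : R -> R) :
  (forall x : R, is_derive x 1 F (f x)) -> continuous f ->
  mu.-integrable [set: R] (EFin \o f) ->
  F n%:R @[n --> \oo] --> 0 -> F (- n%:R) @[n --> \oo] --> 0 ->
  \int[mu]_x f x = 0.
Proof.
move=> dF cf intf Fy FNy.
pose D (n : nat) : set R := `[- n%:R, n%:R]%classic.
have mf : measurable_fun [set: R] f by case/integrableP : intf => /measurable_EFinP.
have cF : continuous F.
  move=> x; have /derivable1_diffP : derivable F x 1 by exact: ex_derive.
  by move/differentiable_continuous.
have gE n : (0 < n)%N -> (\int[mu]_x ((f \_ (D n)) x)%:E = (F n%:R - F (- n%:R))%:E)%E.
  move=> n0; have n0' : (0 : R) < n%:R by rewrite ltr0n.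
  have -> : (\int[mu]_x ((f \_ (D n)) x)%:E = \int[mu]_(x in D n) (f x)%:E)%E.
    by rewrite [RHS]integral_mkcond; under [RHS]eq_integral do rewrite restrict_EFin.
  rewrite (@continuous_FTC2 _ f F) ?EFinB//.
  - lra.
  - exact: continuous_subspaceT.
  - split => /=.
    + move=> x _; exact: ex_derive.
    + exact/cvg_at_right_filter/cF.
    + exact/cvg_at_left_filter/cF.
  - by move=> x _; rewrite derive1E; exact: derive_val.
have mg n : measurable_fun [set: R] (fun x => ((f \_ (D n)) x)%:E).
  apply/measurable_EFinP; apply: (measurable_restrictT _ _).1.
    exact: measurable_itv.
  exact: measurable_funTS.
have mf' : measurable_fun [set: R] (EFin \o f) by exact/measurable_EFinP.
have inorm := integrable_norm intf.
have [||_ _] := @dominated_convergence _ _ _ mu [set: R] measurableT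
  (fun n x => ((f \_ (D n)) x)%:E) (EFin \o f) (EFin \o (fun x => `|f x|)) mg mf' _ inorm _.
- apply: aeW => x _; apply: cvg_near_cst.
  near=> n; rewrite patchE ifT// inE /D/= in_itv/= -ler_norml.
  by near: n; exact: nbhs_infty_ger.
- by apply: aeW => x n _; rewrite lee_fin patchE; case: ifP => //; rewrite normr0.
have : (\int[mu]_x ((f \_ (D n)) x)%:E)%E @[n --> \oo] --> (0%:E : \bar R).
  rewrite -(cvg_shiftS (fun n => (\int[mu]_x ((f \_ (D n)) x)%:E)%E)).
  under eq_fun do rewrite gE//.
  apply: cvg_EFin; first exact: nearW.
  rewrite -[0](subr0 0); apply: cvgB.
    by rewrite (cvg_shiftS (fun n => F n%:R)).
  by rewrite (cvg_shiftS (fun n => F (- n%:R))).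
by move=> /cvg_unique h /h; rewrite /Rintegral => <-.
Unshelve. all: by end_near. Qed.

(* [psi c] solves psi' = - t psi, by integration by parts. *)
Definition psi (c t : R) := \int[mu]_x (cos (t * x + c) * ph x).

Lemma integrable_bounded_ph (h : R -> R) : measurable_fun setT h ->
  (forall x, `|h x| <= 1) -> mu.-integrable [set: R] (EFin \o (fun x => h x * ph x)).
Proof.
move=> mh h1.
have mf : measurable_fun [set: R] (fun x => h x * ph x).
  by apply: measurable_funM => //; exact: measurable_normal_pdf.
apply: (le_integrable measurableT _ _ (integrable_normal_pdf (0 : R) (1 : R))).
  by move/measurable_EFinP : mf => mf; exact: mf.
move=> x _ /=; rewrite lee_fin normrM (ger0_norm (normal_pdf_ge0 _ _ _)).
by rewrite ler_piMl ?normal_pdf_ge0.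
Qed.

Lemma measurable_cos_affine (c t : R) : measurable_fun setT (fun x : R => cos (t * x + c)).
Proof.
apply: (@measurableT_comp _ _ _ _ _ _ (@cos R)).
  by apply: continuous_measurable_fun; exact: continuous_cos.
by apply: measurable_funD => //; exact: measurable_funM.
Qed.

Lemma measurable_sin_affine (c t : R) : measurable_fun setT (fun x : R => sin (t * x + c)).
Proof.
apply: (@measurableT_comp _ _ _ _ _ _ (@sin R)).
  by apply: continuous_measurable_fun; exact: continuous_sin.
by apply: measurable_funD => //; exact: measurable_funM.
Qed.

Lemma is_derive_ph (x : R) : is_derive x 1 ph (- x * ph x).
Proof.
have -> : ph = (fun x : R => normal_peak 1 * expR (- x ^+ 2 / 2)).
  by apply/funext => y; exact: phE.
by apply: trigger_derive; rewrite /GRing.scale/=; field.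
Qed.

Lemma is_derive_sin_affine (c t x : R) :
  is_derive x 1 (fun x => sin (t * x + c)) (t * cos (t * x + c)).
Proof.
apply: trigger_derive; rewrite /GRing.scale/=; ring.
Qed.

Lemma is_derive_cos_affine (c t x : R) :
  is_derive x 1 (fun x => cos (t * x + c)) (- (t * sin (t * x + c))).
Proof.
apply: trigger_derive; rewrite /GRing.scale/=; ring.
Qed.

Lemma integrable_sinx (c t : R) :
  mu.-integrable [set: R] (EFin \o (fun x => x * sin (t * x + c) * ph x)).
Proof.
have mf : measurable_fun [set: R] (fun x => x * sin (t * x + c) * ph x).
  apply: measurable_funM; last exact: measurable_normal_pdf.
  by apply: measurable_funM => //; exact: measurable_sin_affine.
apply: (le_integrable measurableT _ _ normal_moment_integrable).
  by move/measurable_EFinP : mf => mf; exact: mf.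
move=> x _ /=; rewrite lee_fin !normrM normr_id.
rewrite ler_wpM2r// ler_piMr//; exact: sin_max.
Qed.

Lemma ph_cvg0 (c t : R) (u : nat -> R) : (forall n, u n ^+ 2 = n%:R ^+ 2) ->
  sin (t * u n + c) * ph (u n) @[n --> \oo] --> 0.
Proof.
move=> un; have p1 : 0 <= normal_peak 1 :> R by exact: normal_peak_ge0.
apply: norm_cvg0.
apply: (@squeeze_cvgr _ _ _ _ (fun=> 0) (fun n : nat => (normal_peak 1 * 2) * harmonic n)).
- apply: nearW => n; rewrite normr_ge0/= normrM phE un.
  rewrite (ger0_norm (mulr_ge0 p1 (expR_ge0 _))).
  apply: le_trans (ler_piMl (mulr_ge0 p1 (expR_ge0 _)) (sin_max _)) _.
  rewrite -mulrA ler_wpM2l// /harmonic/= mulNr expRN.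
  have n1 : (0 : R) < n.+1%:R by rewrite ltr0n.
  rewrite -[2 * _]invrK lef_pV2 ?posrE ?invr_gt0 ?expR_gt0 ?mulr_gt0 ?invr_gt0//.
  rewrite invfM invrK; apply: le_trans (expR_ge1Dx _).
  rewrite -(natr1 n); have := sqr_ge0 (n%:R - 1 : R); nra.
- exact: cvg_cst.
- by rewrite -[X in _ --> X](mulr0 (normal_peak 1 * 2)); apply: cvgMr; exact: cvg_harmonic.
Qed.

Lemma psi_ibp (c t : R) : \int[mu]_x (x * sin (t * x + c) * ph x) = t * psi c t.
Proof.
have ic : mu.-integrable [set: R] (EFin \o (fun x => cos (t * x + c) * ph x)).
  by apply: integrable_bounded_ph => [|x]; [exact: measurable_cos_affine|exact: cos_max].
have itc := integrableZl measurableT t ic.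
have isx := integrable_sinx c t.
have := @integralT_derive0 (fun x => sin (t * x + c) * ph x)
  (fun x => t * (cos (t * x + c) * ph x) - x * sin (t * x + c) * ph x).
move=> /(_ _ _ _ _ _); rewrite RintegralB// RintegralZl// => h.
apply/eqP; rewrite eq_sym -subr_eq0; apply/eqP; apply: h.
- move=> x; have ds := is_derive_sin_affine c t x; have dp := is_derive_ph x.
  by apply: trigger_derive; rewrite /GRing.scale/=; ring.
- have cder (h : R -> R) (x a : R) : is_derive x 1 h a -> h y @[y --> x] --> h x.
    move=> dh; have /derivable1_diffP : derivable h x 1 by exact: ex_derive.
    by move/differentiable_continuous.
  have cph (x : R) : ph y @[y --> x] --> ph x by exact: cder (is_derive_ph x).
  move=> x; apply: (@cvgB _ R^o).
    apply: cvgM; first exact: cvg_cst.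
    by apply: cvgM (cph x); exact: cder (is_derive_cos_affine c t x).
  apply: cvgM (cph x); apply: cvgM; first exact: cvg_id.
  exact: cder (is_derive_sin_affine c t x).
- by rewrite /comp; under eq_fun do rewrite EFinB; exact: integrableB.
- by apply: ph_cvg0.
- by apply: (ph_cvg0 c t (u := fun n => - n%:R)) => n; rewrite sqrrN.
Qed.

Lemma psi_derive (c t : R) : is_derive t 1 (psi c) (- (t * psi c t)).
Proof.
pose f (s x : R) := cos (s * x + c) * ph x.
have df (s x : R) : is_derive s 1 (f ^~ x) (- (x * sin (s * x + c) * ph x)).
  have := is_derive_cos_affine c x s.
  have -> : (fun y => cos (x * y + c)) = (fun y => cos (y * x + c)).
    by apply/funext => y; rewrite mulrC.
  move=> dc; apply: trigger_derive; rewrite /GRing.scale/= [x * s]mulrC; ring.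
(* The dominating function [|y| * ph y] is the same for all parameters, so any neighbourhood of [t]
   serves. *)
have tI : (`]t - 1, t + 1[%classic : set R) t by rewrite /= in_itv/=; apply/andP; split; lra.
have intf (x : R) : `]t - 1, t + 1[%classic x -> mu.-integrable [set: R] (EFin \o f x).
  by move=> _; apply: integrable_bounded_ph => [|y]; [exact: measurable_cos_affine|exact: cos_max].
have derf (x y : R) : `]t - 1, t + 1[%classic x -> [set: R] y -> derivable (f ^~ y) x 1.
  by move=> _ _; have := df x y => -[].
have G0 (y : R) : 0 <= `|y| * ph y by rewrite mulr_ge0 ?normal_pdf_ge0.
have Gub (x y : R) : `]t - 1, t + 1[%classic x -> [set: R] y ->
    `|partial1of2 f x y| <= `|y| * ph y.
  move=> _ _; rewrite partial1of2E (@derive_val _ _ _ _ _ _ _ (df x y)) normrN !normrM.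
  rewrite (ger0_norm (normal_pdf_ge0 _ _ _)) ler_wpM2r ?normal_pdf_ge0//.
  by rewrite ler_piMr//; exact: sin_max.
have H := @differentiation_under_integral R _ _ mu f [set: R] measurableT t _ _ tI
  intf derf _ G0 normal_moment_integrable Gub.
have D := @derivable_under_integral R _ _ mu f [set: R] measurableT t _ _ tI
  intf derf _ G0 normal_moment_integrable Gub.
apply: DeriveDef; first exact: D.
rewrite -derive1E; rewrite /psi; rewrite [LHS]H.
rewrite -/(psi c t) -psi_ibp.
transitivity (\int[mu]_x (-1 * (x * sin (t * x + c) * ph x))).
  apply: eq_Rintegral => x _.
  by rewrite partial1of2E (@derive_val _ _ _ _ _ _ _ (df t x)) mulN1r.
by rewrite RintegralZl ?mulN1r//; exact: integrable_sinx.
Qed.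

Lemma psiE c t : psi c t = expR (- t ^+ 2 / 2) * cos c.
Proof.
(* Integrating factor of [psi' = - t psi]; the constant is the value at 0, where the density
   integrates to 1. *)
pose h t := psi c t * expR (t ^+ 2 / 2).
have : h t = h 0.
  apply: is_derive_0_is_cst => {}t; have dp := psi_derive c t.
  by apply: trigger_derive; rewrite /GRing.scale/=; field.
rewrite /h expr0n/= mul0r expR0 mulr1.
have -> : psi c 0 = cos c.
  rewrite /psi; under eq_Rintegral do rewrite mul0r add0r.
  rewrite RintegralZl//; last exact: integrable_normal_pdf.
  by rewrite /Rintegral integral_normal_pdf mulr1.
move=> <-; rewrite mulrC -mulrA -expRD.
by rewrite (_ : _ + _ = 0) ?expR0 ?mulr1//; lra.
Qed.

(** The phase [c] lets one real formula carry both the real and the imaginary part of the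
    characteristic function. *)
Lemma gauss_cos d (T : measurableType d) (P : probability T R) (b : T -> R) (c t : R) :
  measurable_fun setT b ->
  (forall A, measurable A -> P (b @^-1` A) = NP A) ->
  (\int[P]_w (cos (t * b w + c))%:E = (expR (- t ^+ 2 / 2) * cos c)%:E)%E.
Proof.
move=> mb bN; pose f (x : R) := (cos (t * x + c))%:E.
have mf : measurable_fun setT f by apply/measurable_EFinP; exact: measurable_cos_affine.
have finf : (\int[NP]_x `|f x| < +oo)%E.
  apply: (@le_lt_trans _ _ (\int[NP]_x 1%:E)%E); last by rewrite integral_prob_cst ltry.
  by apply: ge0_le_integral_any => x //=; rewrite lee_fin cos_max.
rewrite (@eq_law_integral _ _ _ _ _ _ _ P NP b id mb _ _ f)//.
- rewrite integral_normal_prob// -psiE /psi /Rintegral fineK//.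
  apply: integrable_fin_num => //.
  by apply: integrable_bounded_ph => [|x]; [exact: measurable_cos_affine|exact: cos_max].
- apply/integrableP; split; first exact: measurableT_comp.
  apply: (@le_lt_trans _ _ (\int[P]_x 1%:E)%E); last by rewrite integral_prob_cst ltry.
  by apply: ge0_le_integral_any => x //=; rewrite lee_fin cos_max.
Qed.

End Gauss.

(** * Trigonometric moments of sums of independent variables *)

Section TrigBounds.
Context {R : realType}.
Implicit Types x a : R.

Lemma norm_sin_le x : `|sin x| <= `|x|.
Proof.
have key (y : R) : 0 < y -> `|sin y| <= y.
  move=> y0.
  have ds z : z \in `]0, y[ -> is_derive z 1 sin (cos z) by move=> _; exact: is_derive_sin.
  have [c _] := MVT y0 ds (continuous_subspaceT (@continuous_sin R)).
  rewrite sin0 !subr0 => ->; rewrite normrM (gtr0_norm y0).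
  by rewrite ler_piMl ?cos_max// ltW.
have [x0|x0|->] := ltrgtP x 0.
- by rewrite -normrN -sinN (ltr0_norm x0); apply: key; rewrite oppr_gt0.
- by rewrite (gtr0_norm x0); exact: key.
- by rewrite sin0 normr0.
Qed.

Lemma cos_ge_quadratic x : 1 - x ^+ 2 / 2 <= cos x.
Proof.
have -> : x = (x / 2) *+ 2 by rewrite -mulr_natr divfK.
rewrite cos_mulr2n cos2sin2 -mulr_natr.
have := norm_sin_le (x / 2); rewrite -ler_sqr ?nnegrE// !real_normK ?num_real//.
by rewrite -[_ *+ 2]mulr_natr; nra.
Qed.

(** By the mean value theorem the function is controlled by its derivative [cos - 1], which is of
    second order; [cos_sub_le] repeats the argument one order higher. *)
Lemma sin_sub_le x : `|sin x - x| <= `|x| ^+ 3.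
Proof.
have key (y : R) : 0 < y -> `|sin y - y| <= y ^+ 3.
  move=> y0.
  have ds z : z \in `]0, y[ -> is_derive z 1 (fun z => sin z - z) (cos z - 1).
    by move=> _; apply: trigger_derive; rewrite /GRing.scale/=; ring.
  have cs : continuous (fun z : R => sin z - z).
    by move=> z; apply: (@cvgB _ R^o); [exact: continuous_sin|exact: cvg_id].
  have [c] := MVT y0 ds (continuous_subspaceT cs).
  rewrite in_itv/= => /andP[c0 cy]; rewrite sin0 !subr0 => ->.
  rewrite normrM (gtr0_norm y0) exprSr ler_wpM2r ?(ltW y0)//.
  have := cos_ge_quadratic c; have := cos_le1 c => h1 h2.
  rewrite ler0_norm; last lra.
  nra.
have [x0|x0|->] := ltrgtP x 0.
- rewrite -normrN opprB addrC -sinN -[sin _ + _](_ : sin (- x) - - x = _); last by rewrite opprK.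
  by rewrite (ltr0_norm x0); apply: key; rewrite oppr_gt0.
- by rewrite (gtr0_norm x0); exact: key.
- by rewrite sin0 subr0 normr0 expr0n.
Qed.

Lemma cos_sub_le x : `|cos x - 1 + x ^+ 2 / 2| <= `|x| ^+ 4.
Proof.
have key (y : R) : 0 < y -> `|cos y - 1 + y ^+ 2 / 2| <= y ^+ 4.
  move=> y0.
  have ds z : z \in `]0, y[ -> is_derive z 1 (fun z => cos z + z ^+ 2 / 2) (- sin z + z).
    by move=> _; apply: trigger_derive; rewrite /GRing.scale/=; field.
  have cs : continuous (fun z : R => cos z + z ^+ 2 / 2).
    move=> z; apply: (@cvgD _ R^o); first exact: continuous_cos.
    by apply: cvgM; [exact: exprn_continuous|exact: cvg_cst].
  have [c] := MVT y0 ds (continuous_subspaceT cs).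
  rewrite in_itv/= => /andP[c0 cy]; rewrite cos0 expr0n/= mul0r addr0 subr0 => h.
  rewrite (_ : cos y - 1 + _ = cos y + y ^+ 2 / 2 - 1); last lra.
  rewrite h normrM (gtr0_norm y0) [y ^+ 4]exprSr ler_wpM2r ?(ltW y0)//.
  rewrite -normrN opprD opprK.
  have := sin_sub_le c; rewrite (gtr0_norm c0).
  move=> /le_trans; apply; rewrite lerXn2r ?nnegrE ?ltW//.
have [x0|x0|->] := ltrgtP x 0.
- by rewrite -cosN -sqrrN (ltr0_norm x0); apply: key; rewrite oppr_gt0.
- by rewrite (gtr0_norm x0); exact: key.
- by rewrite cos0 subrr add0r normr0 !expr0n/= mul0r normr0.
Qed.

End TrigBounds.

Section TrigPow.
Context {R : realType}.
Implicit Types a p : R.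

Lemma powR_ge_nat a p n : 2 <= p -> p <= 3 -> `|a| <= 1 -> (3 <= n)%N ->
  `|a| ^+ n <= `|a| `^ p.
Proof.
move=> p2 p3 a1 n3; have [->|a0] := eqVneq a 0.
  by rewrite normr0 expr0n gtn_eqF ?powR_ge0// (leq_trans _ n3).
have a0' : 0 < `|a| by rewrite normr_gt0.
rewrite -powR_mulrn//; apply: ger_powR; first by rewrite a0' a1.
by apply: le_trans p3 _; rewrite ler_nat.
Qed.

Lemma powR_ge_sqr a p : 2 <= p -> 1 <= `|a| -> `|a| ^+ 2 <= `|a| `^ p.
Proof. by move=> p2 a1; rewrite -powR_mulrn// ler_powR. Qed.

(** Only moments of some order [p > 2] will be at hand, so the cubic remainder is traded for a p-th
    power: for [|a| <= 1] the cube is smaller as [p <= 3], and for larger [a] a linear bound is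
    below the p-th power. *)
Lemma sin_sub_le_powR a p : 2 <= p -> p <= 3 -> `|sin a - a| <= 3 * `|a| `^ p.
Proof.
move=> p2 p3; have ap := powR_ge0 `|a| p.
have [a1|a1] := leP `|a| 1.
  by have := powR_ge_nat p2 p3 a1 (leqnn _); have := sin_sub_le a; lra.
have := powR_ge_sqr p2 (ltW a1); have := ler_normB (sin a) a.
by have := norm_sin_le a; have := normr_ge0 a; nra.
Qed.

Lemma cos_sub_le_powR a p : 2 <= p -> p <= 3 ->
  `|cos a - 1 + a ^+ 2 / 2| <= 3 * `|a| `^ p.
Proof.
move=> p2 p3; have ap := powR_ge0 `|a| p.
have [a1|a1] := leP `|a| 1.
  by have := powR_ge_nat p2 p3 a1 (isT : 3 <= 4)%N; have := cos_sub_le a; lra.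
have := powR_ge_sqr p2 (ltW a1); rewrite real_normK ?num_real// => h.
have h2 : 1 <= a ^+ 2 by rewrite -[a ^+ 2]real_normK ?num_real//; nra.
rewrite ler_norml; have := cos_le1 a; have := cos_geN1 a => c1 c2.
by apply/andP; split; lra.
Qed.

End TrigPow.

Section Close.
Context {R : realType} d (T : measurableType d) (P : probability T R).
Implicit Types (A B : T -> R) (v e : R).

Lemma bounded_integrable (f : T -> R) (M : R) : measurable_fun setT f ->
  (forall w, `|f w| <= M) -> P.-integrable setT (EFin \o f).
Proof.
move=> mf fM; apply/integrableP; split; first exact/measurable_EFinP.
apply: (@le_lt_trans _ _ (\int[P]_w M%:E)%E); last by rewrite integral_prob_cst ltry.
by apply: ge0_le_integral_any => w //=; rewrite lee_fin.
Qed.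

Definition Ecos A := \int[P]_w cos (A w).
Definition Esin A := \int[P]_w sin (A w).

Lemma measurable_cosT A : measurable_fun setT A -> measurable_fun setT (fun w => cos (A w)).
Proof.
move=> mA; apply: (@measurableT_comp _ _ _ _ _ _ (@cos R)) => //.
by apply: continuous_measurable_fun; exact: continuous_cos.
Qed.

Lemma measurable_sinT A : measurable_fun setT A -> measurable_fun setT (fun w => sin (A w)).
Proof.
move=> mA; apply: (@measurableT_comp _ _ _ _ _ _ (@sin R)) => //.
by apply: continuous_measurable_fun; exact: continuous_sin.
Qed.

Lemma integrable_cos A : measurable_fun setT A ->
  P.-integrable setT (EFin \o (fun w => cos (A w))).
Proof. by move=> mA; apply: (bounded_integrable (measurable_cosT mA)) => w; exact: cos_max. Qed.

Lemma integrable_sin A : measurable_fun setT A ->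
  P.-integrable setT (EFin \o (fun w => sin (A w))).
Proof. by move=> mA; apply: (bounded_integrable (measurable_sinT mA)) => w; exact: sin_max. Qed.

Lemma Rintegral_cst_prob (c : R) : \int[P]_w c = c.
Proof. by rewrite /Rintegral integral_prob_cst. Qed.

Lemma EFin_Rintegral (f : T -> R) : P.-integrable setT (EFin \o f) ->
  (\int[P]_w (f w)%:E = (\int[P]_w f w)%:E)%E.
Proof. by move=> fi; rewrite /Rintegral fineK//; exact: integrable_fin_num. Qed.

Lemma indep2_RintegralM (U V : T -> R) : indep2 P U V ->
  P.-integrable setT (EFin \o U) -> P.-integrable setT (EFin \o V) ->
  \int[P]_w (U w * V w) = (\int[P]_w U w) * \int[P]_w V w.
Proof.
move=> UV iU iV; rewrite /Rintegral indep2_integralM//.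
by rewrite fineM//; exact: integrable_fin_num.
Qed.

(** The mean of [(cos A - c)^2 + (sin A - s)^2] is nonnegative and equals [1 - c^2 - s^2]. *)
Lemma EcosEsin_le1 A : measurable_fun setT A -> Ecos A ^+ 2 + Esin A ^+ 2 <= 1.
Proof.
move=> mA; have ic := integrable_cos mA; have is_ := integrable_sin mA.
set c := Ecos A; set s := Esin A.
have : 0 <= \int[P]_w (1 + (c ^+ 2 + s ^+ 2) - (2 * c * cos (A w) + 2 * s * sin (A w))).
  apply: Rintegral_ge0 => w _.
  have := cos2Dsin2 (A w); have := sqr_ge0 (cos (A w) - c); have := sqr_ge0 (sin (A w) - s).
  by nra.
have i1 : P.-integrable setT (EFin \o (fun w => 2 * c * cos (A w))).
  exact: (integrableZl measurableT (2 * c) ic).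
have i2 : P.-integrable setT (EFin \o (fun w => 2 * s * sin (A w))).
  exact: (integrableZl measurableT (2 * s) is_).
have i3 : P.-integrable setT (EFin \o (fun w => 2 * c * cos (A w) + 2 * s * sin (A w))).
  by rewrite /comp; under eq_fun do rewrite EFinD; exact: integrableD.
have i4 : P.-integrable setT (EFin \o (fun w : T => 1 + (c ^+ 2 + s ^+ 2))).
  by apply: (@bounded_integrable _ `|1 + (c ^+ 2 + s ^+ 2)|).
rewrite RintegralB// Rintegral_cst_prob RintegralD// !RintegralZl//.
rewrite -/(Ecos A) -/(Esin A) -/c -/s; nra.
Qed.

(* Stated for all vectors (x, y) of norm at most 1 so that the errors add up over
   independent summands: conditioning on one summand contracts (x, y). *)
Definition close A (v e : R) := forall x y : R, x ^+ 2 + y ^+ 2 <= 1 ->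
  `|x * Ecos A - y * Esin A - expR (- v / 2) * x| <= e.

Lemma closeD A B v v' e e' : measurable_fun setT A -> measurable_fun setT B ->
  indep2 P A B -> 0 <= v -> close A v e -> close B v' e' ->
  close (fun w => A w + B w) (v + v') (e + e').
Proof.
move=> mA mB AB v0 cA cB x y xy.
have [icA isA] := (integrable_cos mA, integrable_sin mA).
have [icB isB] := (integrable_cos mB, integrable_sin mB).
have mcos : measurable_fun setT (@cos R).
  by apply: continuous_measurable_fun; exact: continuous_cos.
have msin : measurable_fun setT (@sin R).
  by apply: continuous_measurable_fun; exact: continuous_sin.
have CC := indep2_RintegralM (indep2_comp mcos mcos AB) icA icB.
have SS := indep2_RintegralM (indep2_comp msin msin AB) isA isB.
have SC := indep2_RintegralM (indep2_comp msin mcos AB) isA icB.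
have CS := indep2_RintegralM (indep2_comp mcos msin AB) icA isB.
have iCC := indep2_integrableM (indep2_comp mcos mcos AB) icA icB.
have iSS := indep2_integrableM (indep2_comp msin msin AB) isA isB.
have iSC := indep2_integrableM (indep2_comp msin mcos AB) isA icB.
have iCS := indep2_integrableM (indep2_comp mcos msin AB) icA isB.
have EC : Ecos (fun w => A w + B w) = Ecos A * Ecos B - Esin A * Esin B.
  rewrite /Ecos /Esin -CC -SS -RintegralB//.
  by apply: eq_Rintegral => w _; rewrite cosD.
have ES : Esin (fun w => A w + B w) = Esin A * Ecos B + Ecos A * Esin B.
  rewrite /Ecos /Esin -SC -CS -RintegralD//.
  by apply: eq_Rintegral => w _; rewrite sinD.
rewrite EC ES.
have B1 := EcosEsin_le1 mB.
set cb := Ecos B in B1 *; set sb := Esin B in B1 *.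
(* The mean rotation by [B] maps [(x, y)] to a vector of no greater norm, so the bound for [A]
   applies to the image. *)
have xy' : (x * cb - y * sb) ^+ 2 + (x * sb + y * cb) ^+ 2 <= 1.
  have -> : (x * cb - y * sb) ^+ 2 + (x * sb + y * cb) ^+ 2 =
    (x ^+ 2 + y ^+ 2) * (cb ^+ 2 + sb ^+ 2) by ring.
  by apply: mulr_ile1 => //; rewrite addr_ge0 ?sqr_ge0.
have h1 := cA _ _ xy'; have h2 := cB _ _ xy; rewrite -/cb -/sb in h2.
set ev := expR (- v / 2) in h1.
have ev0 : 0 <= ev by exact: expR_ge0.
have ev1 : ev <= 1 by rewrite /ev -[leRHS]expR0 ler_expR; lra.
have -> : expR (- (v + v') / 2) = ev * expR (- v' / 2).
  by rewrite -expRD; congr expR; lra.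
set ev' := expR (- v' / 2) in h2 *.
(* Telescoping: the error of [A] at the contracted vector, plus [exp (- v / 2) <= 1] times the error
   of [B]. *)
rewrite [X in `|X|](_ : _ = ((x * cb - y * sb) * Ecos A - (x * sb + y * cb) * Esin A
   - ev * (x * cb - y * sb)) + ev * (x * cb - y * sb - ev' * x)); last by ring.
apply: le_trans (ler_normD _ _) _; apply: lerD => //.
rewrite normrM (ger0_norm ev0).
by apply: le_trans h2; rewrite ler_piMl.
Qed.

Lemma close_cos A v e (c : R) : measurable_fun setT A -> close A v e ->
  `|\int[P]_w cos (A w + c) - expR (- v / 2) * cos c| <= e.
Proof.
move=> mA cA; have := cA (cos c) (sin c); rewrite cos2Dsin2 lexx => /(_ isT).
congr (`| _ - _| <= _).
rewrite /Ecos /Esin -!RintegralZl//; try exact: integrable_cos; try exact: integrable_sin.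
rewrite -RintegralB//; last 2 first.
- exact: (integrableZl measurableT (cos c) (integrable_cos mA)).
- exact: (integrableZl measurableT (sin c) (integrable_sin mA)).
by apply: eq_Rintegral => w _; rewrite cosD; ring.
Qed.

Lemma close_sum (J : finType) (Z : J -> T -> R) (r : seq J) (v e : J -> R) :
  (forall j, measurable_fun setT (Z j)) -> mindep P Z -> uniq r ->
  (forall j, 0 <= v j) -> (forall j, j \in r -> close (Z j) (v j) (e j)) ->
  close (fun w => \sum_(j <- r) Z j w) (\sum_(j <- r) v j) (\sum_(j <- r) e j).
Proof.
move=> mZ iZ ur v0 cZ; elim: r ur cZ => [_ _|j r ih /= /andP[jr ur] cZ].
  have -> : (fun w => \sum_(j <- [::]) Z j w) = (fun=> 0).
    by apply/funext => w; rewrite big_nil.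
  move=> x y xy; rewrite !big_nil /Ecos /Esin cos0 sin0.
  by rewrite !Rintegral_cst_prob oppr0 mul0r expR0 mul1r mulr1 mulr0 subr0 subrr normr0.
have -> : (fun w => \sum_(i <- j :: r) Z i w) = (fun w => Z j w + \sum_(i <- r) Z i w).
  by apply/funext => w; rewrite big_cons.
rewrite !big_cons; apply: closeD => //.
- exact: measurable_sum.
(* An explicit membership test makes every summand, as a function of an arbitrary index, adapted to
   the block [r]. *)
- have -> : (fun w => \sum_(i <- r) Z i w) =
      (fun w => \sum_(i <- r) (if i \in r then Z i w else 0)).
    by apply/funext => w; rewrite big_seq_cond [RHS]big_seq_cond;
      apply: eq_bigr => i /andP[-> _].
  apply: (mindep_blocks mZ iZ (B := fun i => i == j) (B' := fun i => i \in r)).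
  + by move=> i /eqP ->.
  + exact: (@adapted_coord _ _ _ _ Z (fun i => i == j) j (eqxx _)).
  + apply: measurable_sum => i; case: (boolP (i \in r)) => ir; last exact: measurable_cst.
    exact: (@adapted_coord _ _ _ _ Z (fun i => i \in r) i ir).
- by apply: cZ; rewrite inE eqxx.
- by apply: ih => // i ir; apply: cZ; rewrite inE ir orbT.
Qed.

(** The sine and the cosine remainder contribute 3 each to the factor 6; the squared term is the
    cost of replacing [1 - u / 2] by [exp (- u / 2)] for [u = a^2 v <= 1]. *)
Lemma close_atom (X : T -> R) (a v p L : R) : 2 < p -> p <= 3 -> 0 < L -> 0 <= a ->
  Lb P p X L -> \int[P]_w X w = 0 -> \int[P]_w (X w ^+ 2) = v -> 0 <= v ->
  a ^+ 2 * v <= 1 ->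
  close (fun w => a * X w) (a ^+ 2 * v) (6 * a `^ p * L `^ p + (a ^+ 2 * v) ^+ 2).
Proof.
move=> p2 p3 L0 a0 XL EX EX2 v0 av1 x y xy.
have p2' := ltW p2; have p1 : 1 <= p by lra. have p0 : 0 <= p by lra.
have mX := XL.1.
have maX : measurable_fun setT (fun w => a * X w) by exact: measurable_funM.
have iX : P.-integrable setT (EFin \o X) by exact: (Lb_integrable1 L0 p1 XL).
have iX2 : P.-integrable setT (EFin \o (fun w => X w ^+ 2)).
  have := Lb_integrable L0 (ler0n _ 2) p2' XL.
  by congr (_.-integrable _ _); apply/funext => w /=; rewrite powR_mulrn// real_normK ?num_real.
have iXp := Lb_integrable L0 p0 (lexx _) XL.
have EXp : \int[P]_w (`|X w| `^ p) <= L `^ p.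
  by rewrite -lee_fin -EFin_Rintegral//; exact: XL.2.
have b p' : `|a * X p'| `^ p = a `^ p * `|X p'| `^ p.
  by rewrite normrM (ger0_norm a0) powRM.
have iR : P.-integrable setT (EFin \o (fun w => 3 * a `^ p * `|X w| `^ p)).
  exact: (integrableZl measurableT (3 * a `^ p) iXp).
have ER : \int[P]_w (3 * a `^ p * `|X w| `^ p) <= 3 * a `^ p * L `^ p.
  by rewrite RintegralZl// ler_wpM2l// mulr_ge0// powR_ge0.
have iaX : P.-integrable setT (EFin \o (fun w => a * X w)).
  exact: (integrableZl measurableT a iX).
have iaX2 : P.-integrable setT (EFin \o (fun w => (a ^+ 2 / 2) * X w ^+ 2)).
  exact: (integrableZl measurableT (a ^+ 2 / 2) iX2).
have H1 : `|Esin (fun w => a * X w)| <= 3 * a `^ p * L `^ p.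
  have is_ := integrable_sin maX.
  have -> : Esin (fun w => a * X w) = \int[P]_w (sin (a * X w) - a * X w).
    by rewrite RintegralB// RintegralZl// EX mulr0 subr0.
  have iB : P.-integrable setT (EFin \o (fun w => sin (a * X w) - a * X w)).
    by rewrite /comp; under eq_fun do rewrite EFinB; exact: integrableB.
  apply: le_trans (le_normr_Rintegral measurableT iB) _.
  apply: le_trans ER; apply: le_Rintegral => //; first exact: integrable_norm.
  by move=> w _; rewrite -[leRHS]mulrA -b; exact: sin_sub_le_powR.
have H2 : `|Ecos (fun w => a * X w) - 1 + a ^+ 2 / 2 * v| <= 3 * a `^ p * L `^ p.
  have ic := integrable_cos maX.
  have i1 : P.-integrable setT (EFin \o (fun=> 1 : R)) by apply: (@bounded_integrable _ `|1|).
  have iB' : P.-integrable setT (EFin \o (fun w => cos (a * X w) - 1)).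
    by rewrite /comp; under eq_fun do rewrite EFinB; exact: integrableB.
  have -> : Ecos (fun w => a * X w) - 1 + a ^+ 2 / 2 * v =
      \int[P]_w (cos (a * X w) - 1 + a ^+ 2 / 2 * X w ^+ 2).
    by rewrite RintegralD// RintegralB// RintegralZl// EX2 Rintegral_cst_prob.
  have iB : P.-integrable setT (EFin \o (fun w => cos (a * X w) - 1 + a ^+ 2 / 2 * X w ^+ 2)).
    by rewrite /comp; under eq_fun do rewrite EFinD; exact: integrableD.
  apply: le_trans (le_normr_Rintegral measurableT iB) _.
  apply: le_trans ER; apply: le_Rintegral => //; first exact: integrable_norm.
  move=> w _; rewrite -[leRHS]mulrA -b.
  have -> : a ^+ 2 / 2 * X w ^+ 2 = (a * X w) ^+ 2 / 2 by rewrite exprMn; ring.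
  exact: cos_sub_le_powR.
set u := a ^+ 2 * v in av1 *.
have u0 : 0 <= u by rewrite mulr_ge0 ?sqr_ge0.
have H3 : `|expR (- u / 2) - 1 + u / 2| <= u ^+ 2.
  have h1 := expR_ge1Dx (- u / 2).
  have h2 : `|- u / 2| <= 2^-1 by rewrite normrM normrN ger0_norm// ger0_norm//; lra.
  have := expR_le_quadratic h2; rewrite ler_norml => h3.
  have h4 := sqr_ge0 u.
  by apply/andP; split; nra.
have x1 : `|x| <= 1.
  rewrite -(@expr_le1 _ 2)// real_normK ?num_real//; have := sqr_ge0 y; lra.
have y1 : `|y| <= 1.
  rewrite -(@expr_le1 _ 2)// real_normK ?num_real//; have := sqr_ge0 x; lra.
set C := Ecos _ in H2 *; set S := Esin _ in H1 *.
rewrite [X in `|X|](_ : _ = x * (C - 1 + a ^+ 2 / 2 * v) - x * (expR (- u / 2) - 1 + u / 2) - y * S);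
  last by rewrite /u; field.
apply: le_trans (ler_normB _ _) _.
apply: le_trans (lerD (ler_normB _ _) (lexx _)) _.
rewrite !normrM.
have := ler_piMl (normr_ge0 (C - 1 + a ^+ 2 / 2 * v)) x1.
have := ler_piMl (normr_ge0 (expR (- u / 2) - 1 + u / 2)) x1.
have := ler_piMl (normr_ge0 S) y1.
lra.
Qed.

End Close.

(** * Weak convergence from trigonometric moments *)

Section Bernstein.
Context {R : realType}.
Implicit Types (y s : R) (h g : nat -> R).

(* Bernstein polynomial: the expectation of h at a binomial (q, y) variable. *)
Fixpoint bern q h y : R :=
  if q is q'.+1 then (1 - y) * bern q' h y + y * bern q' (fun z => h z.+1) y
  else h 0%N.

Lemma bern_le q h g y : 0 <= y <= 1 -> (forall z, (z <= q)%N -> h z <= g z) ->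
  bern q h y <= bern q g y.
Proof.
move=> /andP[y0 y1]; elim: q h g => [|q ih] h g hg /=; first exact: hg.
apply: lerD.
- by rewrite ler_wpM2l ?subr_ge0// ih// => z zq; apply: hg; exact: leqW.
- by rewrite ler_wpM2l// ih// => z zq; exact: hg.
Qed.

Lemma bernD q h g y : bern q (fun z => h z + g z) y = bern q h y + bern q g y.
Proof. by elim: q h g => [//|q ih] h g /=; rewrite !ih; ring. Qed.

Lemma bernZ q h y a : bern q (fun z => a * h z) y = a * bern q h y.
Proof. by elim: q h => [//|q ih] h /=; rewrite !ih; ring. Qed.

Lemma bern_cst q y (a : R) : bern q (fun=> a) y = a.
Proof. by elim: q => [//|q ih] /=; rewrite !ih; ring. Qed.

Lemma bern_norm q h y : 0 <= y <= 1 -> `|bern q h y| <= bern q (fun z => `|h z|) y.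
Proof.
move=> y01; rewrite ler_norml -mulN1r -bernZ.
by apply/andP; split; apply: bern_le => // z _; rewrite ?ler_norm// mulN1r lerNl -normrN ler_norm.
Qed.

(** Second moment of a binomial variable about [- s]: squared mean plus variance. The shift is free
    because the recursion replaces [z] by [z + 1]. *)
Lemma bern_sqr q y s : bern q (fun z => (z%:R + s) ^+ 2) y =
  (q%:R * y + s) ^+ 2 + q%:R * (y * (1 - y)).
Proof.
elim: q s => [|q ih] s /=; first by rewrite !mul0r !add0r addr0.
rewrite ih.
have -> : (fun z => (z.+1%:R + s) ^+ 2) = (fun z => (z%:R + (1 + s)) ^+ 2).
  by apply/funext => z; rewrite -natr1 addrA.
by rewrite ih -natr1; ring.
Qed.

(** Since [t <= eta + t^2 / eta] for [t >= 0], the mean deviation is controlled by the variance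
    [y (1 - y) / q] of the frequency. *)
Lemma bern_abs q y (eta : R) : (0 < q)%N -> 0 <= y <= 1 -> 0 < eta ->
  bern q (fun z => `|z%:R / q%:R - y|) y <= eta + (q%:R * eta)^-1.
Proof.
move=> q0 /andP[y0 y1] eta0.
have q0' : 0 < q%:R :> R by rewrite ltr0n.
have y01 : 0 <= y <= 1 by rewrite y0.
apply: (@le_trans _ _ (bern q (fun z => eta + eta^-1 / q%:R ^+ 2 * (z%:R + - (q%:R * y)) ^+ 2) y)).
  apply: bern_le => // z _.
  have -> : eta^-1 / q%:R ^+ 2 * (z%:R - q%:R * y) ^+ 2 = (z%:R / q%:R - y) ^+ 2 / eta.
    by field; rewrite !gt_eqF.
  set x := z%:R / q%:R - y; rewrite -[x ^+ 2]real_normK ?num_real//.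
  have x0 := normr_ge0 x.
  have [xe|ex] := leP `|x| eta.
    by rewrite ler_wpDr// mulr_ge0 ?sqr_ge0// invr_ge0 ltW.
  rewrite ler_wpDl ?ltW// expr2 ltr_pdivlMr// ltr_pM2l//; exact: lt_trans ex.
rewrite bernD bern_cst bernZ bern_sqr subrr expr0n/= add0r lerD2l.
have -> : eta^-1 / q%:R ^+ 2 * (q%:R * (y * (1 - y))) = (q%:R * eta)^-1 * (y * (1 - y)).
  by field; rewrite !gt_eqF.
by rewrite ler_piMr ?invr_ge0 ?mulr_ge0 ?(ltW eta0) ?(ltW q0')//; nra.
Qed.

End Bernstein.

Section SinInverse.
Context {R : realType}.

(** The mean value theorem, with [cos >= cos 1 > 0] between the two points. *)
Lemma sin_lipschitz_inv (x y : R) : -1 <= x <= 1 -> -1 <= y <= 1 ->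
  `|x - y| <= (cos 1)^-1 * `|sin x - sin y|.
Proof.
wlog xy : x y / y < x.
  move=> H x1 y1; have [xy|yx|->] := ltgtP x y.
  - by rewrite distrC [`|sin _ - _|]distrC; exact: H.
  - exact: H.
  - by rewrite !subrr normr0 mulr0.
move=> /andP[x1 x1'] /andP[y1 y1'].
have ds z : z \in `]y, x[ -> is_derive z 1 sin (cos z) by move=> _; exact: is_derive_sin.
have [c] := MVT xy ds (continuous_subspaceT (@continuous_sin R)).
rewrite in_itv/= => /andP[yc cx] ->.
have c1 : cos 1 <= cos c.
  rewrite -[cos c]cos_norm; have [->//|c1] := eqVneq `|c| 1.
  have hp := @pi_ge2 R.
  rewrite ltW// ltr_cos ?in_itv/= ?normr_ge0//; last lra.
    by rewrite lt_neqAle c1/= ler_norml; apply/andP; split; lra.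
  by apply/andP; split => //; rewrite ler_norml; apply/andP; split; lra.
have c0 := @cos1_gt0 R.
rewrite normrM mulrA [_^-1 * _]mulrC ler_peMl// ler_pdivlMr// mul1r.
by apply: le_trans c1 (ler_norm _).
Qed.

(* The grid points do not depend on x, so they may be used as nodes of a
   polynomial approximation in the variable (1 + sin x) / 2. *)
Lemma sin_grid (u : R) : exists2 a : R, -1 <= a <= 1 & forall x, -1 <= x <= 1 ->
  `|a - x| <= (cos 1)^-1 * (2 * `|u - (1 + sin x) / 2|).
Proof.
pose s := sin 1 : R.
have sl x : -1 <= x <= 1 -> - s <= sin x /\ sin x <= s.
  move=> /andP[x1 x1']; have hp := @pihalf_ge1 R.
  have mono (a b : R) : -1 <= a -> a <= b -> b <= 1 -> sin a <= sin b.
    move=> a1 ab b1; move: ab; rewrite le_eqVlt => /predU1P[->//|ab].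
    by rewrite ltW// ltr_sin ?in_itv//=; apply/andP; split; lra.
  by rewrite /s -sinN; split; apply: mono; lra.
(* Clipping [2 u - 1] to the range of the sine on [[-1, 1]] makes it an attained value, and moves it
   no farther from any [sin x]. *)
pose c := Num.max (- s) (Num.min s (2 * u - 1)).
have s0 : 0 <= s by have := sl 0; rewrite sin0 => -[]; lra.
have cs : Num.min (sin (- 1)) (sin 1) <= c <= Num.max (sin (- 1)) (sin 1).
  rewrite sinN -/s min_l ?max_r; [|lra|lra].
  by rewrite /c le_max lexx/= ge_max ge_min lexx orTb andbT; lra.
have [||a] := @IVT R sin (-1) 1 c _ _ cs; first lra.
  exact: (continuous_subspaceT (@continuous_sin R)).
rewrite in_itv/= => a1 ac; exists a => // x x1.
apply: le_trans (sin_lipschitz_inv a1 x1) _.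
have c0 := @cos1_gt0 R.
rewrite ler_wpM2l ?invr_ge0 ?(ltW c0)// ac.
have [h1 h2] := sl x x1.
have -> : 2 * `|u - (1 + sin x) / 2| = `|2 * u - 1 - sin x|.
  by rewrite -[X in X * `|_|](@ger0_norm _ 2)// -normrM; congr `|_|; field.
rewrite /c; have [k1|k1] := leP s (2 * u - 1).
  by rewrite max_r ?ger0_norm; lra.
have [//|k2] := leP (- s) (2 * u - 1).
by rewrite !ler0_norm; lra.
Qed.

End SinInverse.

Definition vcontinuous {R : realType} {I : Type} (Phi : (I -> R) -> R) :=
  forall (x : I -> R) (e : R), 0 < e -> exists2 del : R, 0 < del &
    forall y, (forall i, `|y i - x i| < del) -> `|Phi y - Phi x| < e.

Section MeasurableComp.
Context {R : realType} d (T : measurableType d) (I : finType).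

(** Rounding the coordinates down to multiples of [1 / m.+1] gives a vector with countably many
    values, so [Phi] of it is measurable; continuity of [Phi] lets [m] tend to infinity. *)
Lemma measurable_vcontinuous_comp (Phi : (I -> R) -> R) (X : I -> T -> R) :
  vcontinuous Phi ->
  (forall i, measurable_fun setT (X i)) ->
  measurable_fun setT (fun w => Phi (fun i => X i w)).
Proof.
move=> cPhi mX.
pose fl (m : nat) w : {ffun I -> int} := [ffun i => Num.floor (m.+1%:R * X i w)].
pose pt (m : nat) (z : {ffun I -> int}) : I -> R := fun i => (z i)%:~R / m.+1%:R.
have mfl m z : measurable [set w | fl m w = z].
  have -> : [set w | fl m w = z] =
      \bigcap_(i in [set: I]) (X i @^-1` `[(z i)%:~R / m.+1%:R, ((z i) + 1)%:~R / m.+1%:R[%classic).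
    apply/seteqP; split => w /=.
      move=> <- i _ /=; rewrite ffunE in_itv/= ler_pdivrMr// ltr_pdivlMr//.
      by rewrite [X i w * _]mulrC ge_floor// lt_succ_floor.
    move=> h; apply/ffunP => i; rewrite ffunE; apply/eqP; rewrite floor_eq.
    have := h i Logic.I; rewrite /= in_itv/= ler_pdivrMr// ltr_pdivlMr//.
    by rewrite [X i w * _]mulrC.
  apply: fin_bigcap_measurable; first exact: finite_finset.
  move=> i _; rewrite -[X in measurable X]setTI; apply: mX => //; exact: measurable_itv.
apply: (measurable_fun_cvg (h := fun m w => Phi (pt m (fl m w)))) => //.
  move=> m _ A mA; rewrite setTI.
  have -> : (fun w => Phi (pt m (fl m w))) @^-1` A =
      \bigcup_(z in [set z | A (Phi (pt m z))]) [set w | fl m w = z].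
    apply/seteqP; split => w /=; first by move=> h; exists (fl m w).
    by move=> [z /= Az ->].
  rewrite bigcup_mkcond; apply: (@countable_bigcupT_measurable _ _ {ffun I -> int}).
    exact: countableP.
  by move=> z; case: ifP.
move=> w _; apply/cvgrPdist_lt => e e0.
have [del del0 h] := cPhi (fun i => X i w) e e0.
have del0' : 0 < del^-1 by rewrite invr_gt0.
near=> m; rewrite distrC; apply: h => i.
rewrite /pt ffunE.
have mp : 0 < m.+1%:R :> R by rewrite ltr0n.
set x := X i w; have f1 := ge_floor (m.+1%:R * x); have := lt_succ_floor (m.+1%:R * x); rewrite intrD => f2.
have hm : m.+1%:R^-1 < del.
  rewrite -[del]invrK ltf_pV2 ?posrE//; apply: lt_trans (_ : m%:R < _); last by rewrite ltr_nat.
  by near: m; exact: nbhs_infty_gtr.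
apply: le_lt_trans hm.
set z := _%:~R in f1 f2 *.
have -> : z / m.+1%:R - x = m.+1%:R^-1 * (z - m.+1%:R * x) by field; rewrite gt_eqF.
rewrite normrM gtr0_norm ?invr_gt0//.
rewrite ler_piMr ?invr_ge0 ?(ltW mp)//.
rewrite ler_norml; apply/andP; split; lra.
Unshelve. all: by end_near. Qed.

End MeasurableComp.

Section ApproxIntegral.
Context {R : realType} d (T : measurableType d) (P : probability T R).

Lemma Rintegral_approx (U W : T -> R) (M c D : R) (A : set T) :
  measurable_fun setT U -> measurable_fun setT W -> measurable A ->
  (forall w, `|U w| <= M) -> (forall w, `|W w| <= M) ->
  (forall w, `|U w - W w| <= c + D * \1_A w) ->
  `|\int[P]_w U w - \int[P]_w W w| <= c + D * fine (P A).
Proof.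
move=> mU mW mA UM WM UW.
have iU := bounded_integrable P mU UM; have iW := bounded_integrable P mW WM.
have iA : P.-integrable setT (EFin \o (\1_A : T -> R)).
  apply: (@bounded_integrable _ _ _ _ _ 1); first exact: measurable_indic.
  by move=> w; rewrite indicE; case: (_ \in _); rewrite ?normr1 ?normr0.
have iUW : P.-integrable setT (EFin \o (fun w => U w - W w)).
  by rewrite /comp; under eq_fun do rewrite EFinB; exact: integrableB.
have iDA : P.-integrable setT (EFin \o (fun w => D * \1_A w)).
  exact: (integrableZl measurableT D iA).
have ic : P.-integrable setT (EFin \o (fun w : T => c)).
  by apply: (@bounded_integrable _ _ _ _ _ `|c|).
rewrite -RintegralB//; apply: le_trans (le_normr_Rintegral _ iUW) _ => //.
apply: (@le_trans _ _ (\int[P]_w (c + D * \1_A w))).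
  apply: le_Rintegral => //.
  - exact: (integrable_norm iUW).
  - by rewrite /comp; under eq_fun do rewrite EFinD; exact: integrableD.
rewrite RintegralD// Rintegral_cst_prob RintegralZl//.
by rewrite /Rintegral integral_indic// setIT.
Qed.

End ApproxIntegral.

Definition vlip {R : realType} {I : finType} (L : R) (Phi : (I -> R) -> R) :=
  forall x y, `|Phi x - Phi y| <= L * \sum_i `|x i - y i|.

Definition vset {R : realType} {I : finType} (k : I) (z : R) (x : I -> R) : I -> R :=
  fun i => if i == k then z else x i.

Lemma vlip_continuous {R : realType} {I : finType} (L : R) (Phi : (I -> R) -> R) :
  vlip L Phi -> vcontinuous Phi.
Proof.
move=> hL x e e0.
have K0 : 0 < (`|L| + 1) * (#|I|%:R + 1).
  by rewrite mulr_gt0// ltr_wpDl.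
exists (e / ((`|L| + 1) * (#|I|%:R + 1))); first by rewrite divr_gt0.
move=> y hy; apply: le_lt_trans (hL _ _) _.
set de := e / _ in hy.
have de0 : 0 < de by rewrite divr_gt0.
have hs : \sum_i `|y i - x i| <= #|I|%:R * de.
  apply: (@le_trans _ _ (\sum_(i : I) de)).
    by apply: ler_sum => i _; exact: ltW.
  by rewrite sumr_const mulr_natl.
have s0 : 0 <= \sum_i `|y i - x i| by rewrite sumr_ge0.
have n0 : 0 <= #|I|%:R :> R by [].
apply: (@le_lt_trans _ _ (`|L| * (#|I|%:R * de))).
  apply: (@le_trans _ _ (`|L| * \sum_i `|y i - x i|)); first by rewrite ler_wpM2r ?ler_norm.
  by rewrite ler_wpM2l.
have -> : e = (`|L| + 1) * (#|I|%:R + 1) * de by rewrite /de mulrC divfK// gt_eqF.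
by rewrite mulrA ltr_pM2r//; have := normr_ge0 L; nra.
Qed.

Lemma measurable_tail {R : realType} dd (S : measurableType dd) (f : S -> R) (K : R) : measurable_fun setT f ->
  measurable [set w | K < `|f w|].
Proof.
move=> mf; have -> : [set w | K < `|f w|] = (fun w => `|f w|) @^-1` `]K, +oo[%classic.
  by apply/seteqP; split => w /=; rewrite in_itv/= andbT.
rewrite -[X in measurable X]setTI; apply: (measurableT_comp (@normr_measurable _ _) mf) => //.
Qed.

Lemma measure_bigcup_le {R : realType} d (T : measurableType d) (P : probability T R)
  (I : finType) (A : I -> set T) : (forall i, measurable (A i)) ->
  (P (\bigcup_(i in [set: I]) A i) <= \sum_i P (A i))%E.
Proof.
move=> mA; have -> : \bigcup_(i in [set: I]) A i = \big[setU/set0]_(i <- enum I) A i.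
  rewrite -bigcup_seq; apply: eq_bigcupl; split => i //= _; by rewrite mem_enum.
rewrite -[X in (_ <= X)%E]big_enum/=; elim: (enum I) => [|i r ih].
  by rewrite !big_nil measure0.
rewrite !big_cons; apply: le_trans (measureU2 _ _ _) _ => //.
  by apply: bigsetU_measurable.
by rewrite leeD2l.
Qed.

Section TrigConvergence.
Context {R : realType} d d' (T : measurableType d) (T' : measurableType d')
  (P : probability T R) (P' : probability T' R) (I : finType).
Variables (X : nat -> I -> T -> R) (G : I -> T' -> R).
Hypotheses (mX : forall n i, measurable_fun setT (X n i))
  (mG : forall i, measurable_fun setT (G i)).

Let E n (Phi : (I -> R) -> R) := \int[P]_w Phi (fun i => X n i w).
Let E' (Phi : (I -> R) -> R) := \int[P']_w Phi (fun i => G i w).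

Definition admissible (Phi : (I -> R) -> R) :=
  [/\ forall n, measurable_fun setT (fun w => Phi (fun i => X n i w)),
      measurable_fun setT (fun w => Phi (fun i => G i w)) &
      exists B, forall x, `|Phi x| <= B].

Definition wconv Phi := E n Phi @[n --> \oo] --> E' Phi.

Definition trig (t : I -> R) (c : R) (x : I -> R) : R := cos (\sum_i t i * x i + c).

(** Convergence is required against every trigonometric factor, not only for [Phi] itself; this
    makes the class stable under multiplication by sines. *)
Definition trigconv Phi := admissible Phi /\
  forall t c, wconv (fun x => Phi x * trig t c x).

Lemma admissible_integrable Phi : admissible Phi ->
  (forall n, P.-integrable setT (EFin \o (fun w => Phi (fun i => X n i w)))) /\
  P'.-integrable setT (EFin \o (fun w => Phi (fun i => G i w))).
Proof.
move=> [m1 m2 [B hB]]; split => [n|].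
  exact: (bounded_integrable P (m1 n) (fun w => hB _)).
exact: (bounded_integrable P' m2 (fun w => hB _)).
Qed.

Lemma admissible_continuous Phi : vcontinuous Phi ->
  (exists B, forall x, `|Phi x| <= B) -> admissible Phi.
Proof.
by move=> cP hB; split => // [n|]; exact: measurable_vcontinuous_comp.
Qed.

Lemma admissible_cst (a : R) : admissible (fun=> a).
Proof. by split => //; exists `|a|. Qed.

Lemma admissibleD Phi Psi : admissible Phi -> admissible Psi ->
  admissible (fun x => Phi x + Psi x).
Proof.
move=> [m1 m2 [B hB]] [m1' m2' [B' hB']]; split => [n||].
- exact: measurable_funD.
- exact: measurable_funD.
- by exists (B + B') => x; apply: le_trans (ler_normD _ _) _; exact: lerD.
Qed.

Lemma admissibleM Phi Psi : admissible Phi -> admissible Psi ->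
  admissible (fun x => Phi x * Psi x).
Proof.
move=> [m1 m2 [B hB]] [m1' m2' [B' hB']]; split => [n||].
- exact: measurable_funM.
- exact: measurable_funM.
- by exists (B * B') => x; rewrite normrM ler_pM.
Qed.

Lemma admissible_trig t c : admissible (trig t c).
Proof.
split => [n||].
- apply: measurable_cosT; apply: measurable_funD => //.
  by apply: measurable_sum => i; exact: measurable_funM.
- apply: measurable_cosT; apply: measurable_funD => //.
  by apply: measurable_sum => i; exact: measurable_funM.
- by exists 1 => x; exact: cos_max.
Qed.

Lemma wconvD Phi Psi : admissible Phi -> admissible Psi -> wconv Phi -> wconv Psi ->
  wconv (fun x => Phi x + Psi x).
Proof.
move=> aPhi aPsi cPhi cPsi; have [i1 i1'] := admissible_integrable aPhi.
have [i2 i2'] := admissible_integrable aPsi.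
rewrite /wconv; have -> : E' (fun x => Phi x + Psi x) = E' Phi + E' Psi by exact: RintegralD.
have -> : (fun n => E n (fun x => Phi x + Psi x)) = (fun n => E n Phi + E n Psi).
  by apply/funext => n; exact: RintegralD.
exact: cvgD.
Qed.

Lemma wconvZ (a : R) Phi : admissible Phi -> wconv Phi -> wconv (fun x => a * Phi x).
Proof.
move=> aPhi cPhi; have [i1 i1'] := admissible_integrable aPhi.
rewrite /wconv; have -> : E' (fun x => a * Phi x) = a * E' Phi by exact: RintegralZl.
have -> : (fun n => E n (fun x => a * Phi x)) = (fun n => a * E n Phi).
  by apply/funext => n; exact: RintegralZl.
exact: cvgMr.
Qed.

Lemma wconv_approx Phi : admissible Phi ->
  (forall e : R, 0 < e -> exists Psi, [/\ wconv Psi, forall n, `|E n Phi - E n Psi| <= e &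
     `|E' Phi - E' Psi| <= e]) -> wconv Phi.
Proof.
move=> aPhi h; apply/cvgrPdist_lt => e e0.
have e4 : 0 < e / 4 by rewrite divr_gt0.
have [Psi [cP h1 h2]] := h _ e4.
move/cvgrPdist_lt: cP => /(_ _ e4) cP.
near=> n.
have h3 : `|E' Psi - E n Psi| < e / 4 by near: n; exact: cP.
have h1' := h1 n.
have -> : E' Phi - E n Phi = (E' Phi - E' Psi) + (E' Psi - E n Psi) - (E n Phi - E n Psi) by ring.
apply: le_lt_trans (ler_normB _ _) _.
have := ler_normD (E' Phi - E' Psi) (E' Psi - E n Psi); lra.
Unshelve. all: by end_near. Qed.

Lemma trigconvD Phi Psi : trigconv Phi -> trigconv Psi -> trigconv (fun x => Phi x + Psi x).
Proof.
move=> [a1 c1] [a2 c2]; split; first exact: admissibleD.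
move=> t c; have -> : (fun x => (Phi x + Psi x) * trig t c x) =
  (fun x => Phi x * trig t c x + Psi x * trig t c x) by apply/funext => x; rewrite mulrDl.
by apply: wconvD => //; apply: admissibleM => //; exact: admissible_trig.
Qed.

Lemma trigconvZ (a : R) Phi : trigconv Phi -> trigconv (fun x => a * Phi x).
Proof.
move=> [a1 c1]; split; first exact: admissibleM (admissible_cst _) a1.
move=> t c; have -> : (fun x => (a * Phi x) * trig t c x) =
  (fun x => a * (Phi x * trig t c x)) by apply/funext => x; rewrite mulrA.
by apply: wconvZ => //; apply: admissibleM => //; exact: admissible_trig.
Qed.

(** [2 sin y cos z = sin (z + y) - sin (z - y)]: the frequency in coordinate [k] moves by [r] up and
    down, and the phase [- pi / 2] turns the sines into cosines. *)
Lemma trigconv_sinM (r : R) (k : I) Phi : trigconv Phi ->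
  trigconv (fun x => sin (r * x k) * Phi x).
Proof.
move=> [a1 c1]; split.
  apply: admissibleM => //; split => [n||].
  - by apply: measurable_sinT; exact: measurable_funM.
  - by apply: measurable_sinT; exact: measurable_funM.
  - by exists 1 => x; exact: sin_max.
move=> t c.
pose t1 i := t i + r *+ (i == k); pose t2 i := t i - r *+ (i == k).
have tE (a : R) (x : I -> R) : \sum_i (t i + a *+ (i == k)) * x i = \sum_i t i * x i + a * x k.
  under eq_bigr do rewrite mulrDl; rewrite big_split/=; congr (_ + _).
  rewrite (bigD1 k)//= eqxx big1 ?addr0// => i /negPf ->; by rewrite mul0r.
have -> : (fun x => sin (r * x k) * Phi x * trig t c x) =
  (fun x => 2^-1 * (Phi x * trig t1 (c - pi / 2) x) +
            - 2^-1 * (Phi x * trig t2 (c - pi / 2) x)).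
  apply/funext => x; rewrite /trig /t1 /t2.
  under [in X in _ = _ + _ * (_ * cos (X + _))]eq_bigr do rewrite -mulNrn.
  rewrite !tE; set u := \sum_i _; set y := r * x k.
  have sE z : cos (z - pi / 2) = sin z by rewrite -[in RHS](subrK (pi / 2) z) sinDpihalf.
  rewrite !addrA !sE; have -> : u + y + c = u + c + y by ring.
  have -> : u + - r * x k + c = u + c - y by rewrite /y; ring.
  by rewrite [sin (u + c + y)]sinD sinB; field.
have aM u v : admissible (fun x => Phi x * trig u v x).
  exact: admissibleM a1 (admissible_trig _ _).
by apply: wconvD; [exact: admissibleM (admissible_cst _) (aM _ _)|
  exact: admissibleM (admissible_cst _) (aM _ _)|exact: wconvZ|exact: wconvZ].
Qed.

(** Each step of the recursion multiplies by [(1 - sin) / 2] or [(1 + sin) / 2], and the class is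
    closed under both. *)
Lemma trigconv_bern q (k : I) (r : R) (h : (I -> R) -> nat -> R) :
  (forall z, trigconv (fun x => h x z)) ->
  trigconv (fun x => bern q (h x) ((1 + sin (r * x k)) / 2)).
Proof.
elim: q h => [|q ih] h hh /=; first exact: hh.
have h1 := ih _ hh; have h2 := ih (fun x z => h x z.+1) (fun z => hh z.+1).
set b1 := fun x => bern q (h x) _ in h1.
set b2 := fun x => bern q (fun z => h x z.+1) _ in h2.
have := trigconvD (trigconvD (trigconvZ 2^-1 h1) (trigconvZ (- 2^-1) (trigconv_sinM r k h1)))
  (trigconvD (trigconvZ 2^-1 h2) (trigconvZ 2^-1 (trigconv_sinM r k h2))).
congr trigconv; apply/funext => x; by rewrite -/(b1 x) -/(b2 x); field.
Qed.

Lemma bern_norm_le q (h : nat -> R) (B y : R) : 0 <= y <= 1 -> (forall z, `|h z| <= B) ->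
  `|bern q h y| <= B.
Proof.
move=> y01 hB; apply: le_trans (bern_norm _ _ y01) _.
by rewrite -(bern_cst q y B); apply: bern_le.
Qed.

(** For [|x k| <= rho] the rescaled coordinate lies in [[-1, 1]], and its distance to the node
    [av z] is at most a multiple of that between the frequency [z / q] and [(1 + sin) / 2]; outside,
    both functions are bounded by [B]. Here [rho] is a truncation radius. *)
Lemma bern_approx (k : I) q (B L rho eta : R) (Phi : (I -> R) -> R) (av : nat -> R) (x : I -> R) :
  (0 < q)%N -> 0 < rho -> 0 < eta -> 0 <= L ->
  (forall x, `|Phi x| <= B) -> vlip L Phi ->
  (forall z y, -1 <= y <= 1 ->
    `|av z - y| <= (cos 1)^-1 * (2 * `|z%:R / q%:R - (1 + sin y) / 2|)) ->
  `|Phi x - bern q (fun z => Phi (vset k (rho * av z) x)) ((1 + sin (rho^-1 * x k)) / 2)|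
    <= L * rho * (cos 1)^-1 * 2 * (eta + (q%:R * eta)^-1) + 2 * B * (rho < `|x k|)%R%:R.
Proof.
move=> q0 rho0 eta0 L0 PB PL hav.
have c1 := @cos1_gt0 R; set C := L * rho * (cos 1)^-1 * 2.
have C0 : 0 <= C by rewrite !mulr_ge0// ?invr_ge0 ltW.
set y := rho^-1 * x k; set u := (1 + sin y) / 2.
have u01 : 0 <= u <= 1.
  by have := sin_max y; rewrite ler_norml => /andP[s1 s2]; rewrite /u; apply/andP; split; lra.
have qe0 : 0 <= eta + (q%:R * eta)^-1 by rewrite addr_ge0 ?invr_ge0 ?mulr_ge0// ltW.
case: ltP => hx /=.
  rewrite mulr1; apply: ler_wpDl; first exact: mulr_ge0.
  apply: le_trans (ler_normB _ _) _; rewrite mulrDl mul1r lerD//.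
  by apply: bern_norm_le.
rewrite mulr0 addr0 -[Phi x](bern_cst q u) -mulN1r -bernZ -bernD.
apply: le_trans (bern_norm _ _ u01) _.
apply: (@le_trans _ _ (bern q (fun z => C * `|z%:R / q%:R - u|) u)); last first.
  by rewrite bernZ ler_wpM2l// bern_abs.
apply: bern_le => // z _; rewrite mulN1r.
apply: le_trans (PL _ _) _.
rewrite (bigD1 k)//= big1 ?addr0; last by move=> i /negPf ik; rewrite /vset ik subrr normr0.
rewrite /vset eqxx.
have hy : -1 <= y <= 1.
  by move: hx; rewrite ler_norml /y ler_pdivlMl// ler_pdivrMl// mulrN1 mulr1.
have -> : x k - rho * av z = rho * - (av z - y) by rewrite /y; field; rewrite gt_eqF.
rewrite normrM normrN (gtr0_norm rho0) /C -!mulrA.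
by rewrite ler_wpM2l// ler_wpM2l ?(ltW rho0)// hav.
Qed.

Hypothesis Hcos : forall t c, wconv (trig t c).
Hypothesis Htight : forall e : R, 0 < e -> exists2 K : R, 0 < K & forall i,
  (forall n, fine (P [set w | K < `|X n i w|]) <= e) /\ fine (P' [set w | K < `|G i w|]) <= e.

(** Induction on the list of coordinates on which [Phi] depends. The Bernstein polynomial in the
    sine of [x k / rho] has coefficients in which coordinate [k] is frozen at a node, so they depend
    on one coordinate less. *)
Lemma trigconv_lip (r : seq I) (B L : R) Phi : 0 <= L ->
  (forall x, `|Phi x| <= B) -> vlip L Phi ->
  (forall x y, (forall i, i \in r -> x i = y i) -> Phi x = Phi y) -> trigconv Phi.
Proof.
move=> L0; elim: r Phi => [|k r ih] Phi PB PL Pr.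
  have -> : Phi = fun=> Phi (fun=> 0) * 1 by apply/funext => x; rewrite mulr1; exact: Pr.
  apply: trigconvZ; split; first exact: admissible_cst.
  by move=> t c; rewrite (_ : (fun x => _) = trig t c)//; apply/funext => x; rewrite mul1r.
have aP : admissible Phi.
  by apply: admissible_continuous; [exact: vlip_continuous PL|exists B].
split=> // t c; have at_ := admissible_trig t c.
apply: wconv_approx => [|e e0]; first exact: admissibleM.
have B0 : 0 <= B by apply: le_trans (PB (fun=> 0)).
(* With tail probabilities at most [e / (4 B + 4)] the exceptional event contributes at most
   [e / 2]. *)
have e1 : 0 < e / (4 * B + 4) by rewrite divr_gt0//; lra.
have [rho rho0 hrho] := Htight e1; have [hX hG] := hrho k.
pose C : R := L * rho * (cos 1)^-1 * 2.
have c1 := @cos1_gt0 R.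
have C0 : 0 <= C by rewrite !mulr_ge0// ?invr_ge0 ltW.
(* The degree [q] below makes both terms of [bern_abs] at most [eta], and then the approximation
   error [2 C eta] is at most [e / 2]. *)
have [eta eta0 etaE] : exists2 eta : R, 0 < eta & eta = e / (4 * (C + 1)).
  by exists (e / (4 * (C + 1))) => //; rewrite divr_gt0//; lra.
have [q q1 hq] : exists2 q : nat, (0 < q)%N & (q%:R * eta)^-1 <= eta.
  exists (Num.truncn (eta ^- 2)).+1 => //.
  rewrite -[leRHS]invrK lef_pV2 ?posrE ?mulr_gt0 ?invr_gt0//.
  by rewrite -ler_pdivrMr// -invfM -expr2 ltW// truncnS_gt.
have /choice[av hav] : forall z, exists a : R, forall y : R, -1 <= y <= 1 ->
    `|a - y| <= (cos 1)^-1 * (2 * `|z%:R / q%:R - (1 + sin y) / 2|).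
  by move=> z; have [a _ ha] := sin_grid (z%:R / q%:R : R); exists a.
pose Psi x := bern q (fun z => Phi (vset k (rho * av z) x)) ((1 + sin (rho^-1 * x k)) / 2).
have tPsi : trigconv Psi.
  apply: trigconv_bern => z; apply: ih => [x|x y|x y xy].
  - exact: PB.
  - apply: le_trans (PL _ _) _; rewrite ler_wpM2l// ler_sum// => i _.
    by rewrite /vset; case: eqP => // _; rewrite subrr normr0.
  - apply: Pr => i; rewrite inE /vset; case: eqP => //= _; exact: xy.
exists (fun x => Psi x * trig t c x).
have PsiB x : `|Psi x| <= B.
  apply: bern_norm_le => // ; have := sin_max (rho^-1 * x k).
  by rewrite ler_norml => /andP[s1 s2]; apply/andP; split; lra.
have main x : `|Phi x * trig t c x - Psi x * trig t c x| <= e / 2 + 2 * B * (rho < `|x k|)%R%:R.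
  rewrite -mulrBl normrM.
  apply: (@le_trans _ _ `|Phi x - Psi x|); first by rewrite ler_piMr// cos_max.
  apply: le_trans (bern_approx k x q1 rho0 eta0 L0 PB PL hav) _.
  rewrite lerD2r -/C; apply: (@le_trans _ _ (C * (2 * eta))).
    by rewrite ler_wpM2l// (_ : 2 = 1 + 1)// mulrDl mul1r lerD2l.
  rewrite etaE; have -> : C * (2 * (e / (4 * (C + 1)))) = e / 2 * (C / (C + 1)).
    by field; rewrite gt_eqF//; lra.
  rewrite ler_piMr ?divr_ge0 ?(ltW e0)// ler_pdivrMr; lra.
have trB (F : (I -> R) -> R) : (forall x, `|F x| <= B) -> forall x, `|F x * trig t c x| <= B.
  move=> FB x; rewrite normrM; apply: le_trans (_ : `|F x| * 1 <= _); last by rewrite mulr1.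
  by rewrite ler_wpM2l// cos_max.
have fin (Q : R) : 0 <= Q -> Q <= e / (4 * B + 4) -> e / 2 + 2 * B * Q <= e.
  move=> Q0 Qe; have := ler_wpM2l B0 Qe.
  have : B * (e / (4 * B + 4)) <= e / 4.
    rewrite mulrCA ler_wpM2l ?(ltW e0)// ler_pdivrMr; lra.
  lra.
have [m1 m1' _] := admissibleM aP at_.
have [m2 m2' _] := admissibleM tPsi.1 at_.
split; first exact: tPsi.2.
  move=> n; apply: le_trans (fin _ _ (hX n)); last exact: fine_ge0.
  apply: (@Rintegral_approx _ _ _ _ _ _ B) => //; first exact: measurable_tail.
  - by move=> w; exact: trB.
  - by move=> w; exact: trB.
  - by move=> w; have := main (fun i => X n i w); rewrite indicE mem_setE.
apply: le_trans (fin _ _ hG); last exact: fine_ge0.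
apply: (@Rintegral_approx _ _ _ _ _ _ B) => //; first exact: measurable_tail.
- by move=> w; exact: trB.
- by move=> w; exact: trB.
- by move=> w; have := main (fun i => G i w); rewrite indicE mem_setE.
Qed.

Definition clip (K : R) (x : I -> R) : I -> R := fun i => Num.max (- K) (Num.min K (x i)).

Lemma clip_id K x : (forall i, `|x i| <= K) -> clip K x = x.
Proof.
move=> h; apply/funext => i; rewrite /clip; have := h i.
by rewrite ler_norml => /andP[h1 h2]; rewrite min_r// max_r.
Qed.

Lemma clip_le K x i : 0 <= K -> `|clip K x i| <= K.
Proof.
move=> K0; rewrite /clip ler_norml le_max lexx/= ge_max ge_min lexx/= andbT; lra.
Qed.

(** The functions of interest involve products of coordinates and are only locally Lipschitz.
    Clipping to a large cube makes them Lipschitz, and by tightness it changes the expectations by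
    at most [e], uniformly in [n]. *)
Lemma wconv_lip (B : R) Phi : (forall x, `|Phi x| <= B) -> vcontinuous Phi ->
  (forall K : R, 1 <= K -> exists2 L : R, 0 <= L & vlip L (Phi \o clip K)) -> wconv Phi.
Proof.
move=> PB cP PL; have aP : admissible Phi by apply: admissible_continuous => //; exists B.
apply: wconv_approx => // e e0.
have B0 : 0 <= B by apply: le_trans (PB (fun=> 0)).
have D0 : 0 <= 2 * B * #|I|%:R by rewrite !mulr_ge0.
have e1 : 0 < e / (2 * B * #|I|%:R + 1) by rewrite divr_gt0//; lra.
have [K0 K00 hK0] := Htight e1; pose K := Num.max 1 K0.
have K1 : 1 <= K by rewrite /K le_max lexx.
have [L L0 PLK] := PL K K1.
have tK : trigconv (Phi \o clip K).
  apply: (@trigconv_lip (enum I) B L) => // [x|x y xy]; first exact: PB.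
  by rewrite (_ : x = y)//; apply/funext => i; apply: xy; rewrite mem_enum.
exists (Phi \o clip K).
have main dd (S : measurableType dd) (Q : probability S R) (Z : I -> S -> R) :
    (forall i, measurable_fun setT (Z i)) ->
    (forall i, fine (Q [set w | K0 < `|Z i w|]) <= e / (2 * B * #|I|%:R + 1)) ->
    measurable_fun setT (fun w => Phi (fun i => Z i w)) ->
    measurable_fun setT (fun w => Phi (clip K (fun i => Z i w))) ->
  `|\int[Q]_w Phi (fun i => Z i w) - \int[Q]_w Phi (clip K (fun i => Z i w))| <= e.
  move=> mZ hZ m1 m2; pose A := \bigcup_(i in [set: I]) [set w | K0 < `|Z i w|].
  have mA : measurable A by apply: fin_bigcup_measurable; [exact: finite_finset|move=> i _; exact: measurable_tail].
  have QA : fine (Q A) <= #|I|%:R * (e / (2 * B * #|I|%:R + 1)).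
    rewrite -lee_fin fineK ?fin_num_measure//.
    apply: (@le_trans _ _ (\sum_(i : I) Q [set w | (K0 < `|Z i w|)%R]%classic)%E).
      exact: measure_bigcup_le (fun i => measurable_tail K0 (mZ i)).
    apply: (@le_trans _ _ (\sum_(i : I) (e / (2 * B * #|I|%:R + 1))%:E)%E).
      apply: lee_sum => i _; rewrite -[leLHS]fineK ?lee_fin ?fin_num_measure//.
      exact: measurable_tail.
    by rewrite sumEFin lee_fin sumr_const [leRHS]mulr_natl.
  apply: (@le_trans _ _ (0 + 2 * B * fine (Q A))).
    apply: (@Rintegral_approx _ _ _ _ _ _ B) => // w; rewrite add0r.
    rewrite indicE; case: (boolP (w \in A)) => [_|wA] /=.
      by rewrite mulr1; apply: le_trans (ler_normB _ _) _; rewrite mulrDl mul1r lerD.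
    rewrite clip_id ?subrr ?normr0 ?mulr0// => i; rewrite leNgt; apply/negP => h.
    by move/negP: wA; apply; rewrite inE; exists i => //=; apply: le_lt_trans h; rewrite /K le_max lexx orbT.
  rewrite add0r; apply: le_trans (ler_wpM2l _ QA) _; first exact: mulr_ge0.
  have -> x y : 2 * B * (x * (e / y)) = e * (2 * B * x / y) by ring.
  by rewrite ler_piMr ?(ltW e0)// ler_pdivrMr; lra.
have [m1 m1' _] := aP; have [m2 m2' _] := tK.1.
split.
- have := tK.2 (fun=> 0) 0.
  have t1 : trig (fun=> 0) 0 = fun=> 1.
    by apply/funext => x; rewrite /trig big1 ?addr0 ?cos0// => i _; rewrite mul0r.
  by rewrite t1; congr wconv; apply/funext => x; rewrite mulr1.
- move=> n; apply: (main _ _ P (X n) (mX n) _ (m1 n) (m2 n)) => i; have [h _] := hK0 i; exact: h.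
- apply: (main _ _ P' G mG _ m1' m2') => i; have [_ h] := hK0 i; exact: h.
Qed.

End TrigConvergence.

(** * Random series *)

Section Domination.
Context {R : realType}.

(** The increasing limit may be infinite, hence the extended values; its mean is bounded because the
    second moments control the first ones. *)
Lemma dom_envelope d (T : measurableType d) (P : probability T R) (S : nat -> T -> R) (C : R) :
  0 < C -> (forall I, Lb P 2 (S I) C) -> (forall w I, 0 <= S I w) ->
  (forall w I J, (I <= J)%N -> S I w <= S J w) ->
  exists H : T -> \bar R, [/\ measurable_fun setT H, forall w, (0 <= H w)%E,
    (\int[P]_w H w <= C%:E)%E & forall w I, ((S I w)%:E <= H w)%E].
Proof.
move=> C0 SC S0 Smono.
have mS I : measurable_fun setT (fun w => (S I w)%:E) by apply/measurable_EFinP; exact: (SC I).1.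
have ndS w : {homo (fun I => (S I w)%:E) : I J / (I <= J)%N >-> (I <= J)%E}.
  by move=> I J IJ; rewrite lee_fin Smono.
exists (fun w => limn (fun I => (S I w)%:E)); split.
- apply: (emeasurable_fun_cvg (fun I w => (S I w)%:E)) => // w _.
  exact/ereal_nondecreasing_is_cvgn/ndS.
- by move=> w; apply: lime_ge; [exact/ereal_nondecreasing_is_cvgn/ndS|apply: nearW => I; rewrite lee_fin].
- rewrite monotone_convergence//; last first.
    by move=> I w _; rewrite lee_fin.
  apply: lime_le.
    apply: ereal_nondecreasing_is_cvgn => I J IJ; apply: ge0_le_integral_any => w.
    + by rewrite lee_fin.
    + exact: ndS.
  apply: nearW => I.
  have := (@Lb_mono _ _ _ P 1 2 (S I) C ltr01 _ C0 (SC I)).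
  have h12 : (1:R) <= 2 by rewrite ler1n.
  move=> /(_ h12) [_]; rewrite powRr1 ?(ltW C0)//.
  rewrite (_ : (fun w => (`|S I w| `^ 1)%:E) = fun w => (S I w)%:E)//.
  by apply/funext => w; rewrite powRr1// ger0_norm.
- by move=> w I; apply: lime_ge; [exact/ereal_nondecreasing_is_cvgn/ndS|exists I => // J; exact: ndS].
Qed.

Lemma nneg_tail (h : nat -> R) (C : R) :
  (forall i, 0 <= h i) -> (forall n, \sum_(0 <= i < n) h i <= C) ->
  forall e : R, 0 < e -> exists j0, forall j j', (j0 <= j)%N -> \sum_(j <= i < j') h i <= e.
Proof.
move=> h0 hC e e0.
have ch : cvgn (series h).
  apply: nondecreasing_is_cvgn.
    apply/nondecreasing_seqP => n; rewrite /series/= big_nat_recr//=.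
    by rewrite lerDl.
  by exists C => _ [n _ <-]; exact: hC.
move/cvg_cauchy/cauchy_seriesP : ch => /(_ _ e0) [[A B] [[nA _ hA] [nB _ hB]] hAB].
exists (maxn nA nB) => j j' jj; have [j'j|jj'] := leqP j' j; first by rewrite big_geq// ltW.
have := hAB (j, j'); rewrite /= geq_max in jj; move/andP: jj => [j1 j2].
move=> /(_ (conj (hA j _) (hB j' _))) /= => /(_ _ _).
by move=> hh; apply/ltW/(le_lt_trans (ler_norm _))/hh => //=; exact: leq_trans (ltnW jj').
Qed.

(** Weierstrass test for a telescoping series: the majorants [h] do not depend on [v], so neither
    does [j0]. *)
Lemma uniform_limit (V : Type) (u : nat -> V -> R) (h : nat -> R) (C : R) :
  (forall i, 0 <= h i) -> (forall n, \sum_(0 <= i < n) h i <= C) ->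
  (forall j v, `|u j.+1 v - u j v| <= h j) ->
  exists y : V -> R, forall e : R, 0 < e -> exists j0, forall j v, (j0 <= j)%N -> `|y v - u j v| <= e.
Proof.
move=> h0 hC uh.
have tel j j' v : (j <= j')%N -> `|u j' v - u j v| <= \sum_(j <= i < j') h i.
  move=> jj'; rewrite -(@telescope_sumr _ j j' (u ^~ v))//.
  apply: le_trans (ler_norm_sum _ _ _) _; exact: ler_sum.
have cu v : cvgn (u ^~ v).
  apply/cauchy_cvgP/cauchy_exP => e e0.
  have e2 : 0 < e / 2 by rewrite divr_gt0.
  have [j0 hj] := nneg_tail h0 hC e2; exists (u j0 v); exists j0 => // j /= jj.
  rewrite /ball/= distrC; apply: le_lt_trans (tel _ _ _ jj) _.
  apply: le_lt_trans (hj j0 j (leqnn _)) _; lra.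
exists (fun v => limn (u ^~ v)) => e e0; have [j0 hj] := nneg_tail h0 hC e0.
exists j0 => j v jj.
apply/ler_addgt0Pr => e' e'0.
move/cvgrPdist_le: (cu v) => /(_ _ e'0) [n1 _ h1].
have := h1 (maxn n1 j) (leq_maxl _ _); have := tel j (maxn n1 j) v (leq_maxr _ _).
have := hj j (maxn n1 j) jj; set x := limn _; set y := u (maxn n1 j) v => a1 a2 a3.
have -> : x - u j v = (x - y) + (y - u j v) by ring.
by apply: le_trans (ler_normD _ _) _; rewrite addrC; apply: lerD => //; exact: le_trans a1.
Qed.

End Domination.

Section Series.
Context {R : realType} (V : Type) (rho : V -> V -> R).
Hypotheses (rho_refl : forall v, rho v v = 0) (rho_ge0 : forall u v, 0 <= rho u v)
  (rho_sym : forall u v, rho u v = rho v u)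
  (rho_tri : forall u v w, rho u w <= rho u v + rho v w).
Hypothesis Hcomp : rho_compact rho.
Variables (a : \bar R) (tu : R -> R).
Hypotheses (Ha : (2%:E < a)%E) (tu1 : forall p, prange a p -> 1 <= tu p).
Hypothesis HJ : (Jint rho a tu < +oo)%E.
Variable v0 : V.
Variables (l : nat -> V -> R) (sigma : R).
Hypothesis Hl1 : forall u v m, \sum_(0 <= i < m) `|l i u - l i v| <= rho u v.
Hypothesis Hl2 : forall v m, \sum_(0 <= i < m) `|l i v| <= sigma.

Definition pdiff (T : Type) (W : nat -> T -> R) m m' v w := \sum_(m <= i < m') l i v * W i w.

Definition psum (T : Type) (W : nat -> T -> R) m v w := pdiff W 0 m v w.

Definition moment_bound d (T : measurableType d) (P : probability T R) (W : nat -> T -> R) :=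
  forall p i, prange a p -> Lb P p (W i) (tu p).

Lemma sum_nat_le_all (h : nat -> R) (C : R) m m' : (forall i, 0 <= h i) ->
  (forall n, \sum_(0 <= i < n) h i <= C) -> \sum_(m <= i < m') h i <= C.
Proof.
move=> h0 hC; have [m'm|mm'] := leqP m' m.
  by rewrite big_geq//; have := hC 0%N; rewrite big_geq.
apply: le_trans (hC m'); rewrite (big_cat_nat (leq0n m) (ltnW mm'))/=.
by rewrite lerDr sumr_ge0.
Qed.

Lemma prange2 : prange a 2.
Proof. by split => /=. Qed.

Lemma psumB (T : Type) (W : nat -> T -> R) m m' v w : (m <= m')%N ->
  psum W m' v w - psum W m v w = pdiff W m m' v w.
Proof.
by move=> mm'; rewrite /psum /pdiff (big_cat_nat (leq0n m) mm')/= addrAC subrr add0r.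
Qed.

Lemma l_lip i u v : `|l i u - l i v| <= rho u v.
Proof.
apply: le_trans (Hl1 u v i.+1); rewrite big_nat_recr//= lerDr sumr_ge0//.
Qed.

Lemma pdiff_cont (T : Type) (W : nat -> T -> R) m m' : cont_paths rho (pdiff W m m').
Proof.
move=> w v e e0; pose B : R := \sum_(m <= i < m') `|W i w| + 1.
have B0 : 0 < B by rewrite ltr_wpDl// sumr_ge0.
exists (e / B); first by rewrite divr_gt0.
move=> u uv; rewrite /pdiff -sumrB.
apply: (@le_lt_trans _ _ (rho v u * (B - 1))); last first.
  rewrite ltr_pdivlMr// in uv; apply: le_lt_trans uv; rewrite ler_wpM2l//; lra.
rewrite /B addrK mulr_sumr; apply: le_trans (ler_norm_sum _ _ _) _.
apply: ler_sum => i _; rewrite -mulrBl normrM ler_wpM2r// rho_sym; exact: l_lip.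
Qed.

Section OneSpace.
Context d (T : measurableType d) (P : probability T R) (W : nat -> T -> R).
Hypothesis Wb : moment_bound P W.

Lemma pdiff_incr m m' p u v : prange a p ->
  Lb P p (fun w => pdiff W m m' u w - pdiff W m m' v w) (tu p * rho u v).
Proof.
move=> pa; have [p2 _] := pa; have p1 : 1 <= p by lra.
have t0 : 0 <= tu p by rewrite (le_trans _ (tu1 pa)).
have -> : (fun w => pdiff W m m' u w - pdiff W m m' v w) =
    (fun w => \sum_(i <- index_iota m m') (l i u - l i v) * W i w).
  by apply/funext => w; rewrite /pdiff -sumrB; apply: eq_bigr => i _; rewrite mulrBl.
apply: (@LbW _ _ _ _ _ _ (\sum_(i <- index_iota m m') `|l i u - l i v| * tu p)).
- lra.
- by rewrite sumr_ge0// => i _; rewrite mulr_ge0.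
- rewrite -mulr_suml mulrC ler_wpM2l//; apply: sum_nat_le_all => //; exact: Hl1.
apply: Lb_sum => // i; first by rewrite mulr_ge0.
by apply: LbZ => //; exact: Wb.
Qed.

Lemma pdiff_base m m' p v (C : R) : prange a p -> \sum_(m <= i < m') `|l i v| <= C ->
  Lb P p (pdiff W m m' v) (tu p * C).
Proof.
move=> pa hC; have [p2 _] := pa; have p1 : 1 <= p by lra.
have t0 : 0 <= tu p by rewrite (le_trans _ (tu1 pa)).
apply: (@LbW _ _ _ _ _ _ (\sum_(i <- index_iota m m') `|l i v| * tu p)).
- lra.
- by rewrite sumr_ge0// => i _; rewrite mulr_ge0.
- by rewrite -mulr_suml mulrC ler_wpM2l.
apply: Lb_sum => // i; first by rewrite mulr_ge0.
by apply: LbZ => //; exact: Wb.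
Qed.

End OneSpace.

Lemma entterm_tailS (r : R) : 0 < r ->
  exists i0, forall I, \sum_(i0.+1 <= i < I) entterm rho a tu i <= r.
Proof.
move=> r0; have [i0 hi0] := entterm_tail rho_refl rho_sym rho_tri Hcomp Ha tu1 HJ v0 r0.
exists i0 => I; apply: le_trans (hi0 I); have [Ii|iI] := ltnP i0 I.
  by rewrite [leRHS]big_ltn// lerDr; exact: entterm_ge0.
by rewrite !big_geq// (leq_trans iI).
Qed.

(** There are two sources of error: the values at the finitely many points of one net, whose
    coefficient tails are small beyond [m0], and the chained increments, bounded by the entropy tail
    for every block from [m] to [m']. Neither choice looks at the probability space. *)
Lemma tail_dom (eta : R) : 0 < eta -> exists m0, forall d (T : measurableType d)
  (P : probability T R) (W : nat -> T -> R), moment_bound P W ->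
  forall m m', (m0 <= m)%N -> exists H : T -> \bar R,
   [/\ measurable_fun setT H, forall w, (0 <= H w)%E, (\int[P]_w H w <= eta%:E)%E &
       forall v w, (`|pdiff W m m' v w|%:E <= H w)%E].
Proof.
move=> eta0; have t2 := tu1 prange2; set t := tu 2 in t2.
have t0 : 0 < t by lra.
(* Chaining yields [t * (n0 * e1 + 4 * r)]; this [r] makes the second part [eta / 2], and [e1] below
   makes the first at most [eta / 2]. *)
have r0 : 0 < eta / (8 * t) by rewrite divr_gt0// mulr_gt0.
have [i0 hi0] := entterm_tailS r0.
have [N [F NF]] := nets rho_refl rho_sym rho_tri Hcomp.
pose n0 : R := (N i0)%:R; have n00 : 0 <= n0 by rewrite /n0.
have e10 : 0 < eta / (2 * t * (n0 + 1)) by rewrite divr_gt0// !mulr_gt0//; lra.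
set e1 := eta / _ in e10.
have /choice[mj hmj] : forall j : 'I_(N i0), exists mj, forall m m', (mj <= m)%N ->
    \sum_(m <= i < m') `|l i (F i0 j)| <= e1.
  by move=> j; apply: (@nneg_tail R (fun i => `|l i (F i0 j)|) sigma) => // m; exact: Hl2.
exists (\max_(j < N i0) mj j) => d T P W Wb m m' m0m.
have base p j : prange a p -> Lb P p (pdiff W m m' (F i0 j)) (tu p * e1).
  move=> pa; apply: pdiff_base => //; apply: hmj; apply: leq_trans m0m.
  exact: (leq_bigmax j).
have [S [SC S0 Smono SD]] := chaining rho_refl rho_ge0 rho_sym rho_tri Hcomp Ha tu1 v0
  (@pdiff_cont T W m m') (fun p u v pa => pdiff_incr Wb m m' u v pa) NF
  (fun j => ltW e10) base hi0.
have Sb I : Lb P 2 (S I) eta.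
  apply: LbW (SC 2 I prange2) => //.
  - apply: mulr_ge0; first exact: ltW.
    apply: addr_ge0; first by apply: sumr_ge0 => j _; exact: ltW.
    by rewrite mulr_ge0// ltW.
  rewrite sumr_const card_ord -/t -[e1 *+ _]mulr_natl -/n0.
  have -> : t * (n0 * e1 + 4 * (eta / (8 * t))) = eta / 2 * (n0 / (n0 + 1)) + eta / 2.
    by rewrite /e1; field; rewrite !gt_eqF//; lra.
  have : n0 / (n0 + 1) <= 1 by rewrite ler_pdivrMr; lra.
  by move=> /(ler_wpM2l (ltW (divr_gt0 eta0 (ltr0n _ 2)))); lra.
have [H [mH H0 HI HS]] := dom_envelope eta0 Sb S0 Smono.
exists H; split => // v w; apply/lee_addgt0Pr => e e0.
have [I hI] := SD v w e e0.
apply: (@le_trans _ _ ((S I w)%:E + e%:E)%E); first by rewrite -EFinD lee_fin.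
exact: leeD2r.
Qed.


Lemma sum_dyad (j n : nat) : \sum_(0 <= i < n) dyad (j + i) <= 2 * dyad j :> R.
Proof.
have -> : \sum_(0 <= i < n) dyad (j + i) = 2 * dyad j - 2 * dyad (j + n) :> R.
  elim: n => [|n ih]; first by rewrite big_geq// addn0 subrr.
  by rewrite big_nat_recr//= ih addnS dyadS; field.
by rewrite gerBl mulr_ge0// ltW// dyad_gt0.
Qed.

(* The levels [ms] are chosen before the probability space: they serve Q_L[f] for
   all L and the Gaussian limit at once. *)
Definition tail_levels (ms : nat -> nat) := (forall j, (ms j <= ms j.+1)%N) /\
  forall j d (T : measurableType d) (P : probability T R) (W : nat -> T -> R),
    moment_bound P W -> forall m m', (ms j <= m)%N -> exists H : T -> \bar R,
   [/\ measurable_fun setT H, forall w, (0 <= H w)%E, (\int[P]_w H w <= (dyad j)%:E)%E &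
       forall v w, (`|pdiff W m m' v w|%:E <= H w)%E].

Lemma tail_levels_exists : exists2 ms, tail_levels ms & forall j, (j <= ms j)%N.
Proof.
have /choice[m0 hm0] := fun j => tail_dom (@dyad_gt0 R j).
(* The running maximum makes the levels nondecreasing, and the comparison with [j] makes them tend
   to infinity. *)
exists (fun j => maxn j (\max_(i < j.+1) m0 i)); last by move=> j; rewrite leq_maxl.
split => [j|j d T P W Wb m m' jm].
  rewrite geq_max !leq_max leqnSn/=; apply/orP; right.
  by rewrite [leqRHS]big_ord_recr/= leq_maxl.
apply: hm0 => //; apply: leq_trans jm; rewrite leq_max; apply/orP; right.
exact: (leq_bigmax (ord_max : 'I_j.+1)).
Qed.

Variable ms : nat -> nat.
Hypothesis Hms : tail_levels ms.

(** [Y] is 0 on the null set [N], so that every path is continuous. Uniform convergence off [N]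
    yields this continuity, while the envelopes [G] give a rate in mean that is the same on all
    spaces. *)
Definition series_version d (T : measurableType d) (P : probability T R)
  (W : nat -> T -> R) (Y : V -> T -> R) (N : set T) :=
  [/\ measurable N, P N = 0%E, forall w, N w -> forall v, Y v w = 0,
      forall w, ~ N w -> forall e : R, 0 < e -> exists j0, forall j v, (j0 <= j)%N ->
        `|Y v w - psum W (ms j) v w| <= e &
      exists G : nat -> T -> \bar R, [/\ forall j, measurable_fun setT (G j),
        forall j w, (0 <= G j w)%E, forall j, (\int[P]_w G j w <= (2 * dyad j)%:E)%E &
        forall w, ~ N w -> forall j v, (`|Y v w - psum W (ms j) v w|%:E <= G j w)%E]].

(** The envelopes [H j] of the successive blocks have summable means, so their sum is finite off a
    null set; there the partial sums along [ms] are Cauchy uniformly in [v]. *)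
Lemma series_version_exists d (T : measurableType d) (P : probability T R) (W : nat -> T -> R) :
  moment_bound P W -> exists Y N, series_version P W Y N.
Proof.
move=> Wb; have /choice[H hH] := fun j => Hms.2 j d T P W Wb (ms j) (ms j.+1) (leqnn _).
have mH j : measurable_fun setT (H j) by have [] := hH j.
have H0 j w : (0 <= H j w)%E by have [] := hH j.
have HI j : (\int[P]_w H j w <= (dyad j)%:E)%E by have [] := hH j.
have HW j v w : (`|psum W (ms j.+1) v w - psum W (ms j) v w|%:E <= H j w)%E.
  by rewrite psumB ?(Hms.1 j)//; have [] := hH j.
pose G j w := (\sum_(i <oo) H (j + i)%N w)%E.
have mG j : measurable_fun setT (G j).
  have := @ge0_emeasurable_sum _ _ _ setT (fun i => H (j + i)%N) xpredT.
  by rewrite /G; apply => // k _ w _; exact: H0.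
have G0 j w : (0 <= G j w)%E by apply: nneseries_ge0 => i _ _; exact: H0.
have GI j : (\int[P]_w G j w <= (2 * dyad j)%:E)%E.
  rewrite integral_nneseries//; apply: lime_le.
    by apply: is_cvg_nneseries => i _ _; apply: integral_ge0 => w _; exact: H0.
  apply: nearW => n; apply: (@le_trans _ _ (\sum_(0 <= i < n) (dyad (j + i))%:E)%E).
    by apply: lee_sum => i _; exact: HI.
  by rewrite sumEFin lee_fin sum_dyad.
have iG : P.-integrable setT (G 0%N).
  apply/integrableP; split => //; under eq_integral do rewrite gee0_abs//.
  by apply: le_lt_trans (GI 0%N) _; rewrite ltry.
have [N [mN PN NG]] := integrable_ae measurableT iG.
have Gfin w : ~ N w -> G 0%N w \is a fin_num.
  by move=> Nw; apply: contra_notT Nw => h; apply: NG => /= /(_ Logic.I); exact/negP.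
have sumG w n : (\sum_(0 <= i < n) H i w <= G 0%N w)%E.
  by apply: nneseries_lim_ge => i _ _; exact: H0.
have sumGj w j j' : (\sum_(j <= i < j') H i w <= G j w)%E.
  rewrite -{1}[j]add0n big_addn.
  under eq_bigr do rewrite addnC.
  by apply: nneseries_lim_ge => i _ _; exact: H0.
have Hfin w i : ~ N w -> H i w \is a fin_num.
  move=> Nw; have := sumG w i.+1; rewrite big_nat_recr//= => h.
  rewrite ge0_fin_numE//; apply: le_lt_trans (_ : (G 0%N w < +oo)%E).
    by apply: le_trans h; rewrite leeDr// sume_ge0.
  by rewrite -ge0_fin_numE// Gfin.
have lim w : ~ N w -> exists y : V -> R, forall e : R, 0 < e -> exists j0, forall j v, (j0 <= j)%N ->
    `|y v - psum W (ms j) v w| <= e.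
  move=> Nw; apply: (@uniform_limit _ _ _ (fun i => fine (H i w)) (fine (G 0%N w))).
  - by move=> i; exact: fine_ge0.
  - move=> n; rewrite -lee_fin -sumEFin fineK ?Gfin//.
    by under eq_bigr do rewrite fineK ?Hfin//.
  - by move=> j v; rewrite -lee_fin fineK ?Hfin.
have /choice[y hy] : forall w, exists y : V -> R, (N w -> forall v, y v = 0) /\
   (~ N w -> forall e : R, 0 < e -> exists j0, forall j v, (j0 <= j)%N ->
    `|y v - psum W (ms j) v w| <= e).
  move=> w; have [Nw|Nw] := pselect (N w); first by exists (fun=> 0).
  by have [y hy] := lim w Nw; exists y.
exists (fun v w => y w v), N; split => //.
- by move=> w; exact: (hy w).1.
- by move=> w; exact: (hy w).2.
exists G; split => // w Nw j v; apply/lee_addgt0Pr => e e0.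
have [j0 hj0] := (hy w).2 Nw e e0; set j' := maxn j0 j.
have h1 := hj0 j' v (leq_maxl _ _).
have h2 : `|psum W (ms j') v w - psum W (ms j) v w| <= \sum_(j <= i < j') fine (H i w).
  rewrite -(@telescope_sumr _ j j' (fun i => psum W (ms i) v w)) ?leq_maxr//.
  apply: le_trans (ler_norm_sum _ _ _) _; apply: ler_sum => i _.
  by rewrite -lee_fin fineK ?Hfin.
apply: (@le_trans _ _ ((\sum_(j <= i < j') fine (H i w))%:E + e%:E)%E).
  rewrite -EFinD lee_fin [leRHS]addrC.
  have -> : y w v - psum W (ms j) v w = (y w v - psum W (ms j') v w) +
     (psum W (ms j') v w - psum W (ms j) v w) by ring.
  by apply: le_trans (ler_normD _ _) _; exact: lerD.
rewrite leeD2r// -sumEFin; under eq_bigr do rewrite fineK ?Hfin//.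
exact: sumGj.
Qed.

Section Version.
Context d (T : measurableType d) (P : probability T R) (W : nat -> T -> R).
Hypothesis Wb : moment_bound P W.
Variables (Y : V -> T -> R) (N : set T).
Hypothesis YN : series_version P W Y N.

Lemma version_cont : cont_paths rho Y.
Proof.
move=> w v e e0; have [_ _ h0 h1 _] := YN; have [Nw|Nw] := pselect (N w).
  by exists 1 => // u _; rewrite !h0// subrr normr0.
have e3 : 0 < e / 3 by rewrite divr_gt0.
have [j0 hj0] := h1 w Nw _ e3.
have [del del0 hdel] := pdiff_cont W 0 (ms j0) w v e3.
exists del => // u uv; have := hdel u uv; rewrite -/(psum W (ms j0) u w) -/(psum W (ms j0) v w) => h2.
have := hj0 j0 u (leqnn _); have := hj0 j0 v (leqnn _).
set yu := Y u w; set yv := Y v w; move: h2; set pu := psum _ _ _ _; set pv := psum _ _ _ _ => h2 h3 h4.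
have -> : yu - yv = (yu - pu) + (pu - pv) - (yv - pv) by ring.
apply: le_lt_trans (ler_normB _ _) _.
have := ler_normD (yu - pu) (pu - pv); lra.
Qed.

(** Zeroing the partial sums on [N] makes them converge to [Y] everywhere, which is what [Lb_lim]
    asks for. *)
Definition masked j v w : R := \1_(~` N) w * psum W (ms j) v w.

Lemma maskedN j v w : N w -> masked j v w = 0.
Proof. by move=> Nw; rewrite /masked indicE memNset ?mul0r//=. Qed.

Lemma maskedC j v w : ~ N w -> masked j v w = psum W (ms j) v w.
Proof. by move=> Nw; rewrite /masked indicE mem_set ?mul1r//=. Qed.

Lemma masked_cvg v w : masked j v w @[j --> \oo] --> Y v w.
Proof.
have [_ _ h0 h1 _] := YN; have [Nw|Nw] := pselect (N w).
  have -> : (fun j => masked j v w) = fun=> Y v w.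
    by apply/funext => j; rewrite maskedN// h0.
  exact: cvg_cst.
apply/cvgrPdist_le => e e0; have [j0 hj0] := h1 w Nw e e0.
by exists j0 => // j /= jj; rewrite maskedC//; exact: hj0.
Qed.

Lemma Lb_mask (p : R) (X : T -> R) (C : R) : 0 < p -> Lb P p X C ->
  Lb P p (fun w => \1_(~` N) w * X w) C.
Proof.
have [mN _ _ _ _] := YN.
move=> p0 XC; apply: Lb_le (XC); first exact: ltW.
- by apply: measurable_funM; [exact: measurable_indic (measurableC mN)|exact: XC.1].
- move=> w; rewrite normrM ler_piMl// indicE; case: (_ \in _); by rewrite ?normr1 ?normr0.
Qed.

Lemma version_incr p u v : prange a p -> Lb P p (fun w => Y u w - Y v w) (tu p * rho u v).
Proof.
move=> pa; have [p2 _] := pa; have p0 : 0 < p by lra.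
have t0 : 0 <= tu p by rewrite (le_trans _ (tu1 pa)).
apply: (@Lb_lim _ _ _ _ p _ (fun j w => \1_(~` N) w * (psum W (ms j) u w - psum W (ms j) v w))) => //.
- by rewrite mulr_ge0.
- by move=> j; apply: Lb_mask => //; exact: (pdiff_incr Wb 0 (ms j) u v pa).
- move=> w; under eq_fun do rewrite mulrBr.
  by apply: cvgB; exact: masked_cvg.
Qed.

Lemma version_base p v : prange a p -> Lb P p (Y v) (tu p * sigma).
Proof.
move=> pa; have [p2 _] := pa; have p0 : 0 < p by lra.
have t0 : 0 <= tu p by rewrite (le_trans _ (tu1 pa)).
have s0 : 0 <= sigma by have := Hl2 v 0; rewrite big_geq.
apply: (@Lb_lim _ _ _ _ p _ (fun j => masked j v)) => //.
- by rewrite mulr_ge0.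
- by move=> j; apply: Lb_mask => //; exact: (pdiff_base Wb pa (Hl2 v (ms j))).
- by move=> w; exact: masked_cvg.
Qed.

End Version.

(** The constant comes from one net and one entropy tail, both chosen before the probability space;
    this is the source of the uniformity over the parallelepipeds. *)
Lemma version_sup_bound : exists2 C : R, 0 <= C & forall d (T : measurableType d)
  (P : probability T R) (W : nat -> T -> R) (Y : V -> T -> R) (N : set T),
  moment_bound P W -> series_version P W Y N ->
  forall p, prange a p ->
  (pnorm P p (fun w => sup [set Y v w | v in [set: V]]) <= (tu p * C)%:E)%E.
Proof.
have [i0 hi0] := entterm_tailS ltr01.
have [M [F MF]] := nets rho_refl rho_sym rho_tri Hcomp.
have s0 : 0 <= sigma by have := Hl2 v0 0; rewrite big_geq.
have C0 : 0 <= \sum_(j < M i0) sigma + 4 * 1 by rewrite addr_ge0 ?sumr_ge0.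
exists (\sum_(j < M i0) sigma + 4 * 1) => // d T P W Y N Wb YN p pa.
have [S [SC S0 Smono SD]] := chaining rho_refl rho_ge0 rho_sym rho_tri Hcomp Ha tu1 v0
  (version_cont YN) (fun p u v pa => version_incr Wb YN u v pa) MF
  (fun j => s0) (fun p j pa => version_base Wb YN (F i0 j) pa) hi0.
have [p2 _] := pa; have p0 : 0 < p by lra.
have t0 : 0 <= tu p by rewrite (le_trans _ (tu1 pa)).
apply: (pnorm_dom (S := S)) => //; first by rewrite mulr_ge0.
  by move=> I; exact: SC.
(* Otherwise every [|Y v w|] would be at most [|s| - e / 2]; the set would then be bounded, and
   [|s|] itself would obey the same bound. *)
move=> w e e0; apply: contrapT => h; set s := sup _ in h.
have hs v : `|Y v w| <= `|s| - e / 2.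
  have e2 : 0 < e / 2 by rewrite divr_gt0.
  have [I hI] := SD v w _ e2; apply: le_trans hI _; rewrite leNgt; apply/negP => hh.
  apply: h; exists I; lra.
have ns : [set Y v w | v in [set: V]] !=set0 by exists (Y v0 w), v0.
have : s <= `|s| - e / 2.
  by apply: ge_sup => // _ [v _ <-]; exact: le_trans (ler_norm _) (hs v).
have : - s <= `|s| - e / 2.
  have : Y v0 w <= s.
    apply: ub_le_sup; last by exists v0.
    by exists (`|s| - e / 2) => _ [v _ <-]; exact: le_trans (ler_norm _) (hs v).
  have := hs v0; rewrite ler_norml => /andP[h1 _]; lra.
by have := @ler_norm _ s; case: (ger0P s) => _; lra.
Qed.


Definition lip_functional (F : (V -> R) -> R) (B L : R) := [/\ 0 < L,
  forall h, rho_continuous rho h -> `|F h| <= B &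
  forall h h' (c : R), rho_continuous rho h -> rho_continuous rho h' ->
    (forall v, `|h v - h' v| <= c) -> `|F h - F h'| <= L * c].

Lemma lip_bounded_continuous F B L : lip_functional F B L -> bounded_continuous_functional rho F.
Proof.
move=> [L0 FB FL]; split; first by exists B.
move=> h e hc e0; have L1 : 0 < L + 1 by lra.
exists (e / (L + 1)); first by rewrite divr_gt0.
move=> h' h'c hh; apply: (@le_lt_trans _ _ (L * (e / (L + 1)))).
  by apply: FL => // v; exact: ltW.
by rewrite mulrCA gtr_pMr// ltr_pdivrMr//; lra.
Qed.

Lemma lin_cont m (x : 'I_m -> R) : rho_continuous rho (fun v => \sum_(i < m) l i v * x i).
Proof.
pose W i (_ : unit) : R := if insub i is Some j then x j else 0.
have -> : (fun v => \sum_(i < m) l i v * x i) = (fun v => pdiff W 0 m v tt).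
  apply/funext => v; rewrite /pdiff big_mkord; apply: eq_bigr => i _.
  by rewrite /W valK.
exact: (pdiff_cont W 0 m tt).
Qed.

(** The absolute coefficient sums are at most [sigma], so coordinates closer than
    [del / (sigma + 1)] give functions uniformly closer than [del]. *)
Lemma bcf_vcontinuous F m : bounded_continuous_functional rho F ->
  vcontinuous (fun x : 'I_m -> R => F (fun v => \sum_(i < m) l i v * x i)).
Proof.
move=> [_ cF] x e e0; have [del del0 h] := cF _ e (lin_cont x) e0.
have s0 : 0 <= sigma by have := Hl2 v0 0; rewrite big_geq.
have s1 : 0 < sigma + 1 by lra.
exists (del / (sigma + 1)) => [|y hy]; first by rewrite divr_gt0.
apply: h => [|v]; first exact: lin_cont.
rewrite -sumrB; apply: (@le_lt_trans _ _ (sigma * (del / (sigma + 1)))).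
  apply: (@le_trans _ _ (\sum_(i < m) `|l i v| * (del / (sigma + 1)))).
    apply: le_trans (ler_norm_sum _ _ _) _; apply: ler_sum => i _.
    by rewrite -mulrBr normrM ler_wpM2l// ltW.
  rewrite -mulr_suml ler_wpM2r ?(ltW (divr_gt0 del0 s1))//.
  by have := Hl2 v m; rewrite big_mkord.
by rewrite mulrCA gtr_pMr// ltr_pdivrMr//; lra.
Qed.

Section FunctionalApprox.
Context d (T : measurableType d) (P : probability T R) (W : nat -> T -> R).
Hypothesis Wb : moment_bound P W.

Lemma bcf_measurable_psum F m : bounded_continuous_functional rho F ->
  measurable_fun setT (fun w => F (fun v => psum W m v w)).
Proof.
move=> bF; have -> : (fun w => F (fun v => psum W m v w)) =
    (fun w => F (fun v => \sum_(i < m) l i v * W i w)).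
  by apply/funext => w; congr F; apply/funext => v; rewrite /psum /pdiff big_mkord.
apply: (measurable_vcontinuous_comp (bcf_vcontinuous bF)) => i.
exact: (Wb i (prange2)).1.
Qed.

Variables (Y : V -> T -> R) (N : set T).
Hypothesis YN : series_version P W Y N.

Lemma psum_cont m w : rho_continuous rho (fun v => psum W m v w).
Proof. exact: (pdiff_cont W 0 m w). Qed.

Lemma bcf_cvg F w : bounded_continuous_functional rho F -> ~ N w ->
  F (fun v => psum W (ms j) v w) @[j --> \oo] --> F (fun v => Y v w).
Proof.
move=> [_ cF] Nw; have [_ _ _ h1 _] := YN.
apply/cvgrPdist_lt => e e0; have [del del0 h] := cF _ e (version_cont YN w) e0.
have d2 : 0 < del / 2 by rewrite divr_gt0.
have [j0 hj0] := h1 w Nw _ d2; exists j0 => // j /= jj; rewrite distrC.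
apply: h; first exact: psum_cont.
by move=> v; rewrite distrC; have := hj0 j v jj; lra.
Qed.

Lemma bcf_measurable F : bounded_continuous_functional rho F ->
  measurable_fun setT (fun w => F (fun v => Y v w)).
Proof.
move=> bF; have [mN _ h0 _ _] := YN.
have mCN := measurableC mN.
(* On [N] the field is 0, so the approximants are set there to the constant value of [F] at the zero
   function. *)
apply: (measurable_fun_cvg (h := fun j w => \1_(~` N) w * F (fun v => psum W (ms j) v w) +
   \1_N w * F (fun=> 0))) => //.
  move=> j; apply: measurable_funD; apply: measurable_funM => //.
  exact: bcf_measurable_psum.
move=> w _; have [Nw|Nw] := pselect (N w).
  have -> : (fun v => Y v w) = (fun=> 0) by apply/funext => v; exact: h0.
  have -> : \1_(~` N) w = 0 :> R by rewrite indicE memNset//=.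
  have -> : \1_N w = 1 :> R by rewrite indicE mem_set.
  under eq_fun do rewrite mul0r add0r mul1r; exact: cvg_cst.
have -> : \1_(~` N) w = 1 :> R by rewrite indicE mem_set.
have -> : \1_N w = 0 :> R by rewrite indicE memNset.
under eq_fun do rewrite mul0r addr0 mul1r; exact: bcf_cvg.
Qed.

Lemma bcf_integrable F : bounded_continuous_functional rho F ->
  P.-integrable setT (EFin \o (fun w => F (fun v => Y v w))).
Proof.
move=> bF; have [[B hB] _] := bF.
apply: (@bounded_integrable _ _ _ _ _ B); first exact: bcf_measurable.
by move=> w; apply: hB; exact: version_cont YN w.
Qed.

Lemma lip_approx F B L j : lip_functional F B L ->
  `|\int[P]_w F (fun v => Y v w) - \int[P]_w F (fun v => psum W (ms j) v w)| <= L * (2 * dyad j).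
Proof.
move=> lF; have bF := lip_bounded_continuous lF; have [L0 FB FL] := lF.
have [mN PN _ _ [G [mG G0 GI GY]]] := YN.
have i1 := bcf_integrable bF.
have i2 : P.-integrable setT (EFin \o (fun w => F (fun v => psum W (ms j) v w))).
  apply: (@bounded_integrable _ _ _ _ _ B); first exact: bcf_measurable_psum.
  by move=> w; apply: FB; exact: psum_cont.
have i3 : P.-integrable setT (EFin \o (fun w => F (fun v => Y v w) - F (fun v => psum W (ms j) v w))).
  by rewrite /comp; under eq_fun do rewrite EFinB; exact: integrableB.
rewrite -RintegralB//; apply: le_trans (le_normr_Rintegral _ i3) _ => //.
rewrite -lee_fin -EFin_Rintegral; last exact: (integrable_norm i3).
apply: (@le_trans _ _ (\int[P]_w (L%:E * G j w))%E); last first.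
  by rewrite ge0_integralZl ?lee_fin ?(ltW L0)// EFinM; apply: lee_wpmul2l; rewrite ?lee_fin ?(ltW L0).
(* The bound by the envelope holds only off [N], hence the almost everywhere comparison. *)
apply: ae_ge0_le_integral => //.
- apply/measurable_EFinP/measurableT_comp => //; exact/measurable_EFinP/(measurable_int _ i3).
- by move=> w _; rewrite mule_ge0// lee_fin ltW.
- by apply: measurable_funeM.
exists N; split => // w /= h; apply: contrapT => Nw; apply: h => _.
have := GY w Nw j; have := G0 j w; case: (G j w) => [r r0 hr|_ _|//].
  by rewrite -EFinM lee_fin; apply: FL; [exact: version_cont YN w|exact: psum_cont|].
by rewrite mulry gtr0_sg// mul1e leey.
Qed.

End FunctionalApprox.

End Series.

(** * Bounded continuous functionals *)

Lemma bounded_cvg_Rintegral {R : realType} d (T : measurableType d) (P : probability T R)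
  (f_ : nat -> T -> R) (f : T -> R) (B : R) :
  (forall n, measurable_fun setT (f_ n)) -> measurable_fun setT f ->
  (forall n w, `|f_ n w| <= B) -> (forall w, f_ n w @[n --> \oo] --> f w) ->
  \int[P]_w f_ n w @[n --> \oo] --> \int[P]_w f w.
Proof.
move=> mf_ mf fB cf.
have m1 n : measurable_fun setT (fun w => (f_ n w)%:E) by exact/measurable_EFinP/mf_.
have m2 : measurable_fun setT (EFin \o f) by exact/measurable_EFinP.
have c1 : \forall w \ae P, setT w -> (f_ n w)%:E @[n --> \oo] --> (EFin \o f) w.
  by apply: aeW => w _; apply: cvg_EFin; [exact: nearW|exact: cf].
have i0 : P.-integrable setT (EFin \o cst B).
  by apply: (@bounded_integrable _ _ _ P (cst B) `|B|).
have d1 : \forall w \ae P, forall n, setT w -> (`|(f_ n w)%:E| <= (EFin \o cst B) w)%E.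
  by apply: aeW => w n _; rewrite lee_fin.
have [i1 _ h] := dominated_convergence measurableT m1 m2 c1 i0 d1.
by apply: fine_cvg; move: h; rewrite /= EFin_Rintegral.
Qed.

Section InfConvolution.
Context {R : realType} (V : Type) (rho : V -> V -> R).
Variables (F : (V -> R) -> R) (B : R).
Hypothesis FB : forall h, rho_continuous rho h -> `|F h| <= B.
Hypothesis cF : forall h (e : R), rho_continuous rho h -> 0 < e ->
  exists2 del : R, 0 < del & forall h', rho_continuous rho h' ->
    (forall v, `|h' v - h v| < del) -> `|F h' - F h| < e.

(** The infimal convolution of [F] with [L] times the uniform distance; an arbitrary upper bound [c]
    stands in for the distance, which for [L > 0] leaves the infimum the same. *)
Definition infconv_set (L : R) h : set R := [set y | exists h', exists c : R,
  [/\ rho_continuous rho h', 0 <= c, forall v, `|h v - h' v| <= c & y = F h' + L * c]].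

Definition infconv L h := inf (infconv_set L h).

Lemma infconv_lb L h : 0 < L -> lbound (infconv_set L h) (- B).
Proof.
move=> L0 _ [h' [c [ch' c0 _ ->]]]; have := FB ch'; rewrite ler_norml => /andP[h1 _].
by have := mulr_ge0 (ltW L0) c0; lra.
Qed.

Lemma infconv_le L h h' (c : R) : 0 < L -> rho_continuous rho h' -> 0 <= c ->
  (forall v, `|h v - h' v| <= c) -> infconv L h <= F h' + L * c.
Proof.
move=> L0 ch' c0 hh'; apply: ge_inf; first by exists (- B); exact: infconv_lb.
by exists h', c.
Qed.

Lemma infconv_leF L h : 0 < L -> rho_continuous rho h -> infconv L h <= F h.
Proof.
move=> L0 ch; rewrite -[leRHS]addr0 -(mulr0 L); apply: infconv_le => // v.
by rewrite subrr normr0.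
Qed.

Lemma infconv_ge L h (x : R) : 0 < L -> rho_continuous rho h ->
  (forall h' (c : R), rho_continuous rho h' -> 0 <= c -> (forall v, `|h v - h' v| <= c) ->
     x <= F h' + L * c) -> x <= infconv L h.
Proof.
move=> L0 ch hx; apply: lb_le_inf.
  by exists (F h + L * 0), h, 0; split => // v; rewrite subrr normr0.
by move=> _ [h' [c [ch' c0 hh' ->]]]; exact: hx.
Qed.

Lemma infconv_norm L h : 0 < L -> rho_continuous rho h -> `|infconv L h| <= B.
Proof.
move=> L0 ch; rewrite ler_norml; apply/andP; split.
  apply: infconv_ge => // h' c ch' c0 hh'; apply: (infconv_lb (h := h) L0).
  by exists h', c.
by apply: le_trans (infconv_leF L0 ch) _; apply: le_trans (ler_norm _) (FB ch).
Qed.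

Lemma infconv_lip (v0 : V) L : 0 < L -> lip_functional rho (infconv L) B L.
Proof.
move=> L0; split=> // [h ch|]; first exact: infconv_norm.
have half h h' (c : R) : rho_continuous rho h -> rho_continuous rho h' ->
    (forall v, `|h v - h' v| <= c) -> infconv L h - infconv L h' <= L * c.
  move=> ch ch' hh'; have c0 : 0 <= c by exact: le_trans (hh' v0).
  rewrite lerBlDl -lerBlDr; apply: infconv_ge => // g c' cg c'0 hg.
  rewrite lerBlDr -addrA -mulrDr; apply: infconv_le => //; first exact: addr_ge0.
  move=> v; have -> : h v - g v = (h' v - g v) + (h v - h' v) by ring.
  by apply: le_trans (ler_normD _ _) _; exact: lerD.
move=> h h' c ch ch' hh'; rewrite ler_norml half// andbT lerNl opprB.
by apply: half => // v; rewrite distrC.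
Qed.

(** A competitor closer than [del] has a value above [F h - e] by continuity; a farther one pays
    [L c >= 2 B] once [L >= 2 B / del], as much as [F] can gain. *)
Lemma infconv_cvg h : rho_continuous rho h -> infconv n.+1%:R h @[n --> \oo] --> F h.
Proof.
move=> ch; apply/cvgrPdist_le => e e0; have [del del0 hdel] := cF ch e0.
near=> n; have n0 : 0 < n.+1%:R :> R by [].
rewrite ger0_norm ?subr_ge0 ?infconv_leF//.
suff : F h - e <= infconv n.+1%:R h by lra.
apply: infconv_ge => // h' c ch' c0 hh'.
have [cd|dc] := ltP c del.
  have : `|F h' - F h| < e.
    by apply: hdel => // v; rewrite distrC; exact: le_lt_trans (hh' v) cd.
  by rewrite ltr_norml => /andP[h1 _]; have := mulr_ge0 (ltW n0) c0; lra.
have nd : 2 * B / del <= n.+1%:R.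
  apply: (@le_trans _ _ n%:R); last by rewrite ler_nat.
  by near: n; exact: nbhs_infty_ger.
have : 2 * B <= n.+1%:R * c.
  rewrite ler_pdivrMr// in nd; apply: le_trans nd _; by rewrite ler_wpM2l// ltW.
have := FB ch; have := FB ch'; rewrite !ler_norml => /andP[h1 h2] /andP[h3 h4]; lra.
Unshelve. all: by end_near. Qed.

End InfConvolution.

Section Portmanteau.
Context {R : realType} (V : Type) (rho : V -> V -> R) (v0 : V).
Context d d' (T : measurableType d) (T' : measurableType d')
  (P : probability T R) (P' : probability T' R).
Variables (Y : nat -> V -> T -> R) (Z : V -> T' -> R).
Hypotheses (Yc : forall k, cont_paths rho (Y k)) (Zc : cont_paths rho Z).
Hypothesis mY : forall F k, bounded_continuous_functional rho F ->
  measurable_fun setT (fun w => F (fun v => Y k v w)).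
Hypothesis mZ : forall F, bounded_continuous_functional rho F ->
  measurable_fun setT (fun w => F (fun v => Z v w)).
Hypothesis lip_cvg : forall F B L, lip_functional rho F B L ->
  \int[P]_w F (fun v => Y k v w) @[k --> \oo] --> \int[P']_w F (fun v => Z v w).

(** Infimal convolution approximates from below, so it yields a lower bound; applied to [- F] it
    yields the upper one. *)
Lemma portmanteau_lower F (e : R) : bounded_continuous_functional rho F -> 0 < e ->
  \forall k \near \oo, \int[P']_w F (fun v => Z v w) - e <= \int[P]_w F (fun v => Y k v w).
Proof.
move=> bF e0; have [[B FB] cF] := bF.
have lF n := infconv_lip FB v0 (ltr0Sn R n).
have e2 : 0 < e / 2 by rewrite divr_gt0.
have h1 : \int[P']_w infconv rho F n.+1%:R (fun v => Z v w) @[n --> \oo] -->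
    \int[P']_w F (fun v => Z v w).
  apply: (@bounded_cvg_Rintegral _ _ _ _ _ _ B).
  - by move=> n; apply: mZ; exact: lip_bounded_continuous (lF n).
  - exact: mZ.
  - by move=> n w; apply: infconv_norm => //; exact: Zc.
  - by move=> w; apply: (infconv_cvg FB cF); exact: Zc.
move/cvgrPdist_le: h1 => /(_ _ e2) [n _ /(_ n (leqnn n))] hn.
move/cvgrPdist_le: (lip_cvg (lF n)) => /(_ _ e2); apply: filterS => k hk.
have hle : \int[P]_w infconv rho F n.+1%:R (fun v => Y k v w) <= \int[P]_w F (fun v => Y k v w).
  apply: le_Rintegral => //.
  - apply: (@bounded_integrable _ _ _ _ _ B) => [|w].
      by apply: mY; exact: lip_bounded_continuous (lF n).
    by apply: infconv_norm => //; exact: Yc.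
  - apply: (@bounded_integrable _ _ _ _ _ B) => [|w]; first exact: mY.
    by apply: FB; exact: Yc.
  - by move=> w _; apply: (infconv_leF FB) => //; exact: Yc.
move: hn hk; rewrite !ler_norml => /andP[a1 a2] /andP[a3 a4]; lra.
Qed.

Lemma portmanteau F : bounded_continuous_functional rho F ->
  \int[P]_w F (fun v => Y k v w) @[k --> \oo] --> \int[P']_w F (fun v => Z v w).
Proof.
move=> bF; apply/cvgrPdist_le => e e0.
have bN : bounded_continuous_functional rho (fun h => - F h).
  have [[B FB] cF] := bF; split; first by exists B => h ch; rewrite normrN; exact: FB.
  move=> h e' ch e'0; have [del del0 hd] := cF h e' ch e'0; exists del => // h' ch' hh'.
  by rewrite -opprD normrN; exact: hd.
have iY k : P.-integrable setT (EFin \o (fun w => F (fun v => Y k v w))).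
  have [[B FB] _] := bF; apply: (@bounded_integrable _ _ _ _ _ B) => [|w]; first exact: mY.
  by apply: FB; exact: Yc.
have iZ : P'.-integrable setT (EFin \o (fun w => F (fun v => Z v w))).
  have [[B FB] _] := bF; apply: (@bounded_integrable _ _ _ _ _ B) => [|w]; first exact: mZ.
  by apply: FB; exact: Zc.
have RN dd (S : measurableType dd) (Q : probability S R) (f : S -> R) :
    Q.-integrable setT (EFin \o f) -> \int[Q]_w (- f w) = - \int[Q]_w f w.
  by move=> fi; under eq_Rintegral do rewrite -mulN1r; rewrite RintegralZl// mulN1r.
near=> k.
have h1 : \int[P']_w F (fun v => Z v w) - e <= \int[P]_w F (fun v => Y k v w).
  by near: k; exact: portmanteau_lower.
have : \int[P']_w - F (fun v => Z v w) - e <= \int[P]_w - F (fun v => Y k v w).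
  by near: k; exact: (portmanteau_lower bN e0).
rewrite !RN// => h2; rewrite ler_norml; apply/andP; split; lra.
Unshelve. all: by end_near. Qed.

End Portmanteau.

(** * Enumeration of the coefficients and convergence of coordinates *)

Lemma powR_prod {R : realType} (I : Type) (r : seq I) (f : I -> R) p :
  (forall i, 0 <= f i) -> (\prod_(i <- r) f i) `^ p = \prod_(i <- r) f i `^ p.
Proof.
move=> f0; elim: r => [|i r ih]; first by rewrite !big_nil powR1.
by rewrite !big_cons powRM ?ih// prodr_ge0.
Qed.

Lemma lee_prod {R : realType} (I : Type) (r : seq I) (f g : I -> \bar R) :
  (forall i, (0 <= f i)%E) -> (forall i, (f i <= g i)%E) ->
  (\prod_(i <- r) f i <= \prod_(i <- r) g i)%E.
Proof.
move=> f0 fg; elim: r => [|i r ih]; first by rewrite !big_nil.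
by rewrite !big_cons; apply: lee_pmul => //; exact: prode_ge0.
Qed.

(** By Lyapunov's inequality a norm below 1 would force a second moment below 1. The maximum with
    [2^-1] in the proof supplies the positive bound that [Lb_mono] asks for. *)
Lemma pnorm_ge1 {R : realType} d (T : measurableType d) (P : probability T R) (Z : T -> R) p :
  2 <= p -> measurable_fun setT Z -> (\int[P]_w (Z w ^+ 2)%:E = 1)%E -> (1 <= pnorm P p Z)%E.
Proof.
move=> p2 mZ Z2; rewrite leNgt; apply/negP => h.
have [C [C0 C1 hC]] : exists C : R, [/\ 0 < C, C < 1 & (pnorm P p Z <= C%:E)%E].
  case: (pnorm P p Z) h => [r r1|//|_]; last by exists 2^-1; rewrite leNye; split => //; lra.
  rewrite lte_fin in r1; exists (Num.max 2^-1 r); split; first by rewrite lt_max invr_gt0 ltr0n.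
    by rewrite gt_max r1 andbT; lra.
  by rewrite lee_fin le_max lexx orbT.
have p0 : 0 < p by lra.
have ZC : Lb P p Z C by apply/LbP => //; exact: ltW.
have [_] : Lb P 2 Z C by apply: Lb_mono ZC.
rewrite (_ : (fun w => (`|Z w| `^ 2)%:E) = fun w => (Z w ^+ 2)%:E); last first.
  by apply/funext => w; rewrite powR_mulrn ?real_normK ?num_real.
rewrite Z2 powR_mulrn ?(ltW C0)// lee_fin; apply/negP; rewrite -ltNge.
by rewrite exprn_ilt1 ?(ltW C0).
Qed.

Section Tails.
Context {R : realType} d (T : measurableType d) (P : probability T R).

Lemma Lb_tail (Z : T -> R) (C K : R) : 0 < K -> 0 <= C -> Lb P 2 Z C ->
  fine (P [set w | K < `|Z w|]) <= C ^+ 2 / K ^+ 2.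
Proof.
move=> K0 C0 [mZ hZ]; have mA := measurable_tail K mZ.
have K2 : 0 < K ^+ 2 by rewrite exprn_gt0.
rewrite ler_pdivlMr// -lee_fin EFinM fineK ?fin_num_measure// muleC.
rewrite -[A in P A]setIT -integral_indic// -ge0_integralZl ?lee_fin ?(ltW K2)//; last first.
  by apply/measurable_EFinP; exact: measurable_indic.
apply: (@le_trans _ _ (\int[P]_w (`|Z w| `^ 2)%:E)%E).
  apply: ge0_le_integral_any => w; first by rewrite mule_ge0// lee_fin ltW.
  rewrite -EFinM lee_fin powR_mulrn// indicE; case: (boolP (w \in _)) => [|_]; last by rewrite mulr0 sqr_ge0.
  by rewrite inE/= mulr1 => Kw; rewrite ler_sqr ?nnegrE// ltW.
by apply: le_trans hZ _; rewrite powR_mulrn.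
Qed.

Lemma tight_variable (Z : T -> R) (e : R) : measurable_fun setT Z -> 0 < e ->
  exists n0 : nat, forall n, (n0 <= n)%N -> fine (P [set w | n%:R < `|Z w|]) <= e.
Proof.
move=> mZ e0.
have mA n : measurable [set w | n%:R < `|Z w|] by exact: measurable_tail.
have h : \int[P]_w \1_[set w | n%:R < `|Z w|] w @[n --> \oo] --> \int[P]_w (0 : R).
  apply: (@bounded_cvg_Rintegral _ _ _ P _ _ 1) => [n||n w|w].
  - exact: measurable_indic.
  - exact: measurable_cst.
  - by rewrite indicE; case: (_ \in _); rewrite ?normr1 ?normr0.
  apply/cvgrPdist_lt => e' e'0; near=> n.
  rewrite indicE memNset ?subrr ?normr0//=; apply/negP; rewrite -leNgt.
  by near: n; exact: nbhs_infty_ger.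
rewrite Rintegral_cst_prob in h.
move/cvgrPdist_le: h => /(_ _ e0) [n0 _ h]; exists n0 => n nn.
have := h n nn; rewrite sub0r normrN /Rintegral integral_indic// setIT.
by move=> /(le_trans (ler_norm _)).
Unshelve. all: by end_near. Qed.

End Tails.

(** * Joint trigonometric moments of the Gaussian family *)

Section Gaussian.
Context {R : realType} (d : nat) (dO : measure_display) (Omega : measurableType dO)
  (P : probability Omega R) (beta : 'I_d -> nat -> Omega -> R).
Hypothesis Hbeta : std_gauss_family P beta.

Let mbeta s j : measurable_fun setT (beta s j.+1).
Proof. by have [h _ _] := Hbeta; exact: h. Qed.

(** The phases 0 and [- pi / 2] in [gauss_cos] give both trigonometric moments exactly, so the error
    is 0. *)
Lemma gauss_close (t : R) s j :
  close P (fun w => t * beta s j.+1 w) (t ^+ 2) 0.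
Proof.
have [_ law _] := Hbeta.
have gc (c : R) : \int[P]_w cos (t * beta s j.+1 w + c) = expR (- t ^+ 2 / 2) * cos c.
  by rewrite /Rintegral (gauss_cos c t (mbeta s j) (fun A mA => law s j.+1 A isT mA)).
have Ec : Ecos P (fun w => t * beta s j.+1 w) = expR (- t ^+ 2 / 2).
  rewrite -[RHS]mulr1 -[X in _ * X]cos0 -gc; apply: eq_Rintegral => w _; by rewrite addr0.
have Es : Esin P (fun w => t * beta s j.+1 w) = 0.
  rewrite -[RHS](mulr0 (expR (- t ^+ 2 / 2))) -[X in _ * X](@cos_pihalf R) -cosN -gc.
  by apply: eq_Rintegral => w _; rewrite -[in LHS](subrK (pi / 2) (t * _)) sinDpihalf.
move=> x y _; rewrite Ec Es mulr0 subr0 mulrC subrr normr0//.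
Qed.

Lemma gauss_mindep (J : nat) (t : 'I_d * 'I_J -> R) :
  mindep P (fun sj => fun w => t sj * beta sj.1 sj.2.+1 w).
Proof.
have [_ _ ind] := Hbeta.
(* An index [j] of ['I_J] stands for the Gaussian variable of index [j + 1], whence [j.-1]; indices
   beyond [J] stay unconstrained. *)
move=> A mA; pose A' s j := if insub j.-1 is Some j' then (fun x => t (s, j') * x) @^-1` A (s, j') else setT.
have A'E s (j : 'I_J) : A' s j.+1 = (fun x => t (s, j) * x) @^-1` A (s, j) by rewrite /A' /= valK.
have mA' s j : measurable (A' s j).
  rewrite /A'; case: insubP => // j' _ _; rewrite -[X in measurable X]setTI.
  by apply: measurable_funM => //; exact: mA.
have -> : \bigcap_(sj in [set: 'I_d * 'I_J]) ((fun w => t sj * beta sj.1 sj.2.+1 w) @^-1` A sj) =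
    \bigcap_(j in [set j | (1 <= j <= J)%N]) \bigcap_(s in [set: 'I_d]) (beta s j @^-1` A' s j).
  apply/seteqP; split => w /= hw.
    move=> [//|j] /= jJ s _; rewrite -[j]/(val (Ordinal jJ)) A'E.
    exact: (hw (s, Ordinal jJ)).
  by move=> [s j] _ /=; have := hw j.+1 (ltn_ord j) s Logic.I; rewrite A'E.
rewrite ind// big_add1 /= big_mkord exchange_big/= pair_bigA/=.
by apply: eq_bigr => -[s j] _ /=; rewrite A'E.
Qed.

Lemma gauss_trig (J : nat) (t : 'I_d * 'I_J -> R) (c : R) :
  \int[P]_w cos (\sum_sj t sj * beta sj.1 sj.2.+1 w + c) =
  expR (- (\sum_sj t sj ^+ 2) / 2) * cos c.
Proof.
have m1 (sj : 'I_d * 'I_J) : measurable_fun setT (fun w => t sj * beta sj.1 sj.2.+1 w).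
  by apply: measurable_funM => //; exact: mbeta.
have cl := close_sum (r := enum {: 'I_d * 'I_J}) (v := fun sj => t sj ^+ 2) (e := fun=> 0) m1 (@gauss_mindep J t) (enum_uniq _)
  (fun sj => sqr_ge0 _) (fun sj _ => gauss_close (t sj) sj.1 sj.2).
rewrite !big_enum/= big1_eq in cl.
have -> : (fun w => cos (\sum_sj t sj * beta sj.1 sj.2.+1 w + c)) =
    (fun w => cos (\sum_(sj <- enum {: 'I_d * 'I_J}) t sj * beta sj.1 sj.2.+1 w + c)).
  by apply/funext => w; rewrite big_enum.
apply/eqP; rewrite -subr_eq0 -normr_le0; apply: close_cos => //.
by apply: measurable_sum => sj; exact: m1.
Qed.

End Gaussian.

Lemma Rintegral_sum {R : realType} d (T : measurableType d) (mu : {measure set T -> \bar R})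
  (I : Type) (r : seq I) (f : I -> T -> R) :
  (forall i, mu.-integrable setT (EFin \o f i)) ->
  mu.-integrable setT (EFin \o (fun x => \sum_(i <- r) f i x)) /\
  \int[mu]_x (\sum_(i <- r) f i x) = \sum_(i <- r) \int[mu]_x f i x.
Proof.
move=> fi; elim: r => [|i r [ih1 ih2]].
  have -> : (fun x => \sum_(i <- [::]) f i x) = fun=> 0 by apply/funext => x; rewrite big_nil.
  by rewrite big_nil /Rintegral integral0; split => //; exact: integrable0.
have -> : (fun x => \sum_(i0 <- i :: r) f i0 x) = fun x => f i x + \sum_(i0 <- r) f i0 x.
  by apply/funext => x; rewrite big_cons.
split; last by rewrite RintegralD// ih2 big_cons.
exact: (integrableD measurableT (fi i) ih1).
Qed.

(** Independence is stated over the full rectangle ['I_N * 'I_d]; the observations in use, [n s] of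
    them in coordinate [s], form a sublist of it. *)
Lemma sum_block {R : realType} (d N : nat) (n : 'I_d -> nat) (F : nat -> 'I_d -> R) :
  (forall s, (n s <= N)%N) ->
  \sum_(ij <- [seq ij : 'I_N * 'I_d <- enum {: 'I_N * 'I_d} | (ij.1 < n ij.2)%N]) F ij.1 ij.2 =
  \sum_(s < d) \sum_(0 <= i < n s) F i s.
Proof.
move=> nN; rewrite big_filter big_enum_cond/= big_mkcond/=.
rewrite -(pair_bigA _ (fun (i : 'I_N) (s : 'I_d) => if (i < n s)%N then F i s else 0))/=.
rewrite exchange_big/=; apply: eq_bigr => s _.
by rewrite big_mkord (big_ord_widen _ (F^~ s) (nN s)) [RHS]big_mkcond.
Qed.

(** For [p > 2] the Lyapunov term is [C * n^(1 - p/2)]; the threshold makes the square root of [n],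
    raised to [p - 2], exceed [|C| / e]. *)
Lemma sqrtn_powR_small {R : realType} (p C e : R) : 2 < p -> 0 < e ->
  exists N : nat, forall n : nat, (N <= n)%N -> n%:R * (C * (Num.sqrt n%:R)^-1 `^ p) <= e.
Proof.
move=> p2 e0; pose D := `|C| / e + 1; have D0 : 0 < D by rewrite ltr_wpDl// divr_ge0// ltW.
pose x0 := D `^ (p - 2)^-1; have x00 : 0 < x0 by exact: powR_gt0.
exists (Num.truncn (x0 ^+ 2)).+1 => n Nn.
have n0 : 0 < n%:R :> R by rewrite ltr0n; apply: leq_trans Nn.
have nx : x0 ^+ 2 <= n%:R.
  by apply/ltW/(lt_le_trans (truncnS_gt _)); rewrite ler_nat.
set x := Num.sqrt n%:R; have x_gt0 : 0 < x by rewrite sqrtr_gt0.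
have xx : x ^+ 2 = n%:R by rewrite sqr_sqrtr// ltW.
have x0x : x0 <= x.
  by rewrite -(ler_pXn2r (n := 2)) ?nnegrE ?(ltW x00) ?(ltW x_gt0)// xx.
have Dx : D <= x `^ (p - 2).
  have -> : D = x0 `^ (p - 2).
    by rewrite /x0 -powRrM mulVf ?powRr1 ?(ltW D0)// gt_eqF// subr_gt0.
  by rewrite ge0_ler_powR ?nnegrE ?(ltW x00) ?(ltW x_gt0)// subr_ge0 ltW.
have -> : n%:R * (C * x^-1 `^ p) = C / x `^ (p - 2).
  rewrite -[x^-1]powR_inv1 ?(ltW x_gt0)// -powRrM mulN1r -xx -powR_mulrn ?(ltW x_gt0)//.
  by rewrite mulrCA -powRD ?(gt_eqF x_gt0) ?implybT// -powRN opprB.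
have y0 : 0 < x `^ (p - 2) by exact: powR_gt0.
rewrite ler_pdivrMr//; apply: (@le_trans _ _ (e * D)); last by rewrite ler_wpM2l// ltW.
rewrite /D mulrDr mulrCA divff ?gt_eqF// !mulr1; have := ler_norm C; lra.
Qed.

Section Enumeration.
Context {R : realType} (d : nat) (M : option nat).
Implicit Types (u : kvec d -> R).

Definition kin (k : kvec d) := [forall s, in_range M (k s)].

Lemma kinP k : reflect (Kset M k) (kin k).
Proof. exact: forallP. Qed.

(* Families over the index set are listed along the pickling of vectors; indices
   out of range, and numbers that are not codes, contribute 0. *)
Definition kcoef u (i : nat) : R :=
  if (pickle_inv i : option (kvec d)) is Some k then (if kin k then u k else 0) else 0.

Lemma kcoef_map u u' (f : R -> R -> R) i : f 0 0 = 0 ->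
  kcoef (fun k => f (u k) (u' k)) i = f (kcoef u i) (kcoef u' i).
Proof. by move=> f0; rewrite /kcoef; case: pickle_inv => [k|]//; case: ifP. Qed.

Lemma kcoef_ge0 u i : (forall k, 0 <= u k) -> 0 <= kcoef u i.
Proof. by move=> u0; rewrite /kcoef; case: pickle_inv => [k|]//; case: ifP. Qed.

Lemma esum_kcoef u : (forall k, 0 <= u k) ->
  (\esum_(k in Kset M) (u k)%:E = \sum_(i <oo) (kcoef u i)%:E)%E.
Proof.
move=> u0.
rewrite nneseries_esumT; last by move=> i; rewrite lee_fin kcoef_ge0.
have -> : (\esum_(i in [set: nat]) (kcoef u i)%:E =
    \esum_(i in pickle @` (@Kset d M)) (kcoef u i)%:E)%E.
  rewrite [RHS]esum_mkcond; apply: eq_esum => i _.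
  case: (boolP (i \in _)) => [//|]; rewrite notin_setE /= => h; congr EFin.
  rewrite /kcoef; case E : pickle_inv => [k|]//; case: ifP => // /kinP hk.
  by exfalso; apply: h; exists k => //; have := @pickle_invK {ffun 'I_d -> nat} i; rewrite E.
rewrite (reindex_esum (@Kset d M) _ pickle); last 1 first.
- split => [k hk|k k' _ _|_ [k hk <-]]; [by exists k| |by exists k].
  exact: (pcan_inj pickleK_inv).
- by apply: eq_esum => k /kinP hk; rewrite /kcoef pickleK_inv hk.
Qed.

Lemma esum_kcoef_cvg u (B : R) : (forall k, 0 <= u k) ->
  (forall m, \sum_(0 <= i < m) kcoef u i <= B) ->
  \sum_(0 <= i < m) kcoef u i @[m --> \oo] --> fine (\esum_(k in Kset M) (u k)%:E)%E.
Proof.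
move=> u0 hB; rewrite esum_kcoef//.
have h0 i : (0 <= (kcoef u i)%:E)%E by rewrite lee_fin kcoef_ge0.
have hc : cvgn (fun m => \sum_(0 <= i < m) (kcoef u i)%:E)%E.
  by apply: is_cvg_nneseries => i _ _; exact: h0.
have hle : (\sum_(i <oo) (kcoef u i)%:E <= B%:E)%E.
  by apply: lime_le => //; apply: nearW => m; rewrite sumEFin lee_fin.
have hfin : (\sum_(i <oo) (kcoef u i)%:E)%E \is a fin_num.
  by rewrite ge0_fin_numE; [exact: le_lt_trans hle (ltry _)|exact: nneseries_ge0].
have hc' : (\sum_(0 <= i < m) (kcoef u i)%:E)%E @[m --> \oo] -->
    (fine (\sum_(i <oo) (kcoef u i)%:E)%E)%:E by rewrite fineK.
have := fine_cvg hc'; rewrite (_ : fine \o _ = fun m => \sum_(0 <= i < m) kcoef u i).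
  by move=> h; apply: h.
by apply/funext => m /=; rewrite sumEFin.
Qed.

Lemma kcoef_le_fine u (B : R) m : (forall k, 0 <= u k) ->
  (\esum_(k in Kset M) (u k)%:E <= B%:E)%E -> \sum_(0 <= i < m) kcoef u i <= B.
Proof.
move=> u0; rewrite esum_kcoef// => h; rewrite -lee_fin; apply: le_trans h.
by rewrite -sumEFin; apply: nneseries_lim_ge => i _ _; rewrite lee_fin kcoef_ge0.
Qed.

(** [rsum] treats positive and negative parts separately; the absolute bound keeps both sums finite,
    so that [fine] returns their true values. *)
Lemma rsum_cvg u (B : R) : (forall m, \sum_(0 <= i < m) `|kcoef u i| <= B) ->
  \sum_(0 <= i < m) kcoef u i @[m --> \oo] --> rsum (Kset M) u.
Proof.
move=> hB.
pose up k := Num.max (u k) 0; pose un k := Num.max (- u k) 0.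
have pE i : kcoef up i = Num.max (kcoef u i) 0.
  by rewrite (@kcoef_map u u (fun x _ => Num.max x 0))// maxxx.
have nE i : kcoef un i = Num.max (- kcoef u i) 0.
  by rewrite (@kcoef_map u u (fun x _ => Num.max (- x) 0))// oppr0 maxxx.
have p0 k : 0 <= up k by rewrite /up le_max lexx orbT.
have n0 k : 0 <= un k by rewrite /un le_max lexx orbT.
have cp := @esum_kcoef_cvg up B p0 _; have cn := @esum_kcoef_cvg un B n0 _.
rewrite /rsum -/up -/un.
have -> : (fun m => \sum_(0 <= i < m) kcoef u i) =
    (fun m => \sum_(0 <= i < m) kcoef up i - \sum_(0 <= i < m) kcoef un i).
  apply/funext => m; rewrite -sumrB; apply: eq_bigr => i _; rewrite pE nE.
  by set x := kcoef u i; case: (ltP x 0) => h1; case: (ltP (- x) 0) => h2; lra.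
apply: cvgB.
- apply: cp => m; apply: le_trans (hB m); apply: ler_sum => i _.
  by rewrite pE ge_max ler_norm normr_ge0.
- apply: cn => m; apply: le_trans (hB m); apply: ler_sum => i _.
  by rewrite nE ge_max normr_ge0 andbT -normrN ler_norm.
Qed.

End Enumeration.

(** * The coefficients and the pseudometric they define *)

Section Coefficients.
Context {R : realType} (d : nat) (M : option nat) (V : Type) (lam : V -> kvec d -> R).
Hypothesis Hsigma : (sigma_lam d M lam < +oo)%E.

Definition lcoef i v : R := kcoef M (lam v) i.
Definition sig : R := fine (sigma_lam d M lam).
Let rho := rho_lam d M lam.

Lemma lcoef_norm_sum v m : \sum_(0 <= i < m) `|lcoef i v| <= sig.
Proof.
have hv : (\esum_(k in Kset M) (`|lam v k|)%:E <= sigma_lam d M lam)%E.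
  by apply: ereal_sup_ubound; exists v.
have h0 : (0 <= sigma_lam d M lam)%E by apply: le_trans hv; apply: esum_ge0 => k _; rewrite lee_fin.
have hf : sigma_lam d M lam \is a fin_num by rewrite ge0_fin_numE.
rewrite -(fineK hf) in hv.
apply: le_trans (kcoef_le_fine m _ hv) => [|k]; last exact: normr_ge0.
rewrite le_eqVlt; apply/orP; left; apply/eqP; apply: eq_bigr => i _.
by rewrite (@kcoef_map R d M (lam v) (lam v) (fun x _ => `|x|))// normr0.
Qed.

Lemma lcoefB u v i : kcoef M (fun k => `|lam u k - lam v k|) i = `|lcoef i u - lcoef i v|.
Proof. by rewrite (@kcoef_map R d M (lam u) (lam v) (fun x y => `|x - y|))// subrr normr0. Qed.

(** Finiteness of [sigma_lam] makes the sum behind [rho] finite; as a limit of partial sums [rho]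
    inherits the axioms of a pseudometric. *)
Lemma rho_cvg u v : \sum_(0 <= i < m) `|lcoef i u - lcoef i v| @[m --> \oo] --> rho u v.
Proof.
have := @esum_kcoef_cvg R d M (fun k => `|lam u k - lam v k|) (sig + sig) (fun k => normr_ge0 _).
rewrite (_ : (fun m => \sum_(0 <= i < m) kcoef M _ i) =
  (fun m => \sum_(0 <= i < m) `|lcoef i u - lcoef i v|)); last first.
  by apply/funext => m; apply: eq_bigr => i _; exact: lcoefB.
apply => m; apply: le_trans (lerD (lcoef_norm_sum u m) (lcoef_norm_sum v m)).
rewrite -big_split/=; apply: ler_sum => i _; rewrite lcoefB; exact: ler_normB.
Qed.

Lemma rho_partial u v m : \sum_(0 <= i < m) `|lcoef i u - lcoef i v| <= rho u v.
Proof.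
rewrite -(cvg_lim _ (@rho_cvg u v))//.
apply: (nondecreasing_cvgn_le (u_ := fun m => \sum_(0 <= i < m) `|lcoef i u - lcoef i v|)).
  by apply/nondecreasing_seqP => n; rewrite big_nat_recr//= lerDl.
by apply/cvg_ex; eexists; exact: @rho_cvg.
Qed.

Lemma rho_lam_refl v : rho v v = 0.
Proof.
have := @rho_cvg v v; under eq_fun do under eq_bigr do rewrite subrr normr0.
under eq_fun do rewrite big1_eq.
by move=> h; apply/esym; apply: (cvg_unique _ (cvg_cst _) h).
Qed.

Lemma rho_lam_ge0 u v : 0 <= rho u v.
Proof. by have := rho_partial u v 0; rewrite big_geq. Qed.

Lemma rho_lam_sym u v : rho u v = rho v u.
Proof.
have h := @rho_cvg u v; have := @rho_cvg v u.
under eq_fun do under eq_bigr do rewrite distrC.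
by move=> h'; exact: (cvg_unique _ h h').
Qed.

Lemma rho_lam_tri u v w : rho u w <= rho u v + rho v w.
Proof.
rewrite -(cvg_lim _ (@rho_cvg u w))//; apply: limr_le; first by apply/cvg_ex; eexists; exact: @rho_cvg.
apply: nearW => m; apply: le_trans (lerD (rho_partial u v m) (rho_partial v w m)).
by rewrite -big_split/=; apply: ler_sum => i _; exact: ler_distD.
Qed.

End Coefficients.

Lemma prod_lip {R : realType} (S : Type) (r : seq S) (x y : S -> R) (K : R) : 1 <= K ->
  (forall s, `|x s| <= K) -> (forall s, `|y s| <= K) ->
  `|\prod_(s <- r) x s - \prod_(s <- r) y s| <= K ^+ size r * \sum_(s <- r) `|x s - y s|.
Proof.
move=> K1 xK yK; have K0 : 0 <= K by lra.
elim: r => [|s r ih]; first by rewrite !big_nil subrr normr0 mulr0.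
rewrite !big_cons /= exprS.
have XK : `|\prod_(s <- r) x s| <= K ^+ size r.
  elim: r {ih} => [|t r ih]; first by rewrite big_nil normr1.
  by rewrite big_cons normrM exprS ler_pM.
set X := \prod_(s <- r) x s in ih XK *; set Y := \prod_(s <- r) y s in ih *.
set D := \sum_(s <- r) _ in ih *.
have -> : x s * X - y s * Y = (x s - y s) * X + y s * (X - Y) by ring.
apply: le_trans (ler_normD _ _) _; rewrite !normrM mulrDr; apply: lerD.
  rewrite mulrC; apply: ler_wpM2r => //; apply: le_trans XK _.
  by rewrite ler_peMl// exprn_ge0.
by rewrite -mulrA ler_pM.
Qed.

(** Within distance 1 of [x], clipping at [\sum_i |x i| + 1] acts as the identity, so continuity at
    [x] is that of a Lipschitz function. *)
Lemma clip_vcontinuous {R : realType} (I : finType) (Phi : (I -> R) -> R) :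
  (forall K : R, 1 <= K -> exists2 L : R, 0 <= L & vlip L (Phi \o clip K)) -> vcontinuous Phi.
Proof.
move=> h x e e0; pose K := \sum_i `|x i| + 1.
have S0 : 0 <= \sum_i `|x i| by rewrite sumr_ge0.
have K1 : 1 <= K by rewrite lerDr.
have [L _ /vlip_continuous cL] := h K K1.
have [del del0 hd] := cL x e e0.
exists (Num.min del 1); first by rewrite lt_min del0 ltr01.
move=> y hy; have xK i : `|x i| <= \sum_i `|x i|.
  by rewrite (bigD1 i)//= lerDl sumr_ge0.
have yd i : `|y i - x i| < del by apply: lt_le_trans (hy i) _; rewrite ge_min lexx.
have := hd y yd.
rewrite /= !clip_id// => i; first by apply: le_trans (xK i) _; rewrite lerDl.
have := hy i; rewrite lt_min => /andP[_ h1]; have := ler_normD (y i - x i) (x i).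
by rewrite subrK /K; have := xK i; lra.
Qed.

(** [powR_taylor] with [a = y] and [b = x - y], for [y <= x]; on [[0, K]] its linear term and its
    remainder are at most multiples of [x - y]. *)
Lemma powR_lip {R : realType} (p K : R) : 2 <= p -> 0 < K -> exists2 L : R, 0 <= L &
  forall x y : R, 0 <= x <= K -> 0 <= y <= K -> `|x `^ p - y `^ p| <= L * `|x - y|.
Proof.
move=> p2 K0; have pp : 0 <= p by lra.
have C0 := taylor_cst_ge0 pp.
pose L := p * K `^ (p - 1) + taylor_cst p * (K `^ (p - 1) + K `^ (p - 1)).
have L0 : 0 <= L.
  by apply: addr_ge0; apply: mulr_ge0 => //; rewrite ?addr_ge0 ?powR_ge0.
exists L => // x y xK yK.
wlog yx : x y xK yK / y <= x.
  move=> H; have [yx|xy] := leP y x; first exact: H.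
  by rewrite distrC [`|x - y|]distrC; apply: H => //; exact: ltW.
move: xK yK => /andP[x0 xK] /andP[y0 yK].
have b0 : 0 <= x - y by rewrite subr_ge0.
have bK : x - y <= K by lra.
have p20 : 0 <= p - 2 by lra. have p10 : 0 <= p - 1 by lra. have p0 : 0 <= p by lra.
have e1 u : 0 <= u -> u * u `^ (p - 2) = u `^ (p - 1).
  move=> u0; have [->|un0] := eqVneq u 0; first by rewrite mul0r powR0// gt_eqF//; lra.
  rewrite -{1}[u]powRr1// -powRD ?un0 ?implybT//; congr (_ `^ _); ring.
have mono u r : 0 <= u -> u <= K -> 0 <= r -> u `^ r <= K `^ r.
  by move=> u0 uK r0; rewrite ge0_ler_powR ?nnegrE// ltW.
rewrite (ger0_norm b0) ger0_norm; last by rewrite subr_ge0 ge0_ler_powR ?nnegrE.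
have := powR_taylor y (x - y) p2; rewrite addrC subrK !ger0_norm// e1// => h.
have h1 : p * y `^ (p - 1) * (x - y) <= p * K `^ (p - 1) * (x - y).
  by rewrite ler_wpM2r// ler_wpM2l// mono.
have h2 : y `^ (p - 2) * (x - y) ^+ 2 <= K `^ (p - 1) * (x - y).
  rewrite expr2 mulrA ler_wpM2r// -(e1 K (ltW K0)) mulrC.
  by apply: ler_pM => //; [exact: powR_ge0|exact: mono].
have h3 : (x - y) `^ p <= K `^ (p - 1) * (x - y).
  have -> : (x - y) `^ p = (x - y) `^ (p - 1) * (x - y).
    rewrite -[X in _ * X]powRr1//; have [->|bn0] := eqVneq (x - y) 0.
      by rewrite !powR0 ?mulr0// gt_eqF//; lra.
    by rewrite -powRD ?bn0 ?implybT//; congr (_ `^ _); ring.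
  by rewrite ler_wpM2r// mono.
have h4 : taylor_cst p * (y `^ (p - 2) * (x - y) ^+ 2 + (x - y) `^ p) <=
    taylor_cst p * (K `^ (p - 1) * (x - y) + K `^ (p - 1) * (x - y)).
  by rewrite ler_wpM2l// lerD.
rewrite lerBlDl; apply: le_trans h _; rewrite /L.
move: (taylor_cst p) (K `^ (p - 1)) (y `^ (p - 1)) (x `^ p) (y `^ p) h1 h4 => C k1 y1 xp yp.
clear; move: (y `^ (p - 2) * _) ((x - y) `^ p) => z1 z2; lra.
Qed.

Lemma min_dist {R : realType} (x y K : R) : `|Num.min x K - Num.min y K| <= `|x - y|.
Proof.
wlog xy : x y / x <= y.
  move=> H; have [xy|yx] := leP x y; first exact: H.
  by rewrite distrC [leRHS]distrC; apply: H; exact: ltW.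
rewrite !ler0_norm ?subr_le0//; last by rewrite le_min2.
by case: (ltP x K) => h1; case: (ltP y K) => h2; lra.
Qed.

Lemma max_dist {R : realType} (x y K : R) : `|Num.max K x - Num.max K y| <= `|x - y|.
Proof.
wlog xy : x y / x <= y.
  move=> H; have [xy|yx] := leP x y; first exact: H.
  by rewrite distrC [leRHS]distrC; apply: H; exact: ltW.
rewrite !ler0_norm ?subr_le0//; last by rewrite le_max2.
by case: (ltP K x) => h1; case: (ltP K y) => h2; lra.
Qed.

Section CoordProduct.
Context {R : realType} (d J : nat).
Implicit Types (k : kvec d) (x y : 'I_d * 'I_J -> R).

(** Coordinate [j] stands for index [j + 1], so [k s] is looked up at [(k s).-1]; the value 0 is a
    default for indices above [J]. *)
Definition coordprod k x : R :=
  \prod_(s < d) (if insub (k s).-1 is Some j then x (s, j) else 0).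

Lemma coordprod_lip k x y (K : R) : 1 <= K -> (forall i, `|x i| <= K) -> (forall i, `|y i| <= K) ->
  `|coordprod k x - coordprod k y| <= K ^+ d * \sum_i `|x i - y i|.
Proof.
move=> K1 xK yK; have K0 : 0 <= K by lra.
rewrite /coordprod; apply: le_trans (prod_lip _ K1 _ _) _.
- by move=> s; case: insub => [j|]; rewrite ?normr0.
- by move=> s; case: insub => [j|]; rewrite ?normr0.
have -> : size (index_enum 'I_d) = d by rewrite /index_enum -enumT size_enum_ord.
rewrite ler_wpM2l ?exprn_ge0//.
have -> : \sum_i `|x i - y i| = \sum_i `|x (i.1, i.2) - y (i.1, i.2)| by apply: eq_bigr => -[].
rewrite -(pair_bigA _ (fun s j => `|x (s, j) - y (s, j)|))/=; apply: ler_sum => s _.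
case: insub => [j|]; last by rewrite subrr normr0 sumr_ge0.
by rewrite (bigD1 j)//= lerDl sumr_ge0.
Qed.

Lemma coordprodE k x (f : 'I_d -> R) : (forall s, (0 < k s <= J)%N) ->
  (forall s (j : 'I_J), j.+1 = k s -> x (s, j) = f s) -> coordprod k x = \prod_(s < d) f s.
Proof.
move=> hk hx; apply: eq_bigr => s _; have /andP[k0 kJ] := hk s.
have kl : ((k s).-1 < J)%N by rewrite prednK.
by rewrite insubT; apply: hx; rewrite /= prednK.
Qed.

End CoordProduct.

Lemma cvg_sum_seq {R : realType} (I : Type) (r : seq I) (f : I -> nat -> R) (x : I -> R) :
  (forall i, f i m @[m --> \oo] --> x i) ->
  \sum_(i <- r) f i m @[m --> \oo] --> \sum_(i <- r) x i.
Proof.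
move=> h; elim: r => [|i r ih].
  by rewrite big_nil; under eq_fun do rewrite big_nil; exact: cvg_cst.
by rewrite big_cons; under eq_fun do rewrite big_cons; exact: cvgD.
Qed.

Lemma sum_delta {R : realType} (m : nat) (F : nat -> R) : (0 < m)%N ->
  \sum_(0 <= i < m) (i.+1 == m)%:R * F i.+1 = F m.
Proof.
case: m => // m _; rewrite big_nat_recr//= eqxx mul1r big_nat_cond big1 ?add0r//.
by move=> i /andP[/andP[_ im] _]; rewrite eqSS ltn_eqF// mul0r.
Qed.

Lemma kcoef_sum {R : realType} (d : nat) (M : option nat) (I : finType) (A : pred I)
  (u : I -> kvec d -> R) (c : R) i :
  kcoef M (fun k => c * \sum_(f | A f) u f k) i = c * \sum_(f | A f) kcoef M (u f) i.
Proof.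
rewrite /kcoef; case: pickle_inv => [k|]; last by rewrite big1 ?mulr0.
by case: ifP => // _; rewrite big1 ?mulr0.
Qed.

Lemma kcoef_ext {R : realType} (d : nat) (M : option nat) (u u' : kvec d -> R) i :
  (forall k, kin M k -> (pickle_inv i : option (kvec d)) = Some k -> u k = u' k) ->
  kcoef M u i = kcoef M u' i.
Proof.
move=> h; rewrite /kcoef; case E : pickle_inv => [k|//].
by case: ifP => // hk; exact: h.
Qed.

Lemma kcoef_dist {R : realType} (d : nat) (M : option nat) (u u' : kvec d -> R) (D : R) i :
  0 <= D -> (forall k, `|u k - u' k| <= D) -> `|kcoef M u i - kcoef M u' i| <= D.
Proof.
move=> D0 h; rewrite /kcoef; case: pickle_inv => [k|]; last by rewrite subrr normr0.
by case: ifP => // _; rewrite subrr normr0.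
Qed.

Section AbsoluteConvergence.
Context {R : realType} (V : Type) (a : \bar R) (tu : R -> R) (Ha : (2%:E < a)%E).
Hypothesis tu1 : forall p, prange a p -> 1 <= tu p.
Variables (l : nat -> V -> R) (sigma : R).
Hypothesis Hl2 : forall v m, \sum_(0 <= i < m) `|l i v| <= sigma.
Context d (T : measurableType d) (P : probability T R) (Z : nat -> T -> R).
Hypothesis Zb : moment_bound a tu P Z.

(** By Minkowski's inequality the absolute partial sums are bounded in L_2, so their limit is finite
    off a null set; there [rsum] is the usual sum. *)
Lemma series_bounded_ae v : exists N : set T, [/\ measurable N, P N = 0%E &
  forall w, ~ N w -> exists B : R, forall m, \sum_(0 <= i < m) `|l i v * Z i w| <= B].
Proof.
have pa := prange2 Ha; have t1 := tu1 pa; have t0 : 0 <= tu 2 by lra.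
have s0 : 0 <= sigma by have := Hl2 v 0; rewrite big_geq.
pose S m w : R := \sum_(0 <= i < m) `|l i v * Z i w|.
have C0 : 0 < tu 2 * sigma + 1 by rewrite ltr_wpDl// mulr_ge0.
have SL m : Lb P 2 (S m) (tu 2 * sigma + 1).
  apply: (@LbW _ _ _ _ _ _ (\sum_(i <- index_iota 0 m) `|l i v| * tu 2)) => //.
  - by rewrite sumr_ge0// => i _; rewrite mulr_ge0.
  - rewrite -mulr_suml mulrC; apply: (@le_trans _ _ (tu 2 * sigma)); last by rewrite lerDl.
    by rewrite ler_wpM2l//; exact: Hl2.
  apply: Lb_sum => [|i|i]; [by rewrite ler1n|by rewrite mulr_ge0|].
  have [mZ hZ] := LbZ (l i v) t0 (Zb i pa).
  apply: (@Lb_le _ _ _ P 2 _ (fun w => l i v * Z i w)) => //.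
  - exact: measurableT_comp.
  - by move=> w; rewrite normr_id.
have S0 w m : 0 <= S m w by rewrite sumr_ge0.
have Smono w m m' : (m <= m')%N -> S m w <= S m' w.
  by move=> mm; rewrite /S (big_cat_nat (leq0n m) mm)/= lerDl sumr_ge0.
have [H [mH H0 HI SH]] := dom_envelope C0 SL S0 Smono.
have iH : P.-integrable setT H.
  apply/integrableP; split => //; under eq_integral do rewrite gee0_abs//.
  by apply: le_lt_trans HI _; rewrite ltry.
have [N [mN PN NH]] := integrable_ae measurableT iH.
exists N; split => // w Nw; exists (fine (H w)) => m.
have Hf : H w \is a fin_num.
  by apply: contra_notT Nw => h; apply: NH => /= /(_ Logic.I); exact/negP.
by rewrite -lee_fin fineK//; exact: SH.
Qed.

End AbsoluteConvergence.

(** * The normalised sums *)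

Section Sample.
Context {R : realType} (d : nat) (dX : 'I_d -> measure_display)
  (X : forall s, measurableType (dX s)) (mu : forall s, probability (X s) R)
  (dO : measure_display) (Omega : measurableType dO)
  (P : probability Omega R) (xi : nat -> forall s, Omega -> X s).
Arguments xi : clear implicits.
Hypothesis Hxi_meas : forall i s, (1 <= i)%N -> measurable_fun setT (xi i s).
Hypothesis Hxi_law : forall i s (A : set (X s)), (1 <= i)%N -> measurable A ->
  P (xi i s @^-1` A) = mu s A.
Hypothesis Hxi_indep : indep_xi P xi.

Section RealFunctions.
Variable h : forall s, X s -> R.
Arguments h : clear implicits.
Hypothesis mh : forall s, measurable_fun setT (h s).

Let mhpre s (A : set R) : measurable A -> measurable (h s @^-1` A).
Proof. by move=> mA; rewrite -[X in measurable X]setTI; exact: mh. Qed.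

Lemma measurable_sample i s : measurable_fun setT (h s \o xi i.+1 s).
Proof. by apply: measurableT_comp; [exact: mh|exact: Hxi_meas]. Qed.

Lemma xi_mindep (N : nat) :
  mindep P (fun ij : 'I_N * 'I_d => h ij.2 \o xi ij.1.+1 ij.2).
Proof.
move=> A mA.
pose A' i s := if insub i.-1 is Some j then h s @^-1` A (j, s) else setT.
have A'E (j : 'I_N) s : A' j.+1 s = h s @^-1` A (j, s) by rewrite /A' /= valK.
have mA' i s : measurable (A' i s) by rewrite /A'; case: insubP => // j _ _; exact: mhpre.
have -> : \bigcap_(ij in [set: 'I_N * 'I_d]) ((h ij.2 \o xi ij.1.+1 ij.2) @^-1` A ij) =
    \bigcap_(i in [set i | (1 <= i <= N)%N]) \bigcap_(s in [set: 'I_d]) (xi i s @^-1` A' i s).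
  apply/seteqP; split => w /= hw.
    move=> [//|i] /= iN s _; rewrite -[i]/(val (Ordinal iN)) A'E.
    exact: (hw (Ordinal iN, s)).
  by move=> [i s] _ /=; have := hw i.+1 (ltn_ord i) s Logic.I; rewrite A'E.
rewrite Hxi_indep// big_add1 /= big_mkord pair_bigA/=.
by apply: eq_bigr => -[i s] _ /=; rewrite A'E.
Qed.

Lemma xi_iid (N : nat) (s : 'I_d) : iid_seq P N (fun i => h s \o xi i.+1 s).
Proof.
split; first by move=> i _; exact: measurable_sample.
split.
  move=> i A _ mA.
  have E k : P ((h s \o xi k.+1 s) @^-1` A) = mu s (h s @^-1` A).
    by apply: (@Hxi_law k.+1 s (h s @^-1` A)) => //; exact: mhpre.
  by rewrite !E.
move=> A mA.
pose A' i s' := if s' == s then h s' @^-1` A i.-1 else setT.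
have mA' i s' : measurable (A' i s') by rewrite /A'; case: ifP => // _; exact: mhpre.
have -> : \bigcap_(i in [set i | (i < N)%N]) ((h s \o xi i.+1 s) @^-1` A i) =
    \bigcap_(i in [set i | (1 <= i <= N)%N]) \bigcap_(s' in [set: 'I_d]) (xi i s' @^-1` A' i s').
  apply/seteqP; split => w /= hw.
    by move=> [//|i] /= iN s' _; rewrite /A'; case: eqP => // -> /=; exact: hw.
  by move=> i iN; have := hw i.+1 iN s Logic.I; rewrite /A' eqxx.
rewrite Hxi_indep// big_add1 /=; apply: eq_bigr => i _.
rewrite (bigD1 s)//= /A' eqxx big1 ?mule1// => s' /negPf ->.
by rewrite preimage_setT probability_setT.
Qed.

Definition wsum (n : 'I_d -> nat) (c : 'I_d -> nat -> R) s w : R :=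
  \sum_(0 <= i < n s) c s i * h s (xi i.+1 s w).

Lemma measurable_wsum n c s : measurable_fun setT (wsum n c s).
Proof.
by apply: measurable_sum => i; apply: measurable_funM => //; exact: measurable_sample.
Qed.

(** The factors are functions of the disjoint columns [ij.2 = s] of the sample, so the p-th moment
    of the product is the product of the p-th moments. *)
Lemma Lb_prod_wsum n c (p : R) (C : 'I_d -> R) : 0 < p -> (forall s, 0 <= C s) ->
  (forall s, Lb P p (wsum n c s) (C s)) ->
  Lb P p (fun w => \prod_(s < d) wsum n c s w) (\prod_(s < d) C s).
Proof.
move=> p0 C0 hC; split; first by apply: measurable_prod => s _; exact: measurable_wsum.
pose N := \max_(s < d) n s.
pose Z (ij : 'I_N * 'I_d) := h ij.2 \o xi ij.1.+1 ij.2.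
have mZ ij : measurable_fun setT (Z ij) by exact: measurable_sample.
pose B s (ij : 'I_N * 'I_d) := ij.2 == s.
have nN s : (n s <= N)%N by exact: leq_bigmax.
have aw s : adapted Z (B s) (wsum n c s).
  have -> : wsum n c s = fun w => \sum_(i < N) (if (i < n s)%N then c s i * Z (i, s) w else 0).
    by apply/funext => w; rewrite /wsum big_mkord (big_ord_widen _ (fun i => c s i * h s (xi i.+1 s w)) (nN s)) big_mkcond.
  apply: measurable_sum => i; case: (ltnP i (n s)) => _; last exact: measurable_cst.
  apply: measurable_funM; first exact: measurable_cst.
  by apply: (@adapted_coord _ _ _ _ Z (B s)); rewrite /B/= eqxx.
have aU s : adapted Z (B s) (fun w => `|wsum n c s w| `^ p).
  by apply/measurable_EFinP; exact: measurable_normp (aw s).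
have -> : (fun w => (`|\prod_(s < d) wsum n c s w| `^ p)%:E) =
    (fun w => (\prod_(s <- enum 'I_d) (`|wsum n c s w| `^ p))%:E).
  apply/funext => w; rewrite -big_enum/= normr_prod powR_prod//.
rewrite (mindep_ge0_integral_prod mZ (@xi_mindep N) (enum_uniq _) _ aU)//; last first.
  by move=> s s' ij /eqP <- /eqP.
rewrite -[in leRHS]big_enum/= powR_prod// -prodEFin.
by apply: lee_prod => s; [apply: integral_ge0 => w _; exact: normp_ge0|exact: (hC s).2].
Qed.

End RealFunctions.

Section Orthonormal.
Variables (M : option nat) (g : forall s, nat -> X s -> R).
Arguments g : clear implicits.
Hypothesis Hg : forall s j, in_range M j ->
  [/\ measurable_fun setT (g s j),
      (mu s).-integrable setT (fun x => (g s j x)%:E),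
      (mu s).-integrable setT (fun x => (g s j x ^+ 2)%:E) &
      (\int[mu s]_x (g s j x)%:E = 0)%E].
Hypothesis Horth : forall s j j', in_range M j -> in_range M j' ->
  (\int[mu s]_x (g s j x * g s j' x)%:E)%E = ((j == j')%:R)%:E.

Lemma sample_integral i s (f : X s -> R) : measurable_fun setT f ->
  (mu s).-integrable setT (EFin \o f) ->
  (\int[P]_w (f (xi i.+1 s w))%:E = \int[mu s]_x (f x)%:E)%E /\
  P.-integrable setT (fun w => (f (xi i.+1 s w))%:E).
Proof.
move=> mf fi; have mid : measurable_fun setT (@idfun (X s)) by exact: measurable_id.
have mxi := @Hxi_meas i.+1 s isT.
have law A : measurable A -> mu s (idfun @^-1` A) = P (xi i.+1 s @^-1` A) by move=> mA; rewrite Hxi_law.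
have mf' : measurable_fun setT (EFin \o f) by exact/measurable_EFinP.
split; first by rewrite -(eq_law_integral mid mxi law mf').
exact: (eq_law_integrable mid mxi law mf').
Qed.

Lemma measurable_g s j : in_range M j -> measurable_fun setT (g s j).
Proof. by move=> hj; have [] := @Hg s j hj. Qed.

Lemma sample_mean0 i s j : in_range M j -> (\int[P]_w (g s j (xi i.+1 s w))%:E = 0)%E.
Proof.
move=> hj; have [m1 i1 _ z] := @Hg s j hj.
by rewrite (@sample_integral i s (g s j) m1 i1).1.
Qed.

Lemma sample_sqr1 i s j : in_range M j -> (\int[P]_w (g s j (xi i.+1 s w) ^+ 2)%:E = 1)%E.
Proof.
move=> hj; have [m1 _ i2 _] := @Hg s j hj.
have m2 : measurable_fun setT (fun x => g s j x ^+ 2) by exact: measurable_funX.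
rewrite (@sample_integral i s _ m2 i2).1.
by have := @Horth s j j hj hj; rewrite eqxx; under eq_integral do rewrite -expr2.
Qed.

Definition Gfactor s p : \bar R :=
  ereal_sup [set pnorm P p (g s j \o xi 1%N s) | j in [set j | in_range M j]].

Lemma measurable_g1 s j : in_range M j -> measurable_fun setT (g s j \o xi 1 s).
Proof. by move=> hj; apply: measurableT_comp; [exact: measurable_g|exact: Hxi_meas]. Qed.

Lemma pnorm_g_ge1 s j p : 2 <= p -> in_range M j -> (1 <= pnorm P p (g s j \o xi 1 s))%E.
Proof.
move=> p2 hj; apply: pnorm_ge1 => //; first exact: measurable_g1.
exact: sample_sqr1.
Qed.

Hypothesis HM : in_range M 1.

Lemma Gfactor_ge1 s p : 2 <= p -> (1 <= Gfactor s p)%E.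
Proof.
move=> p2; apply: le_trans (pnorm_g_ge1 s p2 HM) _.
by apply: ereal_sup_ubound; exists 1%N.
Qed.

Variable a : \bar R.
Hypothesis Ha : (2%:E < a)%E.
Hypothesis HG : forall p, prange a p -> (Gfun P xi M g p < +oo)%E.

(** All factors are at least 1, so each of them is bounded by their finite product. *)
Lemma Gfactor_fin s p : prange a p -> Gfactor s p \is a fin_num.
Proof.
move=> pa; have [p2 _] := pa.
have G1 t : (1 <= Gfactor t p)%E by exact: Gfactor_ge1.
have G0 t : (0 <= Gfactor t p)%E by apply: le_trans (G1 t).
rewrite ge0_fin_numE//; apply: le_lt_trans (HG pa).
rewrite /Gfun -/(Gfactor _ p) (bigD1 s)//= -[leLHS]mule1.
apply: lee_pmul => //; apply: (big_ind (fun x => (1 <= x)%E)) => // [x y x1 y1|t _].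
  by rewrite -[leLHS]mule1; exact: lee_pmul.
exact: G1.
Qed.

Definition gmom s p : R := fine (Gfactor s p).

Lemma gmom_ge1 s p : prange a p -> 1 <= gmom s p.
Proof. by move=> pa; rewrite -lee_fin fineK ?Gfactor_fin// Gfactor_ge1//; have [] := pa. Qed.

Let tu := tau d (Gfun P xi M g).

Lemma tauE p : prange a p -> tu p = \prod_(s < d) (K_R p * gmom s p).
Proof.
move=> pa; rewrite big_split/= prodr_const card_ord; congr (_ * _).
rewrite -[RHS]/(fine (\prod_(s < d) gmom s p)%:E) -prodEFin; congr fine.
by apply: eq_bigr => s _; rewrite fineK ?Gfactor_fin.
Qed.

Lemma pnorm_g_le s j p : prange a p -> in_range M j ->
  (pnorm P p (g s j \o xi 1 s) <= (gmom s p)%:E)%E.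
Proof.
by move=> pa hj; rewrite fineK ?Gfactor_fin//; apply: ereal_sup_ubound; exists j.
Qed.

Lemma K_R_ge1_sample (s : 'I_d) p : prange a p -> 1 <= K_R p :> R.
Proof.
move=> pa; have [p2 _] := pa.
apply: (@K_R_ge1 _ _ _ P (g s 1%N \o xi 1 s)) => //.
- exact: measurable_g1.
- exact: (@sample_mean0 0).
- by apply: lt_le_trans (pnorm_g_ge1 s p2 HM).
- by apply: le_lt_trans (pnorm_g_le s pa HM) _; rewrite ltry.
Qed.

Lemma tau_ge1 p : prange a p -> 1 <= tu p.
Proof.
move=> pa; rewrite tauE//; apply: (big_ind (fun x => 1 <= x)) => // [x y x1 y1|s _].
  by rewrite -[leLHS]mulr1; apply: ler_pM.
by rewrite -[leLHS]mulr1; apply: ler_pM => //; [exact: K_R_ge1_sample|exact: gmom_ge1].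
Qed.

(** General weights serve two purposes: the equal weights [n(s)^(-1/2)] give the normalised sums,
    and weights concentrated at one index give a single term of [QL]. *)
Lemma Lb_sample_prod (n : 'I_d -> nat) (c : 'I_d -> nat -> R) (k : kvec d) p :
  prange a p -> (forall s, (0 < n s)%N) ->
  (forall s, \sum_(0 <= i < n s) c s i ^+ 2 <= 1) -> Kset M k ->
  Lb P p (fun w => \prod_(s < d) \sum_(0 <= i < n s) c s i * g s (k s) (xi i.+1 s w)) (tu p).
Proof.
move=> pa n0 c1 hk; have [p2 _] := pa; have p0 : 0 < p by lra.
have mgk s : measurable_fun setT (g s (k s)) by exact: measurable_g.
rewrite tauE//.
have K0 (s : 'I_d) : 0 <= K_R p :> R by apply: le_trans (K_R_ge1_sample s pa).
have C0 s : 0 <= K_R p * gmom s p.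
  by rewrite mulr_ge0 ?(K0 s)//; apply: le_trans (gmom_ge1 s pa).
apply: (@Lb_prod_wsum (fun s => g s (k s)) mgk n c p (fun s => K_R p * gmom s p)) => // s.
apply/LbP => //; first exact: measurable_wsum.
have iid := xi_iid mgk (n s) s.
have pf : (pnorm P p (g s (k s) \o xi 1 s) < +oo)%E.
  by apply: le_lt_trans (pnorm_g_le s pa (hk s)) _; rewrite ltry.
have := @rosenthal_K_R R p p2 (n s) (c s) _ _ P _ (n0 s) iid (@sample_mean0 0 s _ (hk s)) pf.
move=> /le_trans; apply; rewrite [leRHS]EFinM.
apply: lee_pmul.
- by rewrite lee_fin mulr_ge0 ?sqrtr_ge0 ?(K0 s).
- exact: Lnorm_ge0.
- rewrite lee_fin ler_piMr ?(K0 s)// -sqrtr1 ler_wsqrtr//.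
- exact: pnorm_g_le.
Qed.


(** Extension by 0 beyond [M], so that any number [J] of coordinates can be used whatever [M] is. *)
Definition masked_g s j (x : X s) : R := if in_range M j then g s j x else 0.

Lemma measurable_masked_g s j : measurable_fun setT (@masked_g s j).
Proof. by rewrite /masked_g; case: (boolP (in_range M j)) => // /(@Hg s)[]. Qed.

Lemma integrable_masked_g s j : (mu s).-integrable setT (EFin \o @masked_g s j) /\
  \int[mu s]_x @masked_g s j x = 0.
Proof.
rewrite /masked_g; case: (boolP (in_range M j)) => [/(@Hg s)[_ h _ z]|_].
  by split => //; rewrite /Rintegral z.
by rewrite /Rintegral integral0; split => //; exact: integrable0.
Qed.

Lemma integrable_masked_gM s j j' :
  (mu s).-integrable setT (EFin \o (fun x => @masked_g s j x * @masked_g s j' x)) /\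
  \int[mu s]_x (@masked_g s j x * @masked_g s j' x) = (in_range M j && (j == j'))%:R.
Proof.
rewrite /masked_g; case: (boolP (in_range M j)) => [hj|_]; last first.
  by under eq_Rintegral do rewrite mul0r; split; rewrite /Rintegral ?integral0//;
    rewrite /comp; under eq_fun do rewrite mul0r; exact: integrable0.
case: (boolP (in_range M j')) => [hj'|nj]; last first.
  have -> : (j == j') = false by apply/negP => /eqP jj; rewrite -jj hj in nj.
  by under eq_Rintegral do rewrite mulr0; split; rewrite /Rintegral ?integral0//;
    rewrite /comp; under eq_fun do rewrite mulr0; exact: integrable0.
split; last by rewrite /Rintegral Horth.
have [m1 _ i1 _] := @Hg s j hj; have [m2 _ i2 _] := @Hg s j' hj'.
have i3 := integrableD measurableT i1 i2.
apply: (le_integrable measurableT _ _ i3).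
  by apply/measurable_EFinP; exact: measurable_funM.
move=> x _ /=; rewrite lee_fin [leRHS]ger0_norm ?addr_ge0 ?sqr_ge0//.
rewrite normrM -[g s j x ^+ 2]real_normK ?num_real// -[g s j' x ^+ 2]real_normK ?num_real//.
have := sqr_ge0 (`|g s j x| - `|g s j' x|); have := normr_ge0 (g s j x); have := normr_ge0 (g s j' x).
by nra.
Qed.

Lemma Lb_masked_g i s j p : prange a p ->
  Lb P p (@masked_g s j \o xi i.+1 s) (gmom s p).
Proof.
move=> pa; have [p2 _] := pa; have p0 : 0 < p by lra.
have g0 : 0 <= gmom s p.
  by apply: le_trans (gmom_ge1 s pa).
have mm := @measurable_masked_g s j.
split; first by apply: measurableT_comp => //; exact: Hxi_meas.
have law A : measurable A -> P (xi i.+1 s @^-1` A) = P (xi 1%N s @^-1` A).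
  by move=> mA; rewrite !Hxi_law.
have mf : measurable_fun setT (fun x => (`|@masked_g s j x| `^ p)%:E) by exact: measurable_normp.
rewrite (eq_law_ge0_integral (@Hxi_meas i.+1 s isT) (@Hxi_meas 1%N s isT) law mf)//.
suff [] : Lb P p (@masked_g s j \o xi 1 s) (gmom s p) by [].
case: (boolP (in_range M j)) => hj.
  have -> : @masked_g s j = g s j by apply/funext => x; rewrite /masked_g hj.
  apply/LbP => //; first exact: (measurable_g1 s hj).
  exact: (pnorm_g_le s pa hj).
have -> : @masked_g s j \o xi 1 s = cst 0 by apply/funext => w; rewrite /masked_g /= (negPf hj).
exact: Lb0.
Qed.

(** * Central limit error for one linear combination of the coordinates *)

Section TrigSum.
Variables (J : nat) (t : 'I_d * 'I_J -> R).

Definition tsum s (x : X s) : R := \sum_(j < J) t (s, j) * masked_g j.+1 x.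

Definition tvar s : R := \sum_(j < J) (t (s, j) * (in_range M j.+1)%:R) ^+ 2.

Lemma tvar_ge0 s : 0 <= tvar s.
Proof. by rewrite sumr_ge0// => j _; exact: sqr_ge0. Qed.

Lemma measurable_tsum s : measurable_fun setT (@tsum s).
Proof.
apply: measurable_sum => j; apply: measurable_funM => //; exact: measurable_masked_g.
Qed.

Lemma tsum_mean i s : \int[P]_w @tsum s (xi i.+1 s w) = 0.
Proof.
have h j : (mu s).-integrable setT (EFin \o (fun x => t (s, j) * @masked_g s (nat_of_ord j).+1 x)).
  exact: (integrableZl measurableT (t (s, j)) (integrable_masked_g s j.+1).1).
have [h1 h2] := Rintegral_sum (index_enum 'I_J) h.
rewrite /Rintegral (sample_integral i (@measurable_tsum s) h1).1.
rewrite -/(Rintegral _ _ _) h2 big1// => j _.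
by rewrite RintegralZl ?(integrable_masked_g s j.+1).2 ?mulr0//; exact: (integrable_masked_g s j.+1).1.
Qed.

Lemma tsum_sqr i s : \int[P]_w (@tsum s (xi i.+1 s w) ^+ 2) = tvar s.
Proof.
have h (jj : 'I_J * 'I_J) : (mu s).-integrable setT (EFin \o (fun x =>
    (t (s, jj.1) * t (s, jj.2)) * (@masked_g s (nat_of_ord jj.1).+1 x * @masked_g s (nat_of_ord jj.2).+1 x))).
  exact: (integrableZl measurableT _ (integrable_masked_gM s jj.1.+1 jj.2.+1).1).
have [h1 h2] := Rintegral_sum (index_enum _) h.
have E x : @tsum s x ^+ 2 = \sum_jj (t (s, jj.1) * t (s, jj.2)) *
     (@masked_g s (nat_of_ord jj.1).+1 x * @masked_g s (nat_of_ord jj.2).+1 x).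
  rewrite expr2 /tsum big_distrl/=.
  under eq_bigr do rewrite big_distrr/=.
  by rewrite pair_bigA/=; apply: eq_bigr => jj _; ring.
have m2 : measurable_fun setT (fun x => @tsum s x ^+ 2).
  by apply: measurable_funX; exact: measurable_tsum.
rewrite /Rintegral (sample_integral i m2 _).1; last first.
  by rewrite /comp; under eq_fun do rewrite E.
rewrite -/(Rintegral _ _ _); under eq_Rintegral do rewrite E.
rewrite h2 -(pair_bigA _ (fun j j' => \int[mu s]_x ((t (s, j) * t (s, j')) *
     (@masked_g s (nat_of_ord j).+1 x * @masked_g s (nat_of_ord j').+1 x))))/=.
apply: eq_bigr => j _; rewrite (bigD1 j)//= big1 ?addr0.
  rewrite RintegralZl//; last exact: (integrable_masked_gM s j.+1 j.+1).1.
  rewrite (integrable_masked_gM s j.+1 j.+1).2 eqxx andbT.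
  by case: in_range; rewrite ?mulr1 ?mulr0 ?expr0n ?expr2.
move=> j' jj'; rewrite RintegralZl//; last exact: (integrable_masked_gM s j.+1 j'.+1).1.
rewrite (integrable_masked_gM s j.+1 j'.+1).2 eqSS.
by rewrite [_ == _ :> nat](_ : _ = false) ?andbF ?mulr0//; apply/negP => /eqP/val_inj jE; rewrite jE eqxx in jj'.
Qed.

(** The summand 1 keeps the bound positive when all [t] vanish, as [close_atom] requires. *)
Definition tbound s p : R := \sum_(j < J) `|t (s, j)| * gmom s p + 1.

Lemma tbound_gt0 s p : prange a p -> 0 < tbound s p.
Proof.
move=> pa; rewrite ltr_wpDl// sumr_ge0// => j _; rewrite mulr_ge0//.
by apply: le_trans (gmom_ge1 s pa).
Qed.

Lemma Lb_tsum i s p : prange a p -> Lb P p (@tsum s \o xi i.+1 s) (tbound s p).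
Proof.
move=> pa; have [p2 _] := pa; have p1 : 1 <= p by lra. have p0 : 0 <= p by lra.
have g0 : 0 <= gmom s p.
  by apply: le_trans (gmom_ge1 s pa).
apply: (@LbW _ _ _ _ _ _ (\sum_(j < J) `|t (s, j)| * gmom s p)) => //.
- by rewrite sumr_ge0// => j _; rewrite mulr_ge0.
- by rewrite lerDl.
apply: Lb_sum => // j; first by rewrite mulr_ge0.
by apply: LbZ => //; exact: Lb_masked_g.
Qed.

(** The error of [close_atom] with [a = n(s)^(-1/2)], incurred once for each of the [n(s)]
    observations. *)
Definition clt_error (n : 'I_d -> nat) p s : R := (n s)%:R *
  (6 * (Num.sqrt (n s)%:R)^-1 `^ p * tbound s p `^ p +
   ((Num.sqrt (n s)%:R)^-1 ^+ 2 * tvar s) ^+ 2).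

Lemma sample_close (n : 'I_d -> nat) p : 2 < p -> p <= 3 -> prange a p ->
  (forall s, (0 < n s)%N) -> (forall s, tvar s <= (n s)%:R) ->
  close P (fun w => \sum_(s < d) (Num.sqrt (n s)%:R)^-1 * \sum_(0 <= i < n s) tsum (xi i.+1 s w))
    (\sum_(s < d) tvar s) (\sum_(s < d) clt_error n p s).
Proof.
move=> p2 p3 pa n0 nv.
pose N := \max_(s < d) n s; have nN s : (n s <= N)%N by exact: leq_bigmax.
pose al s : R := (Num.sqrt (n s)%:R)^-1.
have nR0 s : 0 < (n s)%:R :> R by rewrite ltr0n.
have al0 s : 0 <= al s by rewrite invr_ge0 sqrtr_ge0.
have al2 s : al s ^+ 2 = (n s)%:R^-1 by rewrite exprVn sqr_sqrtr.
pose h s (x : X s) := al s * tsum x.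
have mh s : measurable_fun setT (@h s).
  by apply: measurable_funM => //; exact: measurable_tsum.
have iZ := xi_mindep mh (N := N).
pose r := [seq ij : 'I_N * 'I_d <- enum {: 'I_N * 'I_d} | (ij.1 < n ij.2)%N].
have := close_sum (r := r) (v := fun ij => al ij.2 ^+ 2 * tvar ij.2)
  (e := fun ij => 6 * al ij.2 `^ p * tbound ij.2 p `^ p + (al ij.2 ^+ 2 * tvar ij.2) ^+ 2)
  _ iZ (filter_uniq _ (enum_uniq _)) _ _.
rewrite (sum_block (fun _ s => al s ^+ 2 * tvar s) nN).
rewrite (sum_block (fun _ s => 6 * al s `^ p * tbound s p `^ p + (al s ^+ 2 * tvar s) ^+ 2) nN).
have -> : (fun w => \sum_(ij <- r) (h ij.2 \o xi ij.1.+1 ij.2) w) =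
    (fun w => \sum_(s < d) al s * \sum_(0 <= i < n s) tsum (xi i.+1 s w)).
  apply/funext => w; rewrite (sum_block (fun i s => h s (xi i.+1 s w)) nN).
  by apply: eq_bigr => s _; rewrite mulr_sumr.
have -> : \sum_(s < d) \sum_(0 <= i < n s) al s ^+ 2 * tvar s = \sum_(s < d) tvar s.
  apply: eq_bigr => s _; rewrite sumr_const_nat subn0 -mulr_natl mulrA al2 mulfV ?mul1r//.
  by rewrite gt_eqF.
have -> : \sum_(s < d) \sum_(0 <= i < n s)
     (6 * al s `^ p * tbound s p `^ p + (al s ^+ 2 * tvar s) ^+ 2) = \sum_(s < d) clt_error n p s.
  by apply: eq_bigr => s _; rewrite sumr_const_nat subn0 -[LHS]mulr_natl.
apply.
- by move=> ij; exact: measurable_sample.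
- by move=> ij; rewrite mulr_ge0 ?sqr_ge0 ?tvar_ge0.
- move=> ij _; apply: (close_atom p2 p3 (tbound_gt0 ij.2 pa) (al0 ij.2)).
  + exact: Lb_tsum.
  + exact: tsum_mean.
  + exact: tsum_sqr.
  + exact: tvar_ge0.
  + by rewrite al2 mulrC ler_pdivrMr// mul1r.
Qed.

Lemma clt_error_small p (e : R) : 2 < p -> 0 < e -> exists N : nat, forall n : 'I_d -> nat,
  (forall s, (N <= n s)%N) -> \sum_(s < d) clt_error n p s <= e.
Proof.
move=> p2 e0; pose e1 : R := e / (2 * (d%:R + 1)).
have d0 : 0 <= d%:R :> R by [].
have e10 : 0 < e1 by rewrite divr_gt0// mulr_gt0// ltr_wpDl.
have /choice[N1 hN1] := fun s => sqrtn_powR_small (6 * tbound s p `^ p) p2 e10.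
(* From [N2 s] on, the second part of the error, [tvar s ^+ 2 / n], is at most [e1]. *)
pose N2 s := (Num.truncn (tvar s ^+ 2 / e1)).+1.
exists (maxn 1 (\max_(s < d) maxn (N1 s) (N2 s))) => n hn.
apply: (@le_trans _ _ (\sum_(s < d) (e1 + e1))); last first.
  rewrite sumr_const card_ord -[leLHS]mulr_natl /e1.
  have -> : d%:R * (e / (2 * (d%:R + 1)) + e / (2 * (d%:R + 1))) = e * (d%:R / (d%:R + 1)).
    by field; rewrite gt_eqF// ltr_wpDl.
  by rewrite ler_piMr ?(ltW e0)// ler_pdivrMr ?ltr_wpDl// mul1r lerDl.
apply: ler_sum => s _; have := hn s; rewrite geq_max => /andP[n1 ns].
have := leq_trans (leq_bigmax s) ns; rewrite geq_max => /andP[a1 a2].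
have n0 : 0 < (n s)%:R :> R by rewrite ltr0n.
rewrite /clt_error mulrDr; apply: lerD.
  by rewrite mulrAC; exact: hN1.
rewrite exprVn sqr_sqrtr ?(ltW n0)//.
have -> : (n s)%:R * ((n s)%:R^-1 * tvar s) ^+ 2 = tvar s ^+ 2 / (n s)%:R.
  by field; rewrite gt_eqF.
rewrite ler_pdivrMr// mulrC -ler_pdivrMr//.
by apply/ltW/(lt_le_trans (truncnS_gt _)); rewrite ler_nat.
Qed.

(** The Taylor bounds ask for [p <= 3], the Lyapunov term for [p > 2]; [a > 2] leaves room for
    both. *)
Lemma prange_23 : exists p, [/\ 2 < p, p <= 3 & prange a p].
Proof.
have [b b2 ba] : exists2 b : R, 2 < b & (b%:E < a)%E.
  case: a Ha => [r|_|//]; last by exists 3; rewrite ?ltry//; lra.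
  by rewrite lte_fin => r2; exists ((2 + r) / 2); rewrite ?lte_fin; lra.
exists (Num.min b 3); split.
- by rewrite lt_min b2; lra.
- by rewrite ge_min lexx orbT.
split => /=; first by rewrite le_min (ltW b2); lra.
by apply: le_lt_trans ba; rewrite lee_fin ge_min lexx.
Qed.

Lemma sample_trig_cvg (n : nat -> 'I_d -> nat) (c : R) :
  (forall N, exists k0, forall k, (k0 <= k)%N -> forall s, (N <= n k s)%N) ->
  \int[P]_w cos (\sum_(s < d) (Num.sqrt (n k s)%:R)^-1 *
      \sum_(0 <= i < n k s) tsum (xi i.+1 s w) + c) @[k --> \oo]
  --> expR (- (\sum_(s < d) tvar s) / 2) * cos c.
Proof.
move=> hn; have [p [p2 p3 pa]] := prange_23.
apply/cvgrPdist_le => e e0; have [N1 hN1] := clt_error_small p2 e0.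
pose N2 s := (Num.truncn (tvar s)).+1.
have [k0 hk0] := hn (maxn N1 (\max_(s < d) N2 s)).
exists k0 => // k /= kk; rewrite distrC.
have h1 s : (N1 <= n k s)%N by have := hk0 k kk s; rewrite geq_max => /andP[].
have h2 s : (N2 s <= n k s)%N.
  have := hk0 k kk s; rewrite geq_max => /andP[_]; apply: leq_trans.
  exact: (leq_bigmax s).
apply: le_trans (hN1 (n k) h1); apply: close_cos.
  apply: measurable_sum => s; apply: measurable_funM => //; apply: measurable_sum => i.
  by apply: measurableT_comp; [exact: measurable_tsum|exact: Hxi_meas].
apply: sample_close => // s; first exact: leq_trans (h2 s).
by apply/ltW/(lt_le_trans (truncnS_gt _)); rewrite ler_nat; exact: h2.
Qed.

End TrigSum.

(* Coordinate (s, j) carries the function g^(s) of index j + 1. *)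
Definition coord J (n : 'I_d -> nat) (sj : 'I_d * 'I_J) w : R :=
  (Num.sqrt (n sj.1)%:R)^-1 * \sum_(0 <= i < n sj.1) masked_g sj.2.+1 (xi i.+1 sj.1 w).

Lemma measurable_coord J n sj : measurable_fun setT (@coord J n sj).
Proof.
apply: measurable_funM => //; apply: measurable_sum => i.
by apply: measurableT_comp; [exact: measurable_masked_g|exact: Hxi_meas].
Qed.

Lemma sum_coord J (t : 'I_d * 'I_J -> R) n w : \sum_sj t sj * coord n sj w =
  \sum_(s < d) (Num.sqrt (n s)%:R)^-1 * \sum_(0 <= i < n s) tsum t (xi i.+1 s w).
Proof.
have -> : \sum_sj t sj * coord n sj w = \sum_sj t (sj.1, sj.2) * coord n (sj.1, sj.2) w.
  by apply: eq_bigr => -[].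
rewrite -(pair_bigA _ (fun s j => t (s, j) * coord n (s, j) w))/=; apply: eq_bigr => s _.
rewrite /coord /tsum/= exchange_big/= mulr_sumr; apply: eq_bigr => j _.
by rewrite mulrCA -mulr_sumr.
Qed.

(** A second-moment bound that does not depend on [n], the source of tightness for the normalised
    sums. *)
Lemma Lb_coord J n sj : Lb P 2 (@coord J n sj) (K_R 2 * gmom sj.1 2).
Proof.
case: sj => s j; have pa : prange a 2 by split.
have [n0|n0] := posnP (n s).
  have -> : coord n (s, j) = cst 0 by apply/funext => w; rewrite /coord /= n0 big_geq// mulr0.
  exact: Lb0.
have K0 : 0 <= K_R 2 :> R.
  by apply: le_trans (K_R_ge1_sample s pa).
have g0 : 0 <= gmom s 2.
  by apply: le_trans (gmom_ge1 s pa).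
apply/LbP => //; [exact: mulr_ge0|exact: measurable_coord|].
have mg s' : measurable_fun setT (@masked_g s' j.+1) by exact: measurable_masked_g.
have iid := xi_iid mg (n s) s.
have hL := Lb_masked_g 0 s j.+1 pa.
have hb : (pnorm P 2 (@masked_g s j.+1 \o xi 1 s) <= (gmom s 2)%:E)%E by exact: Lb_pnorm.
have hf := le_lt_trans hb (ltry _).
have hz : (\int[P]_w (masked_g j.+1 (xi 1 s w))%:E = 0)%E.
  have [i1 z1] := integrable_masked_g s j.+1.
  rewrite (sample_integral 0 (mg s) i1).1.
  by rewrite EFin_Rintegral// z1.
have h22 : (2:R) <= 2 by [].
have := @rosenthal_K_R R 2 h22 (n s) (fun=> (Num.sqrt (n s)%:R)^-1) _ _ P _ n0 iid hz hf.
rewrite (_ : (fun t => _) = coord n (s, j)); last first.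
  by apply/funext => w; rewrite /coord mulr_sumr.
move=> /le_trans; apply; rewrite [leRHS]EFinM.
apply: lee_pmul => //.
- by rewrite lee_fin mulr_ge0 ?sqrtr_ge0.
- exact: Lnorm_ge0.
- rewrite lee_fin ler_piMr// sumr_const_nat subn0 exprVn sqr_sqrtr//.
  by rewrite -[_ *+ _]mulr_natr mulVf ?sqrtr1// gt_eqF// ltr0n.
Qed.

Context (dO' : measure_display) (Omega' : measurableType dO')
  (P' : probability Omega' R) (beta : 'I_d -> nat -> Omega' -> R).
Hypothesis Hbeta : std_gauss_family P' beta.

Definition gcoord J (sj : 'I_d * 'I_J) w : R := (in_range M sj.2.+1)%:R * beta sj.1 sj.2.+1 w.

Lemma measurable_gcoord J sj : measurable_fun setT (@gcoord J sj).
Proof. by have [h _ _] := Hbeta; apply: measurable_funM => //; exact: h. Qed.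

Lemma coord_weak J (n : nat -> 'I_d -> nat) Phi (B : R) :
  (forall N, exists k0, forall k, (k0 <= k)%N -> forall s, (N <= n k s)%N) ->
  (forall x, `|Phi x| <= B) ->
  (forall K : R, 1 <= K -> exists2 L : R, 0 <= L & vlip L (Phi \o clip K)) ->
  \int[P]_w Phi (fun sj => coord (n k) sj w) @[k --> \oo] -->
  \int[P']_w Phi (fun sj : 'I_d * 'I_J => gcoord sj w).
Proof.
move=> hn PB PL.
apply: (@wconv_lip _ _ _ _ _ P P' _ (fun k sj => coord (n k) sj) (@gcoord J) _ _ _ _ B) => //.
- by move=> k sj; exact: (measurable_coord).
- exact: measurable_gcoord.
- move=> t c; rewrite /wconv /trig.
  have := sample_trig_cvg (t := t) hn (c := c).
  rewrite (_ : expR _ * cos c = \int[P']_w cos (\sum_i t i * gcoord i w + c)).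
    rewrite [X in X @ _ --> _ -> _](_ : _ =
      fun k => \int[P]_w cos (\sum_i t i * coord (n k) i w + c))//.
    by apply/funext => k; apply: eq_Rintegral => w _; rewrite sum_coord.
  have -> : (fun w => cos (\sum_i t i * gcoord i w + c)) =
      (fun w => cos (\sum_sj (t sj * (in_range M sj.2.+1)%:R) * beta sj.1 sj.2.+1 w + c)).
    by apply/funext => w; congr (cos (_ + _)); apply: eq_bigr => sj _; rewrite mulrA.
  have gt := @gauss_trig _ _ _ _ _ _ Hbeta J (fun sj => t sj * (in_range M (nat_of_ord sj.2).+1)%:R) c.
  have E : \sum_(s < d) tvar t s = \sum_(sj : 'I_d * 'I_J) (t sj * (in_range M (nat_of_ord sj.2).+1)%:R) ^+ 2.
    rewrite /tvar pair_bigA/=; apply: eq_bigr => -[s j] _ //.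
  by rewrite E -gt.
- move=> e e0.
  have /choice[n0 hn0] := fun sj => tight_variable P' (@measurable_gcoord J sj) e0.
  pose C (sj : 'I_d * 'I_J) := K_R 2 * gmom sj.1 2 : R.
  have C0 sj : 0 <= C sj.
    have pa : prange a 2 by split.
    rewrite mulr_ge0//.
      by apply: le_trans (K_R_ge1_sample sj.1 pa).
    by apply: le_trans (gmom_ge1 sj.1 pa).
  pose N2 sj := Num.truncn (C sj ^+ 2 / e).
  (* [K] exceeds [C^2 / e] and is at least 1, so Chebyshev's bound [C^2 / K^2] is at most [e]; it
     also exceeds the thresholds of the Gaussian tails. *)
  pose K := (maxn (\max_sj n0 sj) (\max_sj N2 sj)).+1.
  exists K%:R => [//|sj]; split => [k|].
    apply: le_trans (Lb_tail _ (C0 sj) (Lb_coord (n k) sj)) _ => //.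
    have K0 : 0 < K%:R :> R by [].
    rewrite ler_pdivrMr ?exprn_gt0// mulrC -ler_pdivrMr//.
    apply: (@le_trans _ _ (N2 sj).+1%:R); first by apply/ltW/truncnS_gt.
    apply: (@le_trans _ _ K%:R).
      by rewrite ler_nat ltnS leq_max (leq_bigmax sj) orbT.
    by rewrite expr2 ler_peMl// ler1n.
  by apply: hn0; rewrite leqW// leq_max (leq_bigmax sj).
- exact: clip_vcontinuous.
Qed.

Definition sample_prod (n : 'I_d -> nat) (k : kvec d) w : R :=
  \prod_(s < d) ((Num.sqrt (n s)%:R)^-1 * \sum_(0 <= i < n s) g s (k s) (xi i.+1 s w)).

Definition gauss_prod (k : kvec d) w : R := \prod_(s < d) beta s (k s) w.

Lemma coordprod_coord J n (k : kvec d) w : kin M k -> (forall s, k s <= J)%N ->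
  coordprod k (fun sj : 'I_d * 'I_J => coord n sj w) = sample_prod n k w.
Proof.
move=> /kinP hk kJ; apply: coordprodE => s.
  by have := hk s; rewrite /in_range => /andP[-> _]; rewrite kJ.
move=> j jk; rewrite /coord/=; congr (_ * _); apply: eq_bigr => i _.
by rewrite /masked_g jk hk.
Qed.

Lemma coordprod_gcoord J (k : kvec d) w : kin M k -> (forall s, k s <= J)%N ->
  coordprod k (fun sj : 'I_d * 'I_J => gcoord sj w) = gauss_prod k w.
Proof.
move=> /kinP hk kJ; apply: coordprodE => s.
  by have := hk s; rewrite /in_range => /andP[-> _]; rewrite kJ.
by move=> j jk; rewrite /gcoord/= jk hk mul1r.
Qed.

Lemma Lb_sample_prod_n n (k : kvec d) p : (forall s, (0 < n s)%N) -> prange a p -> kin M k ->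
  Lb P p (sample_prod n k) (tu p).
Proof.
move=> n0 pa /kinP hk.
have -> : sample_prod n k = fun w => \prod_(s < d) \sum_(0 <= i < n s)
    (Num.sqrt (n s)%:R)^-1 * g s (k s) (xi i.+1 s w).
  by apply/funext => w; apply: eq_bigr => s _; rewrite mulr_sumr.
apply: (Lb_sample_prod
  (c := fun s _ => (Num.sqrt (n s)%:R)^-1)) => // s.
rewrite sumr_const_nat subn0 exprVn sqr_sqrtr// -[_ *+ _]mulr_natr mulVf//.
by rewrite gt_eqF// ltr0n.
Qed.

Lemma measurable_gauss_prod (k : kvec d) : kin M k -> measurable_fun setT (gauss_prod k).
Proof.
move=> /kinP hk; apply: measurable_prod => s _; have [h _ _] := Hbeta.
by apply: h; have := hk s; rewrite /in_range => /andP[].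
Qed.

(** Truncation at [r + 1] makes the p-th power a bounded and locally Lipschitz function of the
    coordinates, so its mean is the limit of means over samples of size [m + 1], all at most
    [tau(p)^p]. Fatou's lemma then removes the truncation. *)
Lemma Lb_gauss_prod (k : kvec d) p : prange a p -> kin M k -> Lb P' p (gauss_prod k) (tu p).
Proof.
move=> pa hk; have [p2 _] := pa; have p0 : 0 < p by lra.
have t0 : 0 <= tu p.
  by apply: le_trans (tau_ge1 pa).
pose J := \max_(s < d) k s; have kJ s : (k s <= J)%N by exact: leq_bigmax.
pose n (m : nat) (s : 'I_d) := m.+1.
have hn N : exists k0, forall m, (k0 <= m)%N -> forall s, (N <= n m s)%N.
  by exists N => m Nm s; rewrite leqW.
have mG := measurable_gauss_prod hk.
have mabs : measurable_fun setT (fun w => `|gauss_prod k w|) by exact: measurableT_comp.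
suff trunc (r : nat) : Lb P' p (fun w => Num.min `|gauss_prod k w| r.+1%:R) (tu p).
  have : Lb P' p (fun w => `|gauss_prod k w|) (tu p).
    apply: (Lb_lim p0 t0 trunc) => w; apply/cvgrPdist_le => e e0.
    near=> r; rewrite min_l ?subrr ?normr0 ?(ltW e0)//.
    apply: (@le_trans _ _ r%:R); last by rewrite ler_nat.
    by near: r; exact: nbhs_infty_ger.
  by apply: Lb_le => //; [exact: ltW|move=> w; rewrite normr_id].
split; first by apply: measurable_minr => //; exact: measurable_cst.
pose K : R := r.+1%:R; have K0 : 0 < K by [].
have min0 (y : R) : 0 <= Num.min `|y| K <= K by rewrite le_min normr_ge0 ltW//= ge_min lexx orbT.
pose Phi (x : 'I_d * 'I_J -> R) := Num.min `|coordprod k x| K `^ p.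
have PhiB x : `|Phi x| <= K `^ p.
  rewrite ger0_norm ?powR_ge0// ge0_ler_powR ?nnegrE ?(ltW p0) ?(ltW K0)//.
    by have /andP[] := min0 (coordprod k x).
  by have /andP[] := min0 (coordprod k x).
have [L L0 hL] := powR_lip p2 K0.
have := coord_weak hn PhiB.
have PhiL D : 1 <= D -> exists2 L : R, 0 <= L & vlip L (Phi \o clip D).
  move=> D1; have D0 : 0 <= D by lra.
  exists (L * D ^+ d) => [|x y]; first by rewrite mulr_ge0// exprn_ge0.
  rewrite /Phi/=; apply: le_trans (hL _ _ (min0 _) (min0 _)) _.
  rewrite -mulrA ler_wpM2l//.
  apply: (@le_trans _ _ `|coordprod k (clip D x) - coordprod k (clip D y)|).
    by apply: le_trans (min_dist _ _ _) _; exact: ler_dist_dist.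
  apply: le_trans (coordprod_lip k D1 (fun i => clip_le x i D0) (fun i => clip_le y i D0)) _.
  rewrite ler_wpM2l ?exprn_ge0// ler_sum// => i _.
  by apply: le_trans (max_dist _ _ _) _; rewrite ![Num.min D _]minC; exact: min_dist.
move=> /(_ PhiL) cv.
have mPhi dd (S : measurableType dd) (Z : S -> R) : measurable_fun setT Z ->
    measurable_fun setT (fun w => Num.min `|Z w| K `^ p).
  move=> mZ; have mm : measurable_fun setT (fun w => Num.min `|Z w| K).
    by apply: measurable_minr; [exact: measurableT_comp|exact: measurable_cst].
  have := measurable_normp p mm; rewrite (_ : (fun w => (`|_| `^ p)%:E) = EFin \o (fun w => Num.min `|Z w| K `^ p)).
    by move/measurable_EFinP.
  by apply/funext => w /=; rewrite [`|Num.min _ _|]ger0_norm//; have /andP[] := min0 (Z w).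
have bnd m : \int[P]_w Phi (fun sj => coord (n m) sj w) <= tu p `^ p.
  have [mS hS] := Lb_sample_prod_n (n := n m) (fun s => ltn0Sn m) pa hk.
  have E : (fun w => Phi (fun sj => coord (n m) sj w)) =
      (fun w => Num.min `|sample_prod (n m) k w| K `^ p).
    by apply/funext => w; rewrite /Phi coordprod_coord.
  rewrite E -lee_fin -EFin_Rintegral.
    apply: le_trans hS; apply: ge0_le_integral_any => w; first by rewrite lee_fin powR_ge0.
    have /andP[h0 _] := min0 (sample_prod (n m) k w).
    by rewrite lee_fin ge0_ler_powR ?nnegrE ?(ltW p0)// ge_min lexx.
  apply: (@bounded_integrable _ _ _ _ _ (K `^ p)); first exact: mPhi.
  by move=> w; have := PhiB (fun sj => coord (n m) sj w); rewrite /Phi coordprod_coord.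
have : \int[P']_w Phi (fun sj => gcoord sj w) <= tu p `^ p.
  rewrite -(cvg_lim _ cv)//; apply: limr_le; first by apply/cvg_ex; eexists; exact: cv.
  exact: nearW.
have E : (fun w => Phi (fun sj => gcoord sj w)) = (fun w => Num.min `|gauss_prod k w| K `^ p).
  by apply/funext => w; rewrite /Phi coordprod_gcoord.
rewrite E -lee_fin -EFin_Rintegral; last first.
  apply: (@bounded_integrable _ _ _ _ _ (K `^ p)); first exact: mPhi.
  by move=> w; have := PhiB (fun sj => gcoord sj w); rewrite /Phi coordprod_gcoord.
rewrite (_ : (fun w => (`|Num.min `|gauss_prod k w| K| `^ p)%:E) =
  (fun w => (Num.min `|gauss_prod k w| K `^ p)%:E))//.
by apply/funext => w; rewrite [`|Num.min _ _|]ger0_norm//; have /andP[] := min0 (gauss_prod k w).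
Unshelve. all: by end_near. Qed.

Variables (V : Type) (lam : V -> kvec d -> R).
Hypothesis Hsigma : (sigma_lam d M lam < +oo)%E.

Let rho := rho_lam d M lam.
Let l := lcoef M lam.

Definition sample_coef (n : 'I_d -> nat) i w : R := kcoef M (fun k => sample_prod n k w) i.

Definition gauss_coef i w : R := kcoef M (fun k => gauss_prod k w) i.

Lemma moment_bound_kcoef dd (S : measurableType dd) (Q : probability S R) (u : kvec d -> S -> R) :
  (forall p k, prange a p -> kin M k -> Lb Q p (u k) (tu p)) ->
  moment_bound a tu Q (fun i w => kcoef M (fun k => u k w) i).
Proof.
move=> h p i pa; have [p2 _] := pa; have p0 : 0 < p by lra.
rewrite /kcoef; case: pickle_inv => [k|]; last exact: Lb0.
by case: (boolP (kin M k)) => hk; [exact: h|exact: Lb0].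
Qed.

Lemma sample_moment_bound n : (forall s, (0 < n s)%N) -> moment_bound a tu P (sample_coef n).
Proof.
move=> n0; apply: moment_bound_kcoef => p k pa hk.
exact: (Lb_sample_prod_n n0 pa hk).
Qed.

Lemma gauss_moment_bound : moment_bound a tu P' gauss_coef.
Proof.
apply: moment_bound_kcoef => p k pa hk.
exact: (Lb_gauss_prod pa hk).
Qed.

(** Distributivity: a product over [s] of sums over [i] is a sum over choice functions, which is how
    [QL] indexes the points of the parallelepiped. *)
Lemma sample_prodE n (k : kvec d) w : sample_prod n k w =
  (Num.sqrt (\prod_(s < d) (n s)%:R))^-1 *
  \sum_(f : {ffun 'I_d -> 'I_(\max_(s < d) n s).+1} | [forall s, (1 <= f s <= n s)%N])
     \prod_(s < d) g s (k s) (xi (f s) s w).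
Proof.
rewrite /sample_prod big_split/=; congr (_ * _).
  rewrite prodfV; congr (_^-1).
  elim/big_rec2 : _ => [|s x y _ ->]; first by rewrite sqrtr1.
  by rewrite sqrtrM.
rewrite [RHS](eq_bigl (fun f => f \in family (fun s => [pred j : 'I_(\max_(s < d) n s).+1 | (1 <= j <= n s)%N]))); last first.
  move=> f; apply/forallP/familyP => h s; by have := h s.
rewrite -(bigA_distr_big_dep (fun s => [pred j : 'I_(\max_(s < d) n s).+1 | (1 <= j <= n s)%N])
   (fun s j => g s (k s) (xi j s w)))/=.
apply: eq_bigr => s _; have sN : (n s <= \max_(s < d) n s)%N by exact: leq_bigmax.
rewrite -(big_mkord (fun j => (1 <= j <= n s)%N) (fun j => g s (k s) (xi j s w))).
rewrite [RHS]big_ltn_cond//= [RHS]big_add1/= [RHS](eq_bigl (fun i => xpredT i && (i < n s)%N))//.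
by rewrite -big_nat_widen.
Qed.

(** [QL] is a finite sum of series, one for each point of the parallelepiped, each absolutely
    convergent off a null set; off the union of these sets the order of summation may be
    exchanged. *)
Lemma QL_cvg n v : (forall s, (0 < n s)%N) -> exists N : set Omega, [/\ measurable N, P N = 0%E &
  forall w, ~ N w -> psum l (sample_coef n) m v w @[m --> \oo] --> QL xi M g lam n v w].
Proof.
move=> n0; pose T1 : finType := {ffun 'I_d -> 'I_(\max_(s < d) n s).+1}.
pose c (f : T1) := [forall s, (1 <= f s <= n s)%N].
pose Z (f : T1) i w : R := kcoef M (fun k => \prod_(s < d) g s (k s) (xi (f s) s w)) i.
have /choice[N hN] : forall f : T1, exists N : set Omega, [/\ measurable N, P N = 0%E &
    c f -> forall w, ~ N w -> exists B : R, forall m, \sum_(0 <= i < m) `|l i v * Z f i w| <= B].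
  move=> f; case: (boolP (c f)) => [/forallP cf|_]; last by exists set0; split.
  have Zb : moment_bound a tu P (Z f).
    apply: moment_bound_kcoef => p k pa /kinP hk.
    have f0 s : (0 < f s)%N by have /andP[] := cf s.
    (* Unit weight at the index [f s]: a single term is a weighted sum over the first [f s]
       observations. *)
    have c1 s : \sum_(0 <= i < f s) ((i.+1 == f s)%:R : R) ^+ 2 <= 1.
      under eq_bigr do rewrite expr2.
      by rewrite (sum_delta (fun i => (i == f s)%:R)) ?eqxx.
    have := Lb_sample_prod pa f0 c1 hk.
    rewrite (_ : (fun w => _) = fun w => \prod_(s < d) g s (k s) (xi (f s) s w))//.
    apply/funext => w; apply: eq_bigr => s _.
    by rewrite (sum_delta (fun i => g s (k s) (xi i s w))).
  have [N [mN PN h]] := series_bounded_ae Ha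
    (fun p pa => tau_ge1 pa) (lcoef_norm_sum Hsigma) Zb v.
  by exists N; split.
exists (\bigcup_(f in [set: T1]) N f); split.
- by apply: fin_bigcup_measurable => [|f _]; [exact: finite_finset|have [] := hN f].
- apply/eqP; rewrite eq_le measure_ge0 andbT.
  apply: le_trans (measure_bigcup_le _ _) _ => [f|]; first by have [] := hN f.
  by rewrite big1// => f _; have [] := hN f.
move=> w Nw.
have E m : psum l (sample_coef n) m v w = (Num.sqrt (\prod_(s < d) (n s)%:R))^-1 *
    \sum_(f : T1 | c f) \sum_(0 <= i < m) l i v * Z f i w.
  rewrite exchange_big/= mulr_sumr; apply: eq_bigr => i _.
  rewrite -mulr_sumr mulrCA; congr (_ * _); rewrite /sample_coef /Z -kcoef_sum.
  by congr kcoef; apply/funext => k; exact: sample_prodE.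
under eq_fun do rewrite E.
rewrite /QL; apply: cvgMr.
under eq_fun do rewrite big_mkcond/=; rewrite big_mkcond/=.
apply: (@cvg_sum_seq R T1 (index_enum T1) (fun f m => if c f then \sum_(0 <= i < m) l i v * Z f i w else 0)).
move=> f; rewrite -/(c f); case: (boolP (c f)) => cf; last exact: cvg_cst.
have [_ _ /(_ cf w) h] := hN f; have [|B hB] := h; first by move=> Nf; apply: Nw; exists f.
have E' i : kcoef M (fun k => lam v k * \prod_(s < d) g s (k s) (xi (f s) s w)) i = l i v * Z f i w.
  by rewrite (@kcoef_map R d M (lam v) (fun k => \prod_(s < d) g s (k s) (xi (f s) s w)) (fun x y => x * y))// mulr0.
have := @rsum_cvg R d M (fun k => lam v k * \prod_(s < d) g s (k s) (xi (f s) s w)) B.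
rewrite (_ : (fun m => \sum_(0 <= i < m) kcoef M _ i) = fun m => \sum_(0 <= i < m) l i v * Z f i w).
  by apply => m; under eq_bigr do rewrite E'; exact: hB.
by apply/funext => m; apply: eq_bigr => i _; exact: E'.
Qed.

Lemma Qinf_cvg v : exists N : set Omega', [/\ measurable N, P' N = 0%E &
  forall w, ~ N w -> psum l gauss_coef m v w @[m --> \oo] --> Qinf M beta lam v w].
Proof.
have [N [mN PN h]] := series_bounded_ae Ha
  (fun p pa => tau_ge1 pa) (lcoef_norm_sum Hsigma) gauss_moment_bound v.
exists N; split => // w Nw; have [B hB] := h w Nw.
have E i : kcoef M (fun k => lam v k * \prod_(s < d) beta s (k s) w) i = l i v * gauss_coef i w.
  by rewrite (@kcoef_map R d M (lam v) (fun k => gauss_prod k w) (fun x y => x * y))// mulr0.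
have := @rsum_cvg R d M (fun k => lam v k * \prod_(s < d) beta s (k s) w) B.
rewrite (_ : (fun m => \sum_(0 <= i < m) kcoef M _ i) = fun m => psum l gauss_coef m v w).
  by apply => m; under eq_bigr do rewrite E; exact: hB.
by apply/funext => m; apply: eq_bigr => i _; exact: E.
Qed.

Let rho_ge0 := rho_lam_ge0 Hsigma.
Let rho_sym := rho_lam_sym Hsigma.
Let Hl1 := rho_partial Hsigma.
Let Hl2 := lcoef_norm_sum Hsigma.

(** A partial sum involves finitely many index vectors, hence finitely many coordinates, of which a
    Lipschitz functional is a bounded, locally Lipschitz function. *)
Lemma psum_weak (n : nat -> 'I_d -> nat) (F : (V -> R) -> R) (B L : R) (m : nat) :
  (forall N, exists k0, forall k, (k0 <= k)%N -> forall s, (N <= n k s)%N) ->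
  lip_functional rho F B L ->
  \int[P]_w F (fun v => psum l (sample_coef (n k)) m v w) @[k --> \oo] -->
  \int[P']_w F (fun v => psum l gauss_coef m v w).
Proof.
move=> hn [L0 FB FL].
pose top (i : nat) : nat := if (pickle_inv i : option (kvec d)) is Some k then \max_(s < d) k s else 0%N.
pose J := \max_(i < m) top i.
have kJ i (k : kvec d) : (i < m)%N -> (pickle_inv i : option (kvec d)) = Some k -> forall s, (k s <= J)%N.
  move=> im ik s; apply: (@leq_trans (top i)).
    by rewrite /top ik; exact: leq_bigmax.
  exact: (leq_bigmax (Ordinal im)).
pose lin (x : 'I_d * 'I_J -> R) v : R := \sum_(i < m) l i v * kcoef M (fun k => coordprod k x) i.
have linc x : rho_continuous rho (lin x).
  exact: (lin_cont rho_ge0 rho_sym Hl1 (fun i : 'I_m => kcoef M (fun k => coordprod k x) i)).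
have ES k w : (fun v => psum l (sample_coef (n k)) m v w) = lin (fun sj => coord (n k) sj w).
  apply/funext => v; rewrite /psum /pdiff big_mkord; apply: eq_bigr => i _; congr (_ * _).
  apply: kcoef_ext => k' hk ik; rewrite coordprod_coord//; exact: kJ ik.
have EG w : (fun v => psum l gauss_coef m v w) = lin (fun sj => gcoord sj w).
  apply/funext => v; rewrite /psum /pdiff big_mkord; apply: eq_bigr => i _; congr (_ * _).
  apply: kcoef_ext => k' hk ik; rewrite coordprod_gcoord//; exact: kJ ik.
have -> : (fun w => F (fun v => psum l gauss_coef m v w)) =
    (fun w => F (lin (fun sj => gcoord sj w))) by apply/funext => w; rewrite EG.
have -> : (fun k => \int[P]_w F (fun v => psum l (sample_coef (n k)) m v w)) =
    (fun k => \int[P]_w F (lin (fun sj => coord (n k) sj w))).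
  by apply/funext => k; congr (Rintegral _ _ _); apply/funext => w; rewrite ES.
apply: (coord_weak (Phi := fun x => F (lin x)) hn).
  by move=> x; exact: FB.
move=> K K1; have K0 : 0 <= K by lra.
(* Over an empty V all functions coincide, and the Lipschitz constant 0 works. *)
case: (pselect (exists v : V, True)) => [[v0 _]|nv]; last first.
  exists 0 => // x y; rewrite mul0r /=.
  rewrite (_ : lin (clip K x) = lin (clip K y)) ?subrr ?normr0//.
  by apply/funext => v; exfalso; apply: nv; exists v.
have s0 : 0 <= sig M lam by have := Hl2 v0 0; rewrite big_geq.
exists (L * (sig M lam * K ^+ d)) => [|x y]; first by rewrite !mulr_ge0 ?exprn_ge0// ltW.
set D := \sum_i `|x i - y i|; have D0 : 0 <= D by rewrite sumr_ge0.
rewrite /= -mulrA; apply: FL => // v; rewrite /lin -sumrB.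
have KD0 : 0 <= K ^+ d * D by rewrite mulr_ge0 ?exprn_ge0.
apply: (@le_trans _ _ (\sum_(i < m) `|l i v| * (K ^+ d * D))); last first.
  rewrite -mulr_suml -mulrA ler_wpM2r//.
  by have := Hl2 v m; rewrite big_mkord.
apply: le_trans (ler_norm_sum _ _ _) _; apply: ler_sum => i _.
rewrite -mulrBr normrM ler_wpM2l//; apply: kcoef_dist => // k.
apply: le_trans (coordprod_lip k K1 (fun i => clip_le x i K0) (fun i => clip_le y i K0)) _.
rewrite ler_wpM2l ?exprn_ge0//; apply: ler_sum => j _.
by apply: le_trans (max_dist _ _ _) _; rewrite ![Num.min K _]minC; exact: min_dist.
Qed.

Hypothesis Hcomp : rho_compact rho.
Hypothesis HJ : (Jint rho a tu < +oo)%E.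
Variable v0 : V.

Let tu1 p : prange a p -> 1 <= tu p.
Proof. by move=> pa; exact: (tau_ge1 pa). Qed.

(** Both limits are taken along [ms], which tends to infinity since [j <= ms j]; off the two null
    sets they agree. *)
Lemma version_of_limit dd (S : measurableType dd) (Q : probability S R) (W : nat -> S -> R)
  (ms : nat -> nat) (Y : V -> S -> R) (Z : V -> S -> R) N :
  (forall j, (j <= ms j)%N) -> series_version l ms Q W Y N ->
  (forall v, exists N : set S, [/\ measurable N, Q N = 0%E &
     forall w, ~ N w -> psum l W m v w @[m --> \oo] --> Z v w]) ->
  is_version Q Z Y.
Proof.
move=> msj [mN QN _ hY _] hZ v; have [N' [mN' QN' hN']] := hZ v.
exists (N `|` N'); split; first exact: measurableU.
  by apply: null_set_setU.
move=> w YZ; apply: contrapT => /not_orP[Nw N'w]; apply: YZ.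
have c1 : psum l W (ms j) v w @[j --> \oo] --> Y v w.
  apply/cvgrPdist_le => e e0; have [j0 hj0] := hY w Nw e e0.
  by exists j0 => // j /= jj; exact: hj0.
have c2 : psum l W (ms j) v w @[j --> \oo] --> Z v w.
  apply/cvgrPdist_le => e e0; move/cvgrPdist_le: (hN' w N'w) => /(_ e e0) [m0 _ hm].
  by exists m0 => // j /= jj; apply: hm => /=; exact: leq_trans (msj j).
exact: (cvg_unique _ c1 c2).
Qed.

Lemma nclt_nonempty : exists (Y : ('I_d -> nat) -> V -> Omega -> R) (Yinf : V -> Omega' -> R),
    [/\ (forall n : 'I_d -> nat, (forall s, (1 <= n s)%N) ->
           is_version P (QL xi M g lam n) (Y n) /\ cont_paths rho (Y n)),
        is_version P' (Qinf M beta lam) Yinf /\ cont_paths rho Yinf,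
        (forall F : (V -> R) -> R, bounded_continuous_functional rho F ->
           forall e : R, 0 < e -> exists N : nat, forall n : 'I_d -> nat,
             (forall s, (1 <= n s)%N && (N <= n s)%N) ->
             (`| \int[P]_w (F (fun v => Y n v w))%:E
                 - \int[P']_w (F (fun v => Yinf v w))%:E | < e%:E)%E) &
        exists C : R, forall n : 'I_d -> nat, (forall s, (1 <= n s)%N) ->
          (Gnorm P a tu (fun w => sup [set Y n v w | v in [set: V]])
             <= C%:E)%E].
Proof.
have [ms Hms msj] := tail_levels_exists (rho_lam_refl Hsigma) rho_ge0 rho_sym (rho_lam_tri Hsigma)
  Hcomp Ha tu1 HJ v0 Hl1 Hl2.
(* The moment bound is available only for positive side lengths; otherwise the field is set to 0. *)
have /choice[Y hY] : forall n : 'I_d -> nat, exists Y : V -> Omega -> R,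
    (forall s, (0 < n s)%N) -> exists N, series_version l ms P (sample_coef n) Y N.
  move=> n; have [n0|n0] := pselect (forall s, (0 < n s)%N); last by exists (fun _ _ => 0).
  by have [Y [N YN]] := series_version_exists Hms (sample_moment_bound n0); exists Y => _; exists N.
have [Yinf [Ninf YNinf]] := series_version_exists Hms gauss_moment_bound.
exists Y, Yinf; split.
- move=> n n0; have [N YN] := hY n n0; split; last exact: (version_cont rho_ge0 rho_sym Hl1 YN).
  by apply: version_of_limit msj YN _ => v; exact: QL_cvg.
- split; last exact: (version_cont rho_ge0 rho_sym Hl1 YNinf).
  by apply: version_of_limit msj YNinf _ => v; exact: Qinf_cvg.
(* If no [N] worked, one counterexample for each [k] would give a sequence of parallelepipeds with
   all sides tending to infinity; so convergence along such sequences suffices. *)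
- move=> F bF e e0; apply: contrapT => hcontra.
  have /choice[n hn] : forall k : nat, exists n : 'I_d -> nat, (forall s, (1 <= n s)%N && (k <= n s)%N) /\
     ~ (`| \int[P]_w (F (fun v => Y n v w))%:E
                 - \int[P']_w (F (fun v => Yinf v w))%:E | < e%:E)%E.
    move=> k; apply: contrapT => hk; apply: hcontra; exists k => n hn.
    by apply: contrapT => h; apply: hk; exists n.
  have n0 k s : (0 < n k s)%N by have /andP[] := (hn k).1 s.
  have ninf N : exists k0, forall k, (k0 <= k)%N -> forall s, (N <= n k s)%N.
    by exists N => k Nk s; apply: leq_trans Nk _; have /andP[] := (hn k).1 s.
  have /choice[NN hNN] : forall k, exists N, series_version l ms P (sample_coef (n k)) (Y (n k)) N.
    by move=> k; exact: hY.
  have mb k := sample_moment_bound (n0 k).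
  have cv : \int[P]_w F (fun v => Y (n k) v w) @[k --> \oo] --> \int[P']_w F (fun v => Yinf v w).
    apply: (@portmanteau _ _ rho v0 _ _ _ _ P P' (fun k => Y (n k)) Yinf) => //.
    + by move=> k; exact: (version_cont rho_ge0 rho_sym Hl1 (hNN k)).
    + exact: (version_cont rho_ge0 rho_sym Hl1 YNinf).
    + by move=> G k bG; exact: (bcf_measurable rho_ge0 rho_sym Ha v0 Hl1 Hl2 (mb k) (hNN k) bG).
    + by move=> G bG; exact: (bcf_measurable rho_ge0 rho_sym Ha v0 Hl1 Hl2 gauss_moment_bound YNinf bG).
    move=> G B L lG; have [L0 _ _] := lG; apply/cvgrPdist_le => e' e'0.
    (* Three errors of at most [e' / 3]: truncation of the sample series, the finite-dimensional
       limit, truncation of the Gaussian series. The level [j] is fixed before [k]. *)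
    have [j hj] : exists j, L * (2 * dyad j) <= e' / 3.
      have hd : dyad j @[j --> \oo] --> (0 : R).
        by apply: cvg_expr; rewrite ger0_norm ?invr_ge0// invf_lt1// ltr1n.
      have e20 : 0 < e' / 3 / L / 2 by rewrite !divr_gt0.
      move/cvgrPdist_le: hd => /(_ _ e20) [j _ /(_ j (leqnn j))].
      rewrite sub0r normrN ger0_norm ?(ltW (dyad_gt0 _))// => hj; exists j.
      by rewrite mulrC -ler_pdivlMr// mulrC -ler_pdivlMr.
    have e30 : 0 < e' / 3 by rewrite divr_gt0.
    move/cvgrPdist_le: (psum_weak (m := ms j) ninf lG) => /(_ _ e30) [k0 _ hk0].
    exists k0 => // k /= kk; have := hk0 k kk.
    have := lip_approx rho_ge0 rho_sym Ha v0 Hl1 Hl2 (mb k) (hNN k) j lG.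
    have := lip_approx rho_ge0 rho_sym Ha v0 Hl1 Hl2 gauss_moment_bound YNinf j lG.
    rewrite !ler_norml => /andP[a1 a2] /andP[a3 a4] /andP[a5 a6]; apply/andP; split; lra.
  move/cvgrPdist_lt: cv => /(_ _ e0) [k _ /(_ k (leqnn k)) hk].
  apply: (hn k).2.
  rewrite EFin_Rintegral; last exact: (bcf_integrable rho_ge0 rho_sym Ha v0 Hl1 Hl2 (mb k) (hNN k) bF).
  rewrite EFin_Rintegral; last exact: (bcf_integrable rho_ge0 rho_sym Ha v0 Hl1 Hl2 gauss_moment_bound YNinf bF).
  by rewrite -EFinB lte_fin distrC.
have [C C0 hC] := version_sup_bound (rho_lam_refl Hsigma) rho_ge0 rho_sym (rho_lam_tri Hsigma)
  Hcomp Ha tu1 HJ v0 Hl1 Hl2 ms.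
exists C => n n0; have [N YN] := hY n n0.
apply: ge_ereal_sup => _ [p pa <-].
have tp := tu1 pa; have tp0 : 0 < tu p by lra.
have := hC _ _ P _ _ _ (sample_moment_bound n0) YN p pa.
move=> /(@lee_wpmul2r _ (tu p)^-1%:E); rewrite lee_fin invr_ge0 (ltW tp0) => /(_ isT).
by rewrite -[X in (_ <= X)%E]EFinM mulrAC mulfV ?mul1r// gt_eqF.
Qed.

End Orthonormal.

End Sample.

(** * Degenerate cases and conclusion *)

Lemma in_range_empty (M : option nat) j : ~~ in_range M 1 -> in_range M j = false.
Proof. by case: M => // -[|m] // _; case: j. Qed.

(** Serves the cases of an empty index set and of an empty V. In the latter the supremum is over an
    empty set and equals 0 by convention. *)
Lemma nclt_zero {R : realType} d d' (T : measurableType d) (T' : measurableType d')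
  (P : probability T R) (P' : probability T' R) (I V : Type) (rho : V -> V -> R)
  (a : \bar R) (tu : R -> R) (adm : I -> Prop) (big : nat -> I -> Prop)
  (Q : I -> V -> T -> R) (Qinf : V -> T' -> R) :
  (forall n v w, Q n v w = 0) -> (forall v w, Qinf v w = 0) ->
  exists (Y : I -> V -> T -> R) (Yinf : V -> T' -> R),
    [/\ (forall n, adm n -> is_version P (Q n) (Y n) /\ cont_paths rho (Y n)),
        is_version P' Qinf Yinf /\ cont_paths rho Yinf,
        (forall F : (V -> R) -> R, bounded_continuous_functional rho F ->
           forall e : R, 0 < e -> exists N : nat, forall n, big N n ->
             (`| \int[P]_w (F (fun v => Y n v w))%:E
                 - \int[P']_w (F (fun v => Yinf v w))%:E | < e%:E)%E) &
        exists C : R, forall n, adm n ->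
          (Gnorm P a tu (fun w => sup [set Y n v w | v in [set: V]]) <= C%:E)%E].
Proof.
move=> Q0 Qinf0; exists (fun _ _ _ => 0), (fun _ _ => 0).
have c0 (S : Type) : cont_paths rho (fun (_ : V) (_ : S) => 0 : R).
  by move=> w v e e0; exists 1 => // u _; rewrite subrr normr0.
split.
- by move=> n _; split => // v; exists set0; split => // w; rewrite Q0.
- by split => // v; exists set0; split => // w; rewrite Qinf0.
- by move=> F _ e e0; exists 0%N => n _; rewrite !integral_prob_cst -EFinB subrr abse0 lte_fin.
exists 0 => n _; apply: ge_ereal_sup => _ [p [p2 _] <-].
have p0 : 0 < p by lra.
have -> : (fun _ : T => sup [set (0 : R) | _ in [set: V]]) = cst 0.
  apply/funext => w; case: (pselect (exists v : V, True)) => [[v _]|nv].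
    rewrite (_ : [set _ | _ in _] = [set 0]) ?sup1//.
    by apply/seteqP; split => [_ [_ _ <-]//|_ ->]; exists v.
  rewrite (_ : [set _ | _ in _] = set0) ?sup0//.
  by apply/seteqP; split => // r [v _ _]; case: nv; exists v.
have h1 := Lb_pnorm p0 (lexx 0) (Lb0 P 0 p0).
have h0 : (0 <= pnorm P p (cst 0%R))%E by exact: Lnorm_ge0.
by rewrite (_ : pnorm P p _ = 0%E) ?mul0e//; apply/eqP; rewrite eq_le h1 h0.
Qed.

Unset Implicit Arguments.
Set Strict Implicit.
Set Printing Implicit Defensive.

Theorem theorem8p2 (R : realType) (d : nat) (hd : (0 < d)%N)
  (* the probability spaces (X_s, B_s, mu_s) *)
  (dX : 'I_d -> measure_display) (X : forall s, measurableType (dX s))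
  (mu : forall s, probability (X s) R)
  (* the random variables xi_i(s), i >= 1, on a probability space *)
  (dO : measure_display) (Omega : measurableType dO)
  (P : probability Omega R) (xi : nat -> forall s, Omega -> X s)
  (Hxi_meas : forall i s, (1 <= i)%N -> measurable_fun setT (xi i s))
  (Hxi_law : forall i s (A : set (X s)), (1 <= i)%N -> measurable A ->
     P (xi i s @^-1` A) = mu s A)
  (Hxi_indep : indep_xi P xi)
  (* the orthonormal systems g^(s)_1, g^(s)_2, ... (j <= M) *)
  (M : option nat) (g : forall s, nat -> X s -> R)
  (Hg : forall s j, in_range M j ->
     [/\ measurable_fun setT (g s j),
         (mu s).-integrable setT (fun x => (g s j x)%:E),
         (mu s).-integrable setT (fun x => (g s j x ^+ 2)%:E) &
         (\int[mu s]_x (g s j x)%:E = 0)%E])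
  (Horth : forall s j j', in_range M j -> in_range M j' ->
     (\int[mu s]_x (g s j x * g s j' x)%:E)%E = ((j == j')%:R)%:E)
  (* the parameter set and coefficients *)
  (V : Type) (lam : V -> kvec d -> R)
  (Hsigma : (sigma_lam d M lam < +oo)%E)
  (Hcomp : rho_compact (rho_lam d M lam))
  (* the Gaussian variables beta^(s)(j) defining Q_oo *)
  (dO' : measure_display) (Omega' : measurableType dO')
  (P' : probability Omega' R) (beta : 'I_d -> nat -> Omega' -> R)
  (Hbeta : std_gauss_family P' beta)
  (* the moment assumptions *)
  (a : \bar R) (Ha : (2%:E < a)%E)
  (HG : forall p, prange a p -> (Gfun P xi M g p < +oo)%E)
  (HJ : (Jint (rho_lam d M lam) a (tau d (Gfun P xi M g)) < +oo)%E) :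
  let rho := rho_lam d M lam in
  let tu := tau d (Gfun P xi M g) in
  exists (Y : ('I_d -> nat) -> V -> Omega -> R) (Yinf : V -> Omega' -> R),
    [/\ (* continuous versions of Q_L[f] *)
        (forall n : 'I_d -> nat, (forall s, (1 <= n s)%N) ->
           is_version P (QL xi M g lam n) (Y n) /\ cont_paths rho (Y n)),
        (* continuous version of Q_oo *)
        is_version P' (Qinf M beta lam) Yinf /\ cont_paths rho Yinf,
        (* NCLT in C(V, rho) *)
        (forall F : (V -> R) -> R, bounded_continuous_functional rho F ->
           forall e : R, 0 < e -> exists N : nat, forall n : 'I_d -> nat,
             (forall s, (1 <= n s)%N && (N <= n s)%N) ->
             (`| \int[P]_w (F (fun v => Y n v w))%:E
                 - \int[P']_w (F (fun v => Yinf v w))%:E | < e%:E)%E) &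
        (* sup_L || sup_v Q_L[f](v) || G tau < oo *)
        exists C : R, forall n : 'I_d -> nat, (forall s, (1 <= n s)%N) ->
          (Gnorm P a tu (fun w => sup [set Y n v w | v in [set: V]])
             <= C%:E)%E].
Proof.
(* If 1 is out of range then [M] is 0; as [d > 0], no index vector remains and every series is 0. *)
move=> rho tu; case: (boolP (in_range M 1)) => HM; last first.
  have K0 : Kset M = set0 :> set (kvec d).
    apply/seteqP; split => // k /(_ (Ordinal hd)).
    by rewrite (in_range_empty _ HM).
  have r0 u : rsum (@Kset d M) u = 0 :> R by rewrite /rsum K0 !esum_set0 subrr.
  apply: nclt_zero => [n v w|v w]; last exact: r0.
  rewrite /QL [X in _ * X]big1 ?mulr0// => k _; exact: r0.
case: (pselect (exists v : V, True)) => [[v0 _]|nv]; last first.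
  by apply: nclt_zero => [n v|v]; case: nv; exists v.
exact: (nclt_nonempty Hxi_meas Hxi_law Hxi_indep Hg Horth HM Ha HG Hbeta Hsigma Hcomp HJ v0).
Qed.
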